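(* Let $0<p<1$ and suppose that $f(z)=z+a_2z^2+a_3z^3+\cdots$ is a function in $\mathcal{C}o_p$. Then the following sharp inequality holds: $$|a_3-a_2^2|\le 1,$$ where sharp means that equality holds for some function in $\mathcal{C}o_p$.
   Context: $\mathbb{D}=\{z\in\mathbb{C}:|z|<1\}$. For $0<p<1$, $\mathcal{C}o_p$ denotes the class of concave functions with pole at $p$: the univalent (injective) meromorphic functions $f$ on $\mathbb{D}$ such that $\mathbb{C}\setminus f(\mathbb{D})$ is convex, $f(0)=0$, $f'(0)=1$, and $f$ has a pole at $p$. The expansion of $f$ is its Taylor series at the origin, valid for $|z|<p$. *)

(* Defs.v *)
(* Stdlib reals with Coquelicot. *)
From Stdlib Require Import Reals.
From Coquelicot Require Import Coquelicot.

Open Scope R_scope.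

Definition unit_disc (z : C) : Prop := Cmod z < 1.

(* The Riemann sphere; [None] is the point at infinity.  A meromorphic function
   is a map [C -> sphere] of which only the values on its domain matter. *)
Definition sphere : Type := option C.

(* The value 0 at infinity is a dummy. *)
Definition finite_part (f : C -> sphere) (z : C) : C :=
  match f z with Some w => w | None => RtoC 0 end.

Definition finite_differentiable (f : C -> sphere) (z : C) : Prop :=
  f z <> None /\ ex_derive (finite_part f) z.

Definition holomorphic_at (f : C -> sphere) (z0 : C) : Prop :=
  locally z0 (finite_differentiable f).

(* [locally'] is the filter of punctured neighbourhoods, so a pole is an
   isolated singularity at which |f| tends to infinity. *)
Definition pole_at (f : C -> sphere) (z0 : C) : Prop :=
  f z0 = None /\
  locally' z0 (finite_differentiable f) /\
  filterlim (fun z => Cmod (finite_part f z)) (locally' z0) (Rbar_locally p_infty).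

Definition meromorphic_on (D : C -> Prop) (f : C -> sphere) : Prop :=
  forall z : C, D z -> holomorphic_at f z \/ pole_at f z.

Definition injective_on (D : C -> Prop) (f : C -> sphere) : Prop :=
  forall z w : C, D z -> D w -> f z = f w -> z = w.

(* The finite plane minus [f(D)]. *)
Definition omitted_set (D : C -> Prop) (f : C -> sphere) (w : C) : Prop :=
  ~ exists z : C, D z /\ f z = Some w.

Definition convex (E : C -> Prop) : Prop :=
  forall (u v : C) (t : R), E u -> E v -> 0 <= t <= 1 ->
    E (RtoC t * u + RtoC (1 - t) * v)%C.

(* In [concave_normalized], [f 0] is finite, so 0 is not a pole and
   [finite_part f] agrees with [f] near 0 for meromorphic [f]. *)
Record concave_normalized (p : R) (f : C -> sphere) : Prop := {
  concave_meromorphic : meromorphic_on unit_disc f;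
  concave_univalent : injective_on unit_disc f;
  concave_complement : convex (omitted_set unit_disc f);
  concave_zero : f (RtoC 0) = Some (RtoC 0);
  concave_derive : is_derive (finite_part f) (RtoC 0) (RtoC 1);
  concave_pole : pole_at f (RtoC p)
}.

(* [f] is the sum of the power series [a] on the disc [|z| < p]; the [a n] are
   then its Taylor coefficients at 0. *)
Definition expansion (p : R) (f : C -> sphere) (a : nat -> C) : Prop :=
  forall z : C, Cmod z < p ->
    exists w : C, f z = Some w /\ is_pseries a z w.

(* Main.v *)
Require Import Defs.
From Stdlib Require Import Reals Lra Lia Psatz Classical ClassicalEpsilon.
From Coquelicot Require Import Coquelicot.

(** Put [G = 1 / f], with value 0 at the pole. Then [G(z) = 1 / z + q(z)] is
    injective on the punctured disc, [q] is continuous on the disc, and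
    [q'(0) = b] with [b = a_2^2 - a_3], so the claim is [|b| <= 1]. This is the
    coefficient bound of Gronwall's area theorem. Instead of the area of the
    complement of the image, the proof uses the definiteness of the
    logarithmic energy of charges placed on the images of circles:

    - If the real function [c] has mean 0, the double integral of
      [c(s) c(t) ln (|w(s) - w(t)|^2 + eps^2)] is at most 0
      ([log_energy_nonpos]). Stereographic projection turns
      [|w - w'|^2 + eps^2] into a product of a function of [w], a function of
      [w'] and [1 - <v, v'>], where [v, v'] lie in the open unit ball of R^3;
      the first two factors drop out, and [- ln (1 - <v, v'>)] is a power series
      with positive coefficients in a positive semidefinite kernel.

    - For [|z| = r < |w|], injectivity says that [z (G(z) - G(w))] has no zero in
      the disc [|z| < |w|]; it has value 1 at 0. So it has a holomorphic
      logarithm, and the mean of [c(t) ln |G(r e^(i t)) - G(w)|] is determined by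
      the derivative [q(0) - G(w)] at 0 ([log_distance_means]). When [c] is the
      first harmonic [wave u], a second integration along [|w| = s] gives the
      mutual energy of the circles of radii [r < s]: it is a negative multiple of
      [r / s + r s Re (b conj(u)^2)] ([energy_0]).

    If [|b| > 1], a suitable [u] makes this expression negative for [r, s] close
    to 1. Then, for small [eps], any two distinct circles of a large finite family
    have mutual energy at least some [kap > 0], while the self-energies stay bounded
    below as [eps] tends to 0 ([energy_diag_bound]). The total energy of the family is
    then positive, contrary to the first point ([coefficient_half_plane]). Mixing
    many radii avoids every estimate of [G(z) - G(w)] near the diagonal.

    The only complex analysis needed is the mean value property [circle_mean],
    for continuous functions on a disc that are differentiable off the slit
    [[0, 1[]: the removable singularities of [q] at 0 and at the pole lie on this
    slit. It follows from Goursat's theorem on rectangles in the coordinate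
    [log z], where the slit becomes two opposite sides of the rectangle.

    Equality holds for [f(z) = z / ((1 - z / p) (1 - p z))]: here
    [1 / f(z) = z + 1 / z - (p + 1 / p)], so [b = 1], and [f] omits exactly a
    real segment because [z + 1 / z] maps the disc onto the complement of
    [[-2, 2]]. *)

(** * Continuity and derivatives of complex functions *)

Lemma continuous_C {U : UniformSpace} (f : U -> C) (x : U) :
  continuous (fun t => Re (f t)) x -> continuous (fun t => Im (f t)) x ->
  continuous f x.
Proof.
  intros H1 H2 P [eps HP].
  assert (K1 := H1 _ (locally_ball (Re (f x)) eps)).
  assert (K2 := H2 _ (locally_ball (Im (f x)) eps)).
  unfold filtermap in *.
  generalize (filter_and _ _ K1 K2); apply filter_imp; intros t [A B].
  apply HP; split; assumption.
Qed.

Lemma continuous_Re (z : C) : continuous Re z.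
Proof. destruct z; apply continuous_fst. Qed.

Lemma continuous_Im (z : C) : continuous Im z.
Proof. destruct z; apply continuous_snd. Qed.

Section ContinuityRules.
Context {U : UniformSpace}.
Implicit Types (f g : U -> C) (x : U).

Lemma continuous_Re_comp f x : continuous f x -> continuous (fun t => Re (f t)) x.
Proof. intros H; apply (continuous_comp f Re); [exact H | apply continuous_Re]. Qed.

Lemma continuous_Im_comp f x : continuous f x -> continuous (fun t => Im (f t)) x.
Proof. intros H; apply (continuous_comp f Im); [exact H | apply continuous_Im]. Qed.

Lemma continuous_Cplus f g x :
  continuous f x -> continuous g x -> continuous (fun t => f t + g t)%C x.
Proof.
  intros Hf Hg; apply continuous_C; simpl.
  - apply (continuous_plus (fun t => Re (f t)) (fun t => Re (g t)));
      now apply continuous_Re_comp.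
  - apply (continuous_plus (fun t => Im (f t)) (fun t => Im (g t)));
      now apply continuous_Im_comp.
Qed.

Lemma continuous_Copp f x : continuous f x -> continuous (fun t => - f t)%C x.
Proof.
  intros Hf; apply continuous_C; simpl.
  - apply (continuous_opp (fun t => Re (f t))); now apply continuous_Re_comp.
  - apply (continuous_opp (fun t => Im (f t))); now apply continuous_Im_comp.
Qed.

Lemma continuous_Cminus f g x :
  continuous f x -> continuous g x -> continuous (fun t => f t - g t)%C x.
Proof.
  intros Hf Hg; apply continuous_Cplus; [assumption | now apply continuous_Copp].
Qed.

Lemma continuous_Cmult f g x :
  continuous f x -> continuous g x -> continuous (fun t => f t * g t)%C x.
Proof.
  intros Hf Hg; apply continuous_C; simpl.
  - apply (continuous_minus (fun t => Re (f t) * Re (g t)) (fun t => Im (f t) * Im (g t)));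
      apply (continuous_mult (K := R_AbsRing));
      (now apply continuous_Re_comp) || now apply continuous_Im_comp.
  - apply (continuous_plus (fun t => Re (f t) * Im (g t)) (fun t => Im (f t) * Re (g t)));
      apply (continuous_mult (K := R_AbsRing));
      (now apply continuous_Re_comp) || now apply continuous_Im_comp.
Qed.

Lemma continuous_Rmult (h k : U -> R) x :
  continuous h x -> continuous k x -> continuous (fun t => h t * k t) x.
Proof. exact (continuous_mult (K := R_AbsRing) h k x). Qed.

Lemma continuous_Rplus (h k : U -> R) x :
  continuous h x -> continuous k x -> continuous (fun t => h t + k t) x.
Proof. exact (continuous_plus (K := R_AbsRing) h k x). Qed.

Lemma continuous_Rminus (h k : U -> R) x :
  continuous h x -> continuous k x -> continuous (fun t => h t - k t) x.
Proof. exact (continuous_minus (K := R_AbsRing) h k x). Qed.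

Lemma continuous_Rinv_comp (h : U -> R) x :
  continuous h x -> h x <> 0 -> continuous (fun t => / h t) x.
Proof. intros H1 H2; apply (continuous_comp h Rinv); [|apply continuous_Rinv]; assumption. Qed.

Lemma continuous_Cmod_sqr f x :
  continuous f x -> continuous (fun t => Cmod (f t) ^ 2) x.
Proof.
  intros H.
  apply (continuous_ext (fun t => Re (f t) * Re (f t) + Im (f t) * Im (f t))).
  - intros t; rewrite Cmod2_alt; simpl; ring.
  - apply continuous_Rplus; apply continuous_Rmult;
      (now apply continuous_Re_comp) || now apply continuous_Im_comp.
Qed.

Lemma continuous_Cmod f x :
  continuous f x -> continuous (fun t => Cmod (f t)) x.
Proof.
  intros H.
  apply (continuous_ext (fun t => sqrt (Cmod (f t) ^ 2))).
  - intros t; apply sqrt_pow2, Cmod_ge_0.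
  - apply (continuous_comp (fun t => Cmod (f t) ^ 2) sqrt);
      [now apply continuous_Cmod_sqr | apply continuous_sqrt].
Qed.

Lemma continuous_Cinv f x :
  continuous f x -> f x <> 0%C -> continuous (fun t => / f t)%C x.
Proof.
  intros H Hx.
  assert (N : Re (f x) ^ 2 + Im (f x) ^ 2 <> 0).
  { rewrite <- Cmod2_alt; apply pow_nonzero; intros E; apply Hx, Cmod_eq_0, E. }
  assert (D : continuous (fun t => Re (f t) ^ 2 + Im (f t) ^ 2) x).
  { apply (continuous_ext (fun t => Cmod (f t) ^ 2));
      [intros t; apply Cmod2_alt | now apply continuous_Cmod_sqr]. }
  apply continuous_C; simpl; unfold Rdiv; apply continuous_Rmult.
  - now apply continuous_Re_comp.
  - now apply continuous_Rinv_comp.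
  - apply (continuous_opp (fun t => Im (f t))); now apply continuous_Im_comp.
  - now apply continuous_Rinv_comp.
Qed.

End ContinuityRules.

(** Product balls and discs define the same neighbourhoods; the estimates
    below are all made with the modulus. *)
Lemma locally_Cmod (z : C) (P : C -> Prop) :
  locally z P <-> exists d : R, 0 < d /\ forall w, Cmod (w - z) < d -> P w.
Proof.
  split.
  - intros [d Hd]; exists d; split; [apply cond_pos|].
    intros w Hw; apply Hd; apply C_NormedModule_mixin_compat1; exact Hw.
  - intros [d [Hd H]].
    assert (Hs : 0 < sqrt 2) by (apply sqrt_lt_R0; lra).
    assert (Hd' : 0 < d / sqrt 2) by (apply Rdiv_lt_0_compat; assumption).
    exists (mkposreal _ Hd'); intros w Hw; apply H.
    replace d with (sqrt 2 * (d / sqrt 2)) by (field; lra).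
    apply (C_NormedModule_mixin_compat2 z w (mkposreal _ Hd')), Hw.
Qed.

Lemma continuous_CC_iff (f : C -> C) (z : C) :
  continuous f z <->
  forall eps, 0 < eps ->
    exists d, 0 < d /\ forall w, Cmod (w - z) < d -> Cmod (f w - f z) < eps.
Proof.
  split.
  - intros H eps He.
    apply (locally_Cmod z (fun w => Cmod (f w - f z) < eps)).
    refine (H (fun v => Cmod (v - f z) < eps) _).
    apply locally_Cmod. exists eps; split; [exact He | tauto].
  - intros H P HP.
    apply locally_Cmod in HP as [e [He HP]].
    destruct (H e He) as [d [Hd K]].
    apply locally_Cmod; exists d; split; [exact Hd|]; intros w Hw; apply HP, K, Hw.
Qed.

Lemma is_derive_CC_iff (f : C -> C) (z l : C) :
  is_derive f z l <->
  forall eps, 0 < eps ->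
    exists d, 0 < d /\ forall w, Cmod (w - z) < d ->
      Cmod (f w - f z - (w - z) * l) <= eps * Cmod (w - z).
Proof.
  split.
  - intros [_ H] eps He.
    assert (K := H z (fun P HP => HP) (mkposreal eps He)); simpl in K.
    apply locally_C, locally_Cmod in K; exact K.
  - intros H; split; [apply is_linear_scal_l|].
    intros x' Hx'.
    apply (is_filter_lim_locally_unique (K := C_AbsRing) (V := AbsRing_NormedModule C_AbsRing))
      in Hx'; subst x'.
    intros [eps He]; apply locally_C, locally_Cmod; exact (H eps He).
Qed.

Lemma ex_derive_CC_continuous (f : C -> C) (z : C) : ex_derive f z -> continuous f z.
Proof.
  intros [l H]. apply continuous_CC_iff. intros eps He.
  assert (HL := Cmod_ge_0 l).
  destruct (proj1 (is_derive_CC_iff f z l) H 1 Rlt_0_1) as [d [Hd K]].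
  exists (Rmin d (eps / (2 + Cmod l))); split.
  { apply Rmin_glb_lt; [exact Hd | apply Rdiv_lt_0_compat; lra]. }
  intros w Hw.
  assert (W1 : Cmod (w - z) < d) by (eapply Rlt_le_trans; [exact Hw | apply Rmin_l]).
  assert (W2 : Cmod (w - z) < eps / (2 + Cmod l))
    by (eapply Rlt_le_trans; [exact Hw | apply Rmin_r]).
  apply (Rmult_lt_compat_l (2 + Cmod l)) in W2; [|lra].
  replace ((2 + Cmod l) * (eps / (2 + Cmod l))) with eps in W2 by (field; lra).
  replace (f w - f z)%C with ((f w - f z - (w - z) * l) + (w - z) * l)%C by ring.
  eapply Rle_lt_trans; [apply Cmod_triangle|]. rewrite Cmod_mult.
  specialize (K w W1). assert (W0 := Cmod_ge_0 (w - z)). nra.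
Qed.

Lemma is_derive_CC_ext_loc (f g : C -> C) (z l : C) :
  locally z (fun w => f w = g w) -> is_derive f z l -> is_derive g z l.
Proof.
  intros H. apply is_derive_ext_loc. apply locally_C in H; exact H.
Qed.

Lemma ex_derive_CC_ext_loc (f g : C -> C) (z : C) :
  locally z (fun w => f w = g w) -> ex_derive f z -> ex_derive g z.
Proof.
  intros H [l Hl]; exists l; now apply (is_derive_CC_ext_loc f g).
Qed.

Lemma is_derive_CC_eq (f : C -> C) (z l m : C) :
  is_derive f z l -> l = m -> is_derive f z m.
Proof. now intros H <-. Qed.

Lemma is_derive_Cid (z : C) : is_derive (fun w : C => w) z (RtoC 1).
Proof.
  apply is_derive_CC_iff; intros eps He; exists 1; split; [lra|]; intros w _.
  replace (w - z - (w - z) * 1)%C with (RtoC 0) by ring.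
  rewrite Cmod_0; apply Rmult_le_pos; [lra | apply Cmod_ge_0].
Qed.

Lemma is_derive_Cconst (c z : C) : is_derive (fun _ : C => c) z (RtoC 0).
Proof.
  apply is_derive_CC_iff; intros eps He; exists 1; split; [lra|]; intros w _.
  replace (c - c - (w - z) * 0)%C with (RtoC 0) by ring.
  rewrite Cmod_0; apply Rmult_le_pos; [lra | apply Cmod_ge_0].
Qed.

Lemma is_derive_Cplus (f g : C -> C) (z l m : C) :
  is_derive f z l -> is_derive g z m -> is_derive (fun w => f w + g w)%C z (l + m)%C.
Proof. intros Hf Hg. exact (is_derive_plus (V := C_NormedModule) f g z l m Hf Hg). Qed.

Lemma is_derive_Copp (f : C -> C) (z l : C) :
  is_derive f z l -> is_derive (fun w => - f w)%C z (- l)%C.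
Proof. intros Hf. exact (is_derive_opp (V := C_NormedModule) f z l Hf). Qed.

Lemma is_derive_Cmult (f g : C -> C) (z l m : C) :
  is_derive f z l -> is_derive g z m ->
  is_derive (fun w => f w * g w)%C z (l * g z + f z * m)%C.
Proof.
  intros Hf Hg. apply is_derive_CC_iff; intros eps He.
  assert (Cg : continuous g z) by (apply ex_derive_CC_continuous; now exists m).
  assert (A0 := Cmod_ge_0 l); assert (B0 := Cmod_ge_0 (f z)); assert (G0 := Cmod_ge_0 (g z)).
  set (e := eps / (2 + Cmod l + Cmod (f z) + Cmod (g z))).
  assert (He' : 0 < e) by (apply Rdiv_lt_0_compat; lra).
  assert (Ee : e * (2 + Cmod l + Cmod (f z) + Cmod (g z)) = eps)
    by (unfold e; field; lra).
  set (e1 := Rmin 1 e).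
  assert (He1 : 0 < e1) by (apply Rmin_glb_lt; lra).
  assert (e1a : e1 <= 1) by apply Rmin_l. assert (e1b : e1 <= e) by apply Rmin_r.
  destruct (proj1 (is_derive_CC_iff f z l) Hf e1 He1) as [d1 [Hd1 K1]].
  destruct (proj1 (is_derive_CC_iff g z m) Hg e1 He1) as [d2 [Hd2 K2]].
  destruct (proj1 (continuous_CC_iff g z) Cg e1 He1) as [d3 [Hd3 K3]].
  exists (Rmin d1 (Rmin d2 d3)); split; [repeat apply Rmin_glb_lt; assumption|].
  intros w Hw.
  assert (W1 : Cmod (w - z) < d1) by (eapply Rlt_le_trans; [exact Hw | apply Rmin_l]).
  assert (W23 : Cmod (w - z) < Rmin d2 d3) by (eapply Rlt_le_trans; [exact Hw | apply Rmin_r]).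
  assert (W2 : Cmod (w - z) < d2) by (eapply Rlt_le_trans; [exact W23 | apply Rmin_l]).
  assert (W3 : Cmod (w - z) < d3) by (eapply Rlt_le_trans; [exact W23 | apply Rmin_r]).
  specialize (K1 w W1); specialize (K2 w W2); specialize (K3 w W3).
  replace (f w * g w - f z * g z - (w - z) * (l * g z + f z * m))%C
    with ((f w - f z - (w - z) * l) * (g w - g z)
          + (f w - f z - (w - z) * l) * g z
          + (w - z) * l * (g w - g z)
          + f z * (g w - g z - (w - z) * m))%C by ring.
  assert (D0 := Cmod_ge_0 (w - z)). set (D := Cmod (w - z)) in *.
  eapply Rle_trans.
  { eapply Rle_trans; [apply Cmod_triangle|]. apply Rplus_le_compat_r.
    eapply Rle_trans; [apply Cmod_triangle|]. apply Rplus_le_compat_r. apply Cmod_triangle. }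
  rewrite !Cmod_mult. fold D.
  assert (X0 := Cmod_ge_0 (g w - g z)).
  assert (Y0 := Cmod_ge_0 (f w - f z - (w - z) * l)).
  assert (Z0 := Cmod_ge_0 (g w - g z - (w - z) * m)).
  set (X := Cmod (g w - g z)) in *.
  set (Y := Cmod (f w - f z - (w - z) * l)) in *.
  set (Z := Cmod (g w - g z - (w - z) * m)) in *.
  assert (T1 : Y * X <= e * D * 1).
  { apply Rmult_le_compat; try assumption; [nra | lra]. }
  assert (T2 : Y * Cmod (g z) <= e * D * Cmod (g z)).
  { apply Rmult_le_compat_r; [assumption|nra]. }
  assert (T3 : D * Cmod l * X <= D * Cmod l * e).
  { apply Rmult_le_compat_l; [apply Rmult_le_pos; assumption | lra]. }
  assert (T4 : Cmod (f z) * Z <= Cmod (f z) * (e * D)).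
  { apply Rmult_le_compat_l; [assumption | nra]. }
  rewrite <- Ee. nra.
Qed.

Lemma is_derive_Cinv_id (z : C) : z <> 0%C -> is_derive (fun w : C => / w)%C z (- / (z * z))%C.
Proof.
  intros Hz. apply is_derive_CC_iff; intros eps He.
  assert (Mz : 0 < Cmod z) by (apply Cmod_gt_0; exact Hz).
  exists (Rmin (Cmod z / 2) (eps * Cmod z ^ 3 / 2)); split.
  { apply Rmin_glb_lt; [lra|]. assert (0 < Cmod z ^ 3) by (apply pow_lt; lra). nra. }
  intros w Hw.
  assert (W1 : Cmod (w - z) < Cmod z / 2) by (eapply Rlt_le_trans; [exact Hw | apply Rmin_l]).
  assert (W2 : Cmod (w - z) < eps * Cmod z ^ 3 / 2)
    by (eapply Rlt_le_trans; [exact Hw | apply Rmin_r]).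
  assert (Mw : Cmod z / 2 < Cmod w).
  { assert (T := Cmod_triangle w (- (w - z))). rewrite Cmod_opp in T.
    replace (w + - (w - z))%C with z in T by ring. lra. }
  assert (Nw : w <> 0%C) by (apply Cmod_gt_0; lra).
  replace (/ w - / z - (w - z) * - / (z * z))%C
    with ((w - z) * ((w - z) * (/ w * (/ z * / z))))%C by (field; split; assumption).
  rewrite !Cmod_mult, !Cmod_inv by assumption.
  rewrite Rmult_comm. apply Rmult_le_compat_r; [apply Cmod_ge_0|].
  assert (Iw : / Cmod w <= 2 / Cmod z).
  { replace (2 / Cmod z) with (/ (Cmod z / 2)) by (field; lra).
    apply Rinv_le_contravar; lra. }
  apply Rle_trans with ((eps * Cmod z ^ 3 / 2) * (2 / Cmod z * (/ Cmod z * / Cmod z))).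
  - assert (0 < / Cmod z) by (apply Rinv_0_lt_compat; lra).
    assert (0 < / Cmod w) by (apply Rinv_0_lt_compat; lra).
    apply Rmult_le_compat; [apply Cmod_ge_0 | | lra |].
    + apply Rmult_le_pos; [lra | nra].
    + apply Rmult_le_compat_r; [nra | exact Iw].
  - right; field; lra.
Qed.

(** The general chain rule wants [g] differentiable for the module structure of
    the field over itself; this structure has the same norm. *)
Lemma is_derive_CC_comp (f g : C -> C) (z l m : C) :
  is_derive f (g z) l -> is_derive g z m -> is_derive (fun w => f (g w)) z (m * l)%C.
Proof.
  intros Hf Hg.
  apply (is_derive_comp (K := C_AbsRing) (V := C_NormedModule) f g z l m Hf).
  destruct Hg as [H1 H2]; split; [apply is_linear_scal_l | exact H2].
Qed.

Lemma ex_derive_Cmult (f g : C -> C) z :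
  ex_derive f z -> ex_derive g z -> ex_derive (fun w => f w * g w)%C z.
Proof. intros [l Hl] [m Hm]; eexists; apply is_derive_Cmult; eassumption. Qed.

Lemma ex_derive_Cplus (f g : C -> C) z :
  ex_derive f z -> ex_derive g z -> ex_derive (fun w => f w + g w)%C z.
Proof. intros [l Hl] [m Hm]; eexists; apply is_derive_Cplus; eassumption. Qed.

Lemma ex_derive_Cminus (f g : C -> C) z :
  ex_derive f z -> ex_derive g z -> ex_derive (fun w => f w - g w)%C z.
Proof.
  intros Hf [m Hm]; apply ex_derive_Cplus; [exact Hf|].
  eexists; apply is_derive_Copp; eassumption.
Qed.

Lemma ex_derive_Cconst (c z : C) : ex_derive (fun _ : C => c) z.
Proof. eexists; apply is_derive_Cconst. Qed.

Lemma ex_derive_Cid (z : C) : ex_derive (fun w : C => w) z.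
Proof. eexists; apply is_derive_Cid. Qed.

Lemma ex_derive_Cinv (f : C -> C) z :
  ex_derive f z -> f z <> 0%C -> ex_derive (fun w => / f w)%C z.
Proof.
  intros [l Hl] H; eexists.
  apply (is_derive_CC_comp (fun w => / w)%C f); [now apply is_derive_Cinv_id | exact Hl].
Qed.

(** * Goursat's theorem for rectangles *)

(** The nested-interval argument, in the form of an induction over rectangles. *)
Lemma bisection_induction (P : R -> R -> R -> R -> Prop) (a c w v : R) :
  0 <= w -> 0 <= v ->
  (forall a' c' w' v',
     P a' c' (w' / 2) (v' / 2) -> P (a' + w' / 2) c' (w' / 2) (v' / 2) ->
     P a' (c' + v' / 2) (w' / 2) (v' / 2) -> P (a' + w' / 2) (c' + v' / 2) (w' / 2) (v' / 2) ->
     a <= a' -> a' + w' <= a + w -> c <= c' -> c' + v' <= c + v -> 0 <= w' -> 0 <= v' ->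
     P a' c' w' v') ->
  (forall x y, a <= x <= a + w -> c <= y <= c + v ->
     exists d, 0 < d /\ forall a' c' w' v', 0 <= w' < d -> 0 <= v' < d ->
       a <= a' -> a' + w' <= a + w -> c <= c' -> c' + v' <= c + v ->
       a' <= x <= a' + w' -> c' <= y <= c' + v' -> P a' c' w' v') ->
  P a c w v.
Proof.
  intros Hw Hv split local. apply NNPP; intros HP.
  set (wn n := w * (/ 2) ^ n). set (vn n := v * (/ 2) ^ n).
  assert (p2 : forall n, 0 < (/ 2) ^ n) by (intros n; apply pow_lt; lra).
  assert (wS : forall n, wn (S n) = wn n / 2) by (intros n; unfold wn; simpl; field).
  assert (vS : forall n, vn (S n) = vn n / 2) by (intros n; unfold vn; simpl; field).
  assert (wp : forall n, 0 <= wn n) by (intros n; unfold wn; specialize (p2 n); nra).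
  assert (vp : forall n, 0 <= vn n) by (intros n; unfold vn; specialize (p2 n); nra).
  set (bad n (s : R * R) := a <= fst s /\ fst s + wn n <= a + w /\ c <= snd s /\
         snd s + vn n <= c + v /\ ~ P (fst s) (snd s) (wn n) (vn n)).
  set (good_step n (s s' : R * R) := bad (S n) s' /\
         fst s <= fst s' /\ fst s' + wn (S n) <= fst s + wn n /\
         snd s <= snd s' /\ snd s' + vn (S n) <= snd s + vn n).
  assert (step : forall n s, exists s', bad n s -> good_step n s s').
  { intros n [a' c']. apply NNPP; intros N.
    assert (B : bad n (a', c')).
    { apply NNPP; intros B; apply N; exists (a', c'); tauto. }
    destruct B as (B1 & B2 & B3 & B4 & B5); simpl in *.
    assert (w0 := wp n); assert (v0 := vp n).
    apply B5, split; try assumption; apply NNPP; intros Q; apply N.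
    - exists (a', c'); intros _; unfold good_step, bad; simpl; rewrite wS, vS; repeat split; trivial; lra.
    - exists (a' + wn n / 2, c'); intros _; unfold good_step, bad; simpl; rewrite wS, vS; repeat split; trivial; lra.
    - exists (a', c' + vn n / 2); intros _; unfold good_step, bad; simpl; rewrite wS, vS; repeat split; trivial; lra.
    - exists (a' + wn n / 2, c' + vn n / 2); intros _; unfold good_step, bad; simpl; rewrite wS, vS; repeat split; trivial; lra. }
  set (next n s := proj1_sig (constructive_indefinite_description _ (step n s))).
  assert (Hnext : forall n s, bad n s -> good_step n s (next n s)).
  { intros n s; unfold next; destruct constructive_indefinite_description; assumption. }
  set (sq := fix sq n := match n with O => (a, c) | S m => next m (sq m) end).
  assert (Hbad : forall n, bad n (sq n)).
  { induction n; simpl.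
    - unfold bad, wn, vn; simpl; rewrite !Rmult_1_r; repeat split; trivial; lra.
    - apply Hnext, IHn. }
  assert (Hstep : forall n, good_step n (sq n) (sq (S n))) by (intros n; apply Hnext, Hbad).
  assert (nest : forall n k, fst (sq n) <= fst (sq (n + k)%nat) /\
            fst (sq (n + k)%nat) + wn (n + k)%nat <= fst (sq n) + wn n /\
            snd (sq n) <= snd (sq (n + k)%nat) /\
            snd (sq (n + k)%nat) + vn (n + k)%nat <= snd (sq n) + vn n).
  { intros n; induction k.
    - rewrite Nat.add_0_r; lra.
    - rewrite Nat.add_succ_r. destruct (Hstep (n + k)%nat) as (_ & H); lra. }
  assert (cross : forall n m, fst (sq n) <= fst (sq m) + wn m /\ snd (sq n) <= snd (sq m) + vn m).
  { intros n m. destruct (Nat.le_ge_cases n m) as [H|H].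
    - replace m with (n + (m - n))%nat by lia.
      destruct (nest n (m - n)%nat) as (H1 & _ & H3 & _).
      specialize (wp (n + (m - n))%nat); specialize (vp (n + (m - n))%nat); lra.
    - replace n with (m + (n - m))%nat by lia.
      destruct (nest m (n - m)%nat) as (_ & H1 & _ & H3).
      specialize (wp (m + (n - m))%nat); specialize (vp (m + (n - m))%nat); lra. }
  destruct (completeness (fun x => exists n, x = fst (sq n))) as [x [x1 x2]].
  { exists (fst (sq 0%nat) + wn 0%nat); intros z [n ->]; apply cross. }
  { now exists (fst (sq 0%nat)), 0%nat. }
  destruct (completeness (fun y => exists n, y = snd (sq n))) as [y [y1 y2]].
  { exists (snd (sq 0%nat) + vn 0%nat); intros z [n ->]; apply cross. }
  { now exists (snd (sq 0%nat)), 0%nat. }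
  assert (xin : forall n, fst (sq n) <= x <= fst (sq n) + wn n).
  { intros n; split; [apply x1; now exists n|]. apply x2; intros z [k ->]; apply cross. }
  assert (yin : forall n, snd (sq n) <= y <= snd (sq n) + vn n).
  { intros n; split; [apply y1; now exists n|]. apply y2; intros z [k ->]; apply cross. }
  destruct (local x y) as [d [Hd L]].
  { assert (H := xin O); unfold wn in H; simpl in H; lra. }
  { assert (H := yin O); unfold vn in H; simpl in H; lra. }
  destruct (pow_lt_1_zero (/ 2)) with (y := d / (1 + w + v)) as [n Hn].
  { rewrite Rabs_pos_eq; lra. }
  { apply Rdiv_lt_0_compat; lra. }
  specialize (Hn n (Nat.le_refl n)). rewrite Rabs_pos_eq in Hn by (specialize (p2 n); lra).
  apply (Rmult_lt_compat_l (1 + w + v)) in Hn; [|lra].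
  replace ((1 + w + v) * (d / (1 + w + v))) with d in Hn by (field; lra).
  destruct (Hbad n) as (B1 & B2 & B3 & B4 & B5).
  apply B5, L; try assumption; try apply xin; try apply yin; split; try apply wp; try apply vp.
  - unfold wn; specialize (p2 n); nra.
  - unfold vn; specialize (p2 n); nra.
Qed.

(** The real part of [- i] times the integral of [S z dz] around the rectangle
    [[a, b] x [c, d]]. *)
Definition boundary_integral (S : C -> C) (a b c d : R) : R :=
  RInt (fun y => Re (S (b, y)) - Re (S (a, y))) c d -
  RInt (fun x => Im (S (x, d)) - Im (S (x, c))) a b.

Definition on_rect (P : C -> Prop) (a b c d : R) : Prop :=
  forall x y, a <= x <= b -> c <= y <= d -> P (x, y).

Lemma continuous_vline (x y : R) : continuous (fun y : R => (x, y) : C) y.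
Proof.
  apply continuous_C; simpl; [apply continuous_const | apply continuous_id].
Qed.

Lemma continuous_hline (x y : R) : continuous (fun x : R => (x, y) : C) x.
Proof.
  apply continuous_C; simpl; [apply continuous_id | apply continuous_const].
Qed.

Lemma ex_RInt_vline (g : C -> R) (x c d : R) :
  c <= d -> (forall y, c <= y <= d -> continuous g (x, y)) ->
  ex_RInt (fun y => g (x, y)) c d.
Proof.
  intros Hcd H. apply (ex_RInt_continuous (V := R_CompleteNormedModule)).
  intros y; rewrite Rmin_left, Rmax_right by assumption; intros Hy.
  apply (continuous_comp (fun y => (x, y) : C) g); [apply continuous_vline | now apply H].
Qed.

Lemma ex_RInt_hline (g : C -> R) (y a b : R) :
  a <= b -> (forall x, a <= x <= b -> continuous g (x, y)) ->
  ex_RInt (fun x => g (x, y)) a b.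
Proof.
  intros Hcd H. apply (ex_RInt_continuous (V := R_CompleteNormedModule)).
  intros x; rewrite Rmin_left, Rmax_right by assumption; intros Hx.
  apply (continuous_comp (fun x => (x, y) : C) g); [apply continuous_hline | now apply H].
Qed.

Section BoundaryIntegral.
Variables (S : C -> C) (a b c d : R).
Hypothesis Hab : a <= b.
Hypothesis Hcd : c <= d.
Hypothesis HS : on_rect (fun z => continuous S z) a b c d.

Lemma ex_RInt_Re_v x : a <= x <= b -> ex_RInt (fun y => Re (S (x, y))) c d.
Proof.
  intros Hx; apply (ex_RInt_vline (fun z => Re (S z))); [exact Hcd|].
  intros y Hy; apply continuous_Re_comp, HS; assumption.
Qed.

Lemma ex_RInt_Im_h y : c <= y <= d -> ex_RInt (fun x => Im (S (x, y))) a b.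
Proof.
  intros Hy; apply (ex_RInt_hline (fun z => Im (S z))); [exact Hab|].
  intros x Hx; apply continuous_Im_comp, HS; assumption.
Qed.

Lemma boundary_integral_E :
  boundary_integral S a b c d =
  (RInt (fun y => Re (S (b, y))) c d - RInt (fun y => Re (S (a, y))) c d) -
  (RInt (fun x => Im (S (x, d))) a b - RInt (fun x => Im (S (x, c))) a b).
Proof.
  unfold boundary_integral. f_equal.
  - apply (RInt_minus (V := R_CompleteNormedModule) (fun y => Re (S (b, y))) (fun y => Re (S (a, y))));
      apply ex_RInt_Re_v; lra.
  - apply (RInt_minus (V := R_CompleteNormedModule) (fun x => Im (S (x, d))) (fun x => Im (S (x, c))));
      apply ex_RInt_Im_h; lra.
Qed.

(** Linear functions have boundary integral 0, so only the deviation from one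
    counts. *)
Lemma boundary_integral_near_linear (A B : C) (e : R) :
  on_rect (fun z => Cmod (S z - (A + z * B)) <= e) a b c d ->
  Rabs (boundary_integral S a b c d) <= 2 * e * ((b - a) + (d - c)).
Proof.
  intros H.
  assert (Z : boundary_integral S a b c d =
    RInt (fun y => (Re (S (b, y)) - Re (S (a, y))) - (b - a) * Re B) c d -
    RInt (fun x => (Im (S (x, d)) - Im (S (x, c))) - (d - c) * Re B) a b).
  { unfold boundary_integral.
    rewrite (RInt_minus (V := R_CompleteNormedModule)
              (fun y => Re (S (b, y)) - Re (S (a, y))) (fun _ => (b - a) * Re B)).
    2: apply (ex_RInt_minus (V := R_NormedModule) (fun y => Re (S (b, y))) (fun y => Re (S (a, y))));
       apply ex_RInt_Re_v; lra.
    2: apply ex_RInt_const.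
    rewrite (RInt_minus (V := R_CompleteNormedModule)
              (fun x => Im (S (x, d)) - Im (S (x, c))) (fun _ => (d - c) * Re B)).
    2: apply (ex_RInt_minus (V := R_NormedModule) (fun x => Im (S (x, d))) (fun x => Im (S (x, c))));
       apply ex_RInt_Im_h; lra.
    2: apply ex_RInt_const.
    rewrite !RInt_const. unfold minus, plus, opp, scal; simpl; unfold mult; simpl. ring. }
  assert (re : forall z1 z2 : C, Rabs (Re z1 - Re z2) <= Cmod (z1 - z2)).
  { intros z1 z2; apply (re_le_Cmod (z1 - z2)). }
  assert (im : forall z1 z2 : C, Rabs (Im z1 - Im z2) <= Cmod (z1 - z2)).
  { intros z1 z2; eapply Rle_trans; [|apply Rmax_Cmod]; apply Rmax_r. }
  rewrite Z. unfold Rminus at 1.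
  eapply Rle_trans; [apply Rabs_triang|]. rewrite Rabs_Ropp.
  assert (I1 : Rabs (RInt (fun y => (Re (S (b, y)) - Re (S (a, y))) - (b - a) * Re B) c d)
               <= (d - c) * (2 * e)).
  { apply abs_RInt_le_const; [exact Hcd | |].
    - apply (ex_RInt_minus (V := R_NormedModule) (fun y => Re (S (b, y)) - Re (S (a, y)))); [|apply ex_RInt_const].
      apply (ex_RInt_minus (V := R_NormedModule) (fun y => Re (S (b, y))) (fun y => Re (S (a, y))));
      apply ex_RInt_Re_v; lra.
    - intros y Hy.
      assert (K1 := H b y ltac:(lra) Hy); assert (K2 := H a y ltac:(lra) Hy).
      assert (R1 := re (S (b, y)) (A + (b, y) * B)%C).
      assert (R2 := re (S (a, y)) (A + (a, y) * B)%C).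
      replace (Re (S (b, y)) - Re (S (a, y)) - (b - a) * Re B)
        with ((Re (S (b, y)) - Re (A + (b, y) * B)%C) - (Re (S (a, y)) - Re (A + (a, y) * B)%C))
        by (unfold Re; simpl; ring).
      unfold Rminus at 1. eapply Rle_trans; [apply Rabs_triang|]. rewrite Rabs_Ropp. lra. }
  assert (I2 : Rabs (RInt (fun x => (Im (S (x, d)) - Im (S (x, c))) - (d - c) * Re B) a b)
               <= (b - a) * (2 * e)).
  { apply abs_RInt_le_const; [exact Hab | |].
    - apply (ex_RInt_minus (V := R_NormedModule) (fun x => Im (S (x, d)) - Im (S (x, c)))); [|apply ex_RInt_const].
      apply (ex_RInt_minus (V := R_NormedModule) (fun x => Im (S (x, d))) (fun x => Im (S (x, c))));
      apply ex_RInt_Im_h; lra.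
    - intros x Hx.
      assert (K1 := H x d Hx ltac:(lra)); assert (K2 := H x c Hx ltac:(lra)).
      assert (R1 := im (S (x, d)) (A + (x, d) * B)%C).
      assert (R2 := im (S (x, c)) (A + (x, c) * B)%C).
      replace (Im (S (x, d)) - Im (S (x, c)) - (d - c) * Re B)
        with ((Im (S (x, d)) - Im (A + (x, d) * B)%C) - (Im (S (x, c)) - Im (A + (x, c) * B)%C))
        by (unfold Im, Re; simpl; ring).
      unfold Rminus at 1. eapply Rle_trans; [apply Rabs_triang|]. rewrite Rabs_Ropp. lra. }
  lra.
Qed.

End BoundaryIntegral.

Lemma on_rect_sub P a b c d a' b' c' d' :
  on_rect P a b c d -> a <= a' -> b' <= b -> c <= c' -> d' <= d -> on_rect P a' b' c' d'.
Proof. intros H Ha Hb Hc Hd x y Hx Hy; apply H; lra. Qed.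

Lemma boundary_integral_split_x (S : C -> C) a m b c d :
  a <= m <= b -> c <= d -> on_rect (fun z => continuous S z) a b c d ->
  boundary_integral S a b c d =
  boundary_integral S a m c d + boundary_integral S m b c d.
Proof.
  intros Hm Hcd H.
  assert (H1 : on_rect (fun z => continuous S z) a m c d) by (apply (on_rect_sub _ _ _ _ _ _ _ _ _ H); lra).
  assert (H2 : on_rect (fun z => continuous S z) m b c d) by (apply (on_rect_sub _ _ _ _ _ _ _ _ _ H); lra).
  rewrite !boundary_integral_E by (assumption || lra).
  rewrite <- (RInt_Chasles (fun x => Im (S (x, d))) a m b).
  2: apply (ex_RInt_Im_h S a m c d); assumption || lra.
  2: apply (ex_RInt_Im_h S m b c d); assumption || lra.
  rewrite <- (RInt_Chasles (fun x => Im (S (x, c))) a m b).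
  2: apply (ex_RInt_Im_h S a m c d); assumption || lra.
  2: apply (ex_RInt_Im_h S m b c d); assumption || lra.
  unfold plus; simpl; ring.
Qed.

Lemma boundary_integral_split_y (S : C -> C) a b c m d :
  a <= b -> c <= m <= d -> on_rect (fun z => continuous S z) a b c d ->
  boundary_integral S a b c d =
  boundary_integral S a b c m + boundary_integral S a b m d.
Proof.
  intros Hab Hm H.
  assert (H1 : on_rect (fun z => continuous S z) a b c m) by (apply (on_rect_sub _ _ _ _ _ _ _ _ _ H); lra).
  assert (H2 : on_rect (fun z => continuous S z) a b m d) by (apply (on_rect_sub _ _ _ _ _ _ _ _ _ H); lra).
  rewrite !boundary_integral_E by (assumption || lra).
  rewrite <- (RInt_Chasles (fun y => Re (S (b, y))) c m d).
  2: apply (ex_RInt_Re_v S a b c m); assumption || lra.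
  2: apply (ex_RInt_Re_v S a b m d); assumption || lra.
  rewrite <- (RInt_Chasles (fun y => Re (S (a, y))) c m d).
  2: apply (ex_RInt_Re_v S a b c m); assumption || lra.
  2: apply (ex_RInt_Re_v S a b m d); assumption || lra.
  unfold plus; simpl; ring.
Qed.

(** No continuity of the derivative is assumed: this is where the subdivision
    argument is needed. *)
Lemma goursat (S : C -> C) a b c d :
  a <= b -> c <= d -> on_rect (fun z => ex_derive S z) a b c d ->
  boundary_integral S a b c d = 0.
Proof.
  intros Hab Hcd HD.
  assert (HC : on_rect (fun z => continuous S z) a b c d).
  { intros x y Hx Hy; apply ex_derive_CC_continuous, HD; assumption. }
  assert (main : forall e, 0 < e ->
    Rabs (boundary_integral S a (a + (b - a)) c (c + (d - c))) <= e * ((b - a) + (d - c)) ^ 2).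
  { intros e He.
    apply (bisection_induction
      (fun a' c' w v => Rabs (boundary_integral S a' (a' + w) c' (c' + v)) <= e * (w + v) ^ 2)).
    - lra.
    - lra.
    - intros a' c' w v P1 P2 P3 P4 Ha1 Ha2 Hc1 Hc2 Hw Hv.
      assert (HC' : on_rect (fun z => continuous S z) a' (a' + w) c' (c' + v))
        by (apply (on_rect_sub _ _ _ _ _ _ _ _ _ HC); lra).
      rewrite (boundary_integral_split_x S a' (a' + w / 2)) by (assumption || lra).
      rewrite (boundary_integral_split_y S a' (a' + w / 2) c' (c' + v / 2)).
      2: lra. 2: lra. 2: apply (on_rect_sub _ _ _ _ _ _ _ _ _ HC'); lra.
      rewrite (boundary_integral_split_y S (a' + w / 2) (a' + w) c' (c' + v / 2)).
      2: lra. 2: lra. 2: apply (on_rect_sub _ _ _ _ _ _ _ _ _ HC'); lra.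
      replace (a' + w / 2 + w / 2) with (a' + w) in P2, P4 by field.
      replace (c' + v / 2 + v / 2) with (c' + v) in P3, P4 by field.
      apply Rabs_le_between in P1; apply Rabs_le_between in P2.
      apply Rabs_le_between in P3; apply Rabs_le_between in P4.
      replace (e * (w + v) ^ 2) with (4 * (e * (w / 2 + v / 2) ^ 2)) by field.
      apply Rabs_le_between; lra.
    - intros x y Hx Hy.
      destruct (HD x y ltac:(lra) ltac:(lra)) as [l Hl].
      assert (He2 : 0 < e / 2) by lra.
      destruct (proj1 (is_derive_CC_iff _ _ _) Hl (e / 2) He2) as [dl [Hdl K]].
      exists (dl / 2); split; [lra|].
      intros a' c' w v Hw Hv Ha1 Ha2 Hc1 Hc2 Hx' Hy'.
      assert (near : on_rect (fun z => Cmod (z - (x, y)) <= w + v) a' (a' + w) c' (c' + v)).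
      { intros x1 y1 Hx1 Hy1.
        replace ((x1, y1) - (x, y))%C with (RtoC (x1 - x) + Ci * RtoC (y1 - y))%C
          by (apply injective_projections; simpl; ring).
        eapply Rle_trans; [apply Cmod_triangle|].
        rewrite Cmod_mult, Cmod_Ci, !Cmod_R, Rmult_1_l.
        apply Rplus_le_compat; apply Rabs_le_between; lra. }
      replace (e * (w + v) ^ 2) with (2 * (e / 2 * (w + v)) * ((a' + w - a') + (c' + v - c'))) by field.
      apply boundary_integral_near_linear with
        (A := (S (x, y) - (x, y) * l)%C) (B := l); [lra | lra | |].
      + apply (on_rect_sub _ _ _ _ _ _ _ _ _ HC); lra.
      + intros x1 y1 Hx1 Hy1. specialize (near x1 y1 Hx1 Hy1).
        replace (S (x1, y1) - (S (x, y) - (x, y) * l + (x1, y1) * l))%C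
          with (S (x1, y1) - S (x, y) - ((x1, y1) - (x, y)) * l)%C by ring.
        eapply Rle_trans; [apply K; lra|]. nra. }
  replace (a + (b - a)) with b in main by ring. replace (c + (d - c)) with d in main by ring.
  apply Rabs_eq_0. apply Rle_antisym; [|apply Rabs_pos].
  apply le_epsilon; intros eps He; rewrite Rplus_0_l.
  set (q := ((b - a) + (d - c)) ^ 2) in *.
  assert (Hq : 0 <= q) by apply pow2_ge_0.
  eapply Rle_trans; [apply (main (eps / (1 + q)))|].
  - apply Rdiv_lt_0_compat; lra.
  - apply Rmult_le_reg_r with (1 + q); [lra|].
    replace (eps / (1 + q) * q * (1 + q)) with (eps * q) by (field; lra). nra.
Qed.

(** * The complex exponential *)

Definition Cexp (z : C) : C := (exp (Re z) * cos (Im z), exp (Re z) * sin (Im z)).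

Lemma Cexp_plus z w : Cexp (z + w) = (Cexp z * Cexp w)%C.
Proof.
  unfold Cexp. destruct z as [a b], w as [c d]; simpl.
  rewrite exp_plus, cos_plus, sin_plus.
  apply injective_projections; simpl; ring.
Qed.

Lemma Cexp_0 : Cexp (RtoC 0) = RtoC 1.
Proof. unfold Cexp; simpl; rewrite exp_0, cos_0, sin_0; apply injective_projections; simpl; ring. Qed.

Lemma Cmod_Cexp z : Cmod (Cexp z) = exp (Re z).
Proof.
  assert (H : Cmod (Cexp z) ^ 2 = exp (Re z) ^ 2).
  { rewrite Cmod2_alt; unfold Cexp; simpl.
    assert (T := sin2_cos2 (Im z)); unfold Rsqr in T.
    replace (exp (Re z) * cos (Im z) * (exp (Re z) * cos (Im z) * 1) +
             exp (Re z) * sin (Im z) * (exp (Re z) * sin (Im z) * 1))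
      with (exp (Re z) * exp (Re z) * (sin (Im z) * sin (Im z) + cos (Im z) * cos (Im z))) by ring.
    rewrite T; ring. }
  rewrite <- (sqrt_pow2 (Cmod (Cexp z))) by apply Cmod_ge_0.
  rewrite H. apply sqrt_pow2. left; apply exp_pos.
Qed.

Lemma Cexp_neq_0 z : Cexp z <> 0%C.
Proof. apply Cmod_gt_0. rewrite Cmod_Cexp. apply exp_pos. Qed.

Lemma derivable_pt_lim_at_0 g l :
  derivable_pt_lim g 0 l -> forall e, 0 < e ->
  exists d, 0 < d /\ forall x, Rabs x < d -> Rabs (g x - g 0 - l * x) <= e * Rabs x.
Proof.
  intros H e He. destruct (H e He) as [d Hd]. exists d; split; [apply cond_pos|].
  intros x Hx. destruct (Req_dec x 0) as [->|Nx].
  - replace (g 0 - g 0 - l * 0) with 0 by ring. rewrite Rabs_R0; lra.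
  - specialize (Hd x Nx Hx). rewrite Rplus_0_l in Hd.
    replace (g x - g 0 - l * x) with (((g x - g 0) / x - l) * x) by (field; assumption).
    rewrite Rabs_mult. apply Rmult_le_compat_r; [apply Rabs_pos | lra].
Qed.

Lemma is_derive_Cexp_0 : is_derive Cexp (RtoC 0) (RtoC 1).
Proof.
  apply is_derive_CC_iff; intros eps Heps.
  set (e := Rmin 1 (eps / 9)).
  assert (He : 0 < e) by (apply Rmin_glb_lt; lra).
  assert (e1 : e <= 1) by apply Rmin_l. assert (e2 : e <= eps / 9) by apply Rmin_r.
  destruct (derivable_pt_lim_at_0 exp 1) with (e := e) as [d1 [D1 K1]]; [|exact He|].
  { generalize (derivable_pt_lim_exp 0); now rewrite exp_0. }
  destruct (derivable_pt_lim_at_0 cos 0) with (e := e) as [d2 [D2 K2]]; [|exact He|].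
  { generalize (derivable_pt_lim_cos 0); now rewrite sin_0, Ropp_0. }
  destruct (derivable_pt_lim_at_0 sin 1) with (e := e) as [d3 [D3 K3]]; [|exact He|].
  { generalize (derivable_pt_lim_sin 0); now rewrite cos_0. }
  exists (Rmin (Rmin d1 d2) (Rmin d3 (e / 2))); split.
  { repeat apply Rmin_glb_lt; lra. }
  intros h Hh. rewrite Cexp_0.
  replace (Cexp h - 1 - (h - 0) * 1)%C with (Cexp h - 1 - h)%C by ring.
  replace (h - 0)%C with h in * by ring.
  assert (Hx := re_le_Cmod h).
  assert (Hy : Rabs (Im h) <= Cmod h) by (eapply Rle_trans; [|apply Rmax_Cmod]; apply Rmax_r).
  assert (M := Cmod_ge_0 h).
  assert (Hh1 : Cmod h < Rmin d1 d2) by (eapply Rlt_le_trans; [exact Hh | apply Rmin_l]).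
  assert (Hh2 : Cmod h < Rmin d3 (e / 2)) by (eapply Rlt_le_trans; [exact Hh | apply Rmin_r]).
  assert (H1 : Cmod h < d1) by (eapply Rlt_le_trans; [exact Hh1 | apply Rmin_l]).
  assert (H2 : Cmod h < d2) by (eapply Rlt_le_trans; [exact Hh1 | apply Rmin_r]).
  assert (H3 : Cmod h < d3) by (eapply Rlt_le_trans; [exact Hh2 | apply Rmin_l]).
  assert (H4 : Cmod h < e / 2) by (eapply Rlt_le_trans; [exact Hh2 | apply Rmin_r]).
  specialize (K1 (Re h) ltac:(lra)); specialize (K2 (Im h) ltac:(lra)); specialize (K3 (Im h) ltac:(lra)).
  rewrite exp_0 in K1. rewrite cos_0 in K2. rewrite sin_0 in K3.
  set (m := Cmod h) in *. set (x := Re h) in *; set (y := Im h) in *.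
  assert (X3 : exp x <= 3).
  { eapply Rle_trans; [|apply exp_le_3]. destruct (Req_dec x 1) as [->|]; [lra|].
    left; apply exp_increasing. apply Rabs_le_between in Hx; lra. }
  assert (X0 := exp_pos x).
  assert (E1 : Rabs (exp x - 1) <= e).
  { replace (exp x - 1) with ((exp x - 1 - 1 * x) + x) by ring.
    eapply Rle_trans; [apply Rabs_triang|]. assert (e * Rabs x <= Rabs x) by (assert (A := Rabs_pos x); nra). lra. }
  replace (Cexp h - 1 - h)%C with
    (RtoC ((exp x - 1 - 1 * x) + exp x * (cos y - 1 - 0 * y)) +
     Ci * RtoC (exp x * (sin y - 0 - 1 * y) + (exp x - 1) * y))%C.
  2: { apply injective_projections; unfold Cexp; simpl; fold x; fold y;
       change (fst h) with x; change (snd h) with y; ring. }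
  eapply Rle_trans; [apply Cmod_triangle|].
  rewrite Cmod_mult, Cmod_Ci, !Cmod_R.
  assert (A1 := Rabs_triang (exp x - 1 - 1 * x) (exp x * (cos y - 1 - 0 * y))).
  assert (A2 := Rabs_triang (exp x * (sin y - 0 - 1 * y)) ((exp x - 1) * y)).
  rewrite !Rabs_mult, (Rabs_pos_eq (exp x)) in A1 by lra.
  rewrite !Rabs_mult, (Rabs_pos_eq (exp x)) in A2 by lra.
  assert (B1 : e * Rabs x <= e * m) by (apply Rmult_le_compat_l; lra).
  assert (B2 : e * Rabs y <= e * m) by (apply Rmult_le_compat_l; lra).
  assert (C1 : exp x * Rabs (cos y - 1 - 0 * y) <= 3 * (e * m)).
  { apply Rmult_le_compat; try lra. apply Rabs_pos. }
  assert (C2 : exp x * Rabs (sin y - 0 - 1 * y) <= 3 * (e * m)).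
  { apply Rmult_le_compat; try lra. apply Rabs_pos. }
  assert (C3 : Rabs (exp x - 1) * Rabs y <= e * m).
  { apply Rmult_le_compat; try lra; apply Rabs_pos. }
  assert (e * m <= eps / 9 * m) by (apply Rmult_le_compat_r; assumption).
  assert (0 <= eps * m) by (apply Rmult_le_pos; lra).
  lra.
Qed.

Lemma is_derive_Cexp z : is_derive Cexp z (Cexp z).
Proof.
  apply (is_derive_CC_ext_loc (fun w => Cexp z * Cexp (w - z))%C).
  { apply locally_Cmod; exists 1; split; [lra|]; intros w _.
    rewrite <- Cexp_plus; f_equal; ring. }
  eapply is_derive_CC_eq.
  - apply is_derive_Cmult; [apply is_derive_Cconst|].
    apply (is_derive_CC_comp Cexp (fun w => w - z)%C).
    + replace (z - z)%C with (RtoC 0) by ring. apply is_derive_Cexp_0.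
    + apply (is_derive_Cplus (fun w => w) (fun _ => - z)%C);
        [apply is_derive_Cid | apply is_derive_Cconst].
  - simpl; ring.
Qed.

Lemma continuous_Cexp z : continuous Cexp z.
Proof. apply ex_derive_CC_continuous; eexists; apply is_derive_Cexp. Qed.

(** * Integrals depending on a parameter *)

(** Only finitely many neighbourhoods are needed to cover the interval of
    integration, so that the integrand is close to its limit uniformly. *)
Lemma continuous_RInt_param {U : UniformSpace} (phi : U -> R -> R) (u0 : U) (a b : R) :
  a <= b ->
  locally u0 (fun u => forall t, a <= t <= b ->
    continuous (fun p : U * R => phi (fst p) (snd p)) (u, t)) ->
  continuous (fun u => RInt (phi u) a b) u0.
Proof.
  intros Hab H.
  assert (H0 := locally_singleton _ _ H).
  assert (ex : forall u, (forall t, a <= t <= b ->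
     continuous (fun p : U * R => phi (fst p) (snd p)) (u, t)) -> ex_RInt (phi u) a b).
  { intros u Hu. apply (ex_RInt_continuous (V := R_CompleteNormedModule)).
    intros t; rewrite Rmin_left, Rmax_right by assumption; intros Ht.
    apply (continuous_comp_2 (fun _ : R => u) (fun t : R => t) phi);
      [apply continuous_const | apply continuous_id | now apply Hu]. }
  intros P [eps HP].
  set (e := eps / (4 * (1 + (b - a)))).
  assert (He : 0 < e) by (apply Rdiv_lt_0_compat; [apply cond_pos | lra]).
  assert (gauge : forall t, exists d : posreal, a <= t <= b ->
     forall u t', ball u0 d u -> Rabs (t' - t) < d -> Rabs (phi u t' - phi u0 t) < e).
  { intros t. destruct (classic (a <= t <= b)) as [Ht|Ht].
    - destruct (H0 t Ht (fun v => Rabs (v - phi u0 t) < e)) as [d Hd].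
      { exists (mkposreal e He); intros v Hv; exact Hv. }
      exists d; intros _ u t' Hu Ht'. apply (Hd (u, t')). split; assumption.
    - exists (mkposreal 1 Rlt_0_1); tauto. }
  set (dl t := proj1_sig (constructive_indefinite_description _ (gauge t))).
  assert (Hdl : forall t, a <= t <= b -> forall u t', ball u0 (dl t) u -> Rabs (t' - t) < dl t ->
     Rabs (phi u t' - phi u0 t) < e).
  { intros t; unfold dl; destruct constructive_indefinite_description; assumption. }
  destruct (compactness_value_1d a b dl) as [d Hd].
  assert (near : locally u0 (fun u => forall t, a <= t <= b -> Rabs (phi u t - phi u0 t) <= 2 * e)).
  { exists d; intros u Hu t Ht.
    destruct (NNPP _ (Hd t Ht)) as [t0 [Ht0 [Htt Hdt]]].
    assert (A1 := Hdl t0 Ht0 u t (ball_le _ _ _ Hdt _ Hu) Htt).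
    assert (A2 := Hdl t0 Ht0 u0 t (ball_center _ _) Htt).
    replace (phi u t - phi u0 t) with ((phi u t - phi u0 t0) - (phi u0 t - phi u0 t0)) by ring.
    unfold Rminus at 1; eapply Rle_trans; [apply Rabs_triang|]; rewrite Rabs_Ropp; lra. }
  unfold filtermap; generalize (filter_and _ _ H near); apply filter_imp; intros u [Hu Hn].
  apply HP. change (Rabs (RInt (phi u) a b - RInt (phi u0) a b) < eps).
  rewrite <- (RInt_minus (V := R_CompleteNormedModule) (phi u) (phi u0)) by (now apply ex).
  apply Rle_lt_trans with ((b - a) * (2 * e)).
  - apply (abs_RInt_le_const (fun t => phi u t - phi u0 t)); [assumption| |].
    + apply (ex_RInt_minus (V := R_NormedModule) (phi u) (phi u0)); now apply ex.
    + intros t Ht; now apply Hn.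
  - assert (E : e * (4 * (1 + (b - a))) = eps) by (unfold e; field; lra).
    assert (P0 := cond_pos eps). nra.
Qed.

(** * The mean value property *)

Definition polar (r t : R) : C := (r * cos t, r * sin t).

Lemma Cmod_polar r t : 0 <= r -> Cmod (polar r t) = r.
Proof.
  intros Hr. rewrite <- (sqrt_pow2 (Cmod (polar r t))) by apply Cmod_ge_0.
  rewrite Cmod2_alt; unfold polar; simpl.
  assert (T := sin2_cos2 t); unfold Rsqr in T.
  replace (r * cos t * (r * cos t * 1) + r * sin t * (r * sin t * 1)) with (r ^ 2 * (sin t * sin t + cos t * cos t)) by ring.
  rewrite T, Rmult_1_r. now apply sqrt_pow2.
Qed.

Lemma polar_neq_0 r t : 0 < r -> polar r t <> 0%C.
Proof. intros Hr; apply Cmod_gt_0; rewrite Cmod_polar; lra. Qed.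

Lemma Cexp_polar x y : Cexp (x, y) = polar (exp x) y.
Proof. reflexivity. Qed.

Lemma continuous_polar (p : R * R) : continuous (fun p : R * R => polar (fst p) (snd p)) p.
Proof.
  destruct p as [r t].
  apply continuous_C; simpl; apply continuous_Rmult; try apply continuous_fst.
  - apply (continuous_comp snd cos); [apply continuous_snd | apply continuous_cos].
  - apply (continuous_comp snd sin); [apply continuous_snd | apply continuous_sin].
Qed.

Lemma continuous_polar_t r t : continuous (polar r) t.
Proof.
  apply (continuous_comp_2 (fun _ => r) (fun t => t) polar);
    [apply continuous_const | apply continuous_id | apply (continuous_polar (r, t))].
Qed.

(** Differentiability on the half-line [[0, +oo[] is never assumed, to leave room
    for removable singularities. *)
Definition off_slit (z : C) : Prop := Im z <> 0 \/ Re z < 0.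

Lemma off_slit_Cexp x y : 0 < y < 2 * PI -> off_slit (Cexp (x, y)).
Proof.
  intros Hy. unfold off_slit, Cexp; simpl. assert (E := exp_pos x).
  destruct (Rtotal_order y PI) as [H|[->|H]].
  - left. assert (0 < sin y) by (apply sin_gt_0; lra). nra.
  - right. rewrite cos_PI; lra.
  - left. assert (sin y < 0) by (apply sin_lt_0; lra). nra.
Qed.

Lemma continuous_zero_limit (f : R -> R) :
  continuous f 0 -> (forall t, 0 < t < 1 -> f t = 0) -> f 0 = 0.
Proof.
  intros Hf H. apply NNPP; intros N.
  destruct (Hf (fun v => Rabs (v - f 0) < Rabs (f 0))) as [d Hd].
  { exists (mkposreal _ (Rabs_pos_lt _ N)); intros v Hv; exact Hv. }
  set (t := Rmin (d / 2) (1 / 2)).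
  assert (D := cond_pos d).
  assert (t0 : 0 < t) by (apply Rmin_glb_lt; lra).
  assert (t1 : t <= d / 2) by apply Rmin_l. assert (t2 : t <= 1 / 2) by apply Rmin_r.
  assert (K := Hd t). rewrite H in K by lra.
  assert (B : ball 0 d t).
  { change (Rabs (t - 0) < d). rewrite Rabs_pos_eq; lra. }
  specialize (K B). rewrite Rminus_0_l, Rabs_Ropp in K. lra.
Qed.

(** The slit is the image under [Cexp] of the horizontal sides of the rectangle
    [[ln r1, ln r2] x [0, 2 pi]]; these two sides cancel by periodicity, and
    Goursat's theorem applies to the slightly smaller rectangles inside. *)
Lemma circle_integral_const (H : C -> C) (rad r1 r2 : R) :
  (forall z, 0 < Cmod z < rad -> continuous H z) ->
  (forall z, Cmod z < rad -> off_slit z -> ex_derive H z) ->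
  0 < r1 <= r2 -> r2 < rad ->
  RInt (fun t => Re (H (polar r1 t))) 0 (2 * PI) =
  RInt (fun t => Re (H (polar r2 t))) 0 (2 * PI).
Proof.
  intros HC HD Hr Hrad. assert (Hpi := PI_RGT_0). assert (Hpi3 := PI2_3_2).
  set (a := ln r1); set (b := ln r2).
  assert (Ea : exp a = r1) by (apply exp_ln; lra).
  assert (Eb : exp b = r2) by (apply exp_ln; lra).
  assert (Hab : a <= b).
  { destruct (Req_dec r1 r2) as [E|E]; [unfold a, b; rewrite E; lra|].
    left; apply ln_increasing; lra. }
  set (S s := H (Cexp s)).
  assert (bound : forall x, x <= b -> 0 < exp x < rad).
  { intros x Hx; split; [apply exp_pos|]. apply Rle_lt_trans with r2; [|assumption].
    rewrite <- Eb. destruct (Req_dec x b) as [->|]; [lra|]. left; apply exp_increasing; lra. }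
  assert (SC : forall x y, x <= b -> continuous S (x, y)).
  { intros x y Hx. apply (continuous_comp Cexp H); [apply continuous_Cexp|].
    apply HC. rewrite Cmod_Cexp; now apply bound. }
  assert (SD : forall x y, x <= b -> 0 < y < 2 * PI -> ex_derive S (x, y)).
  { intros x y Hx Hy.
    destruct (HD (Cexp (x, y))) as [l Hl].
    - rewrite Cmod_Cexp; now apply bound.
    - now apply off_slit_Cexp.
    - eexists; apply (is_derive_CC_comp H Cexp); [exact Hl | apply is_derive_Cexp]. }
  set (f t := boundary_integral S a b t (2 * PI - t)).
  assert (f0 : f 0 = 0).
  { apply continuous_zero_limit.
    - unfold f, boundary_integral. apply continuous_Rminus.
      + set (g y := Re (S (b, y)) - Re (S (a, y))).
        assert (gC : forall y, continuous g y).
        { intros y; apply continuous_Rminus.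
          - apply (continuous_comp (fun y => (b, y) : C) (fun z => Re (S z))); [apply continuous_vline|].
            apply continuous_Re_comp, SC; lra.
          - apply (continuous_comp (fun y => (a, y) : C) (fun z => Re (S z))); [apply continuous_vline|].
            apply continuous_Re_comp, SC; lra. }
        apply (continuous_comp_2 (fun t : R => t) (fun t => 2 * PI - t) (fun u v => RInt g u v)).
        * apply continuous_id.
        * apply continuous_Rminus; [apply continuous_const | apply continuous_id].
        * apply (continuous_RInt (V := R_NormedModule) g).
          apply filter_forall; intros z; apply (RInt_correct (V := R_CompleteNormedModule)).
          apply (ex_RInt_continuous (V := R_CompleteNormedModule)); intros y _; apply gC.
      + apply (continuous_RInt_param (fun t x => Im (S (x, 2 * PI - t)) - Im (S (x, t)))); [exact Hab|].
        apply filter_forall; intros t x Hx. apply continuous_Rminus.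
        * apply (continuous_comp (fun p : R * R => (snd p, 2 * PI - fst p) : C) (fun z => Im (S z))).
          -- apply continuous_C; simpl; [apply continuous_snd|].
             apply continuous_Rminus; [apply continuous_const | apply continuous_fst].
          -- apply continuous_Im_comp, SC; simpl; lra.
        * apply (continuous_comp (fun p : R * R => (snd p, fst p) : C) (fun z => Im (S z))).
          -- apply continuous_C; simpl; [apply continuous_snd | apply continuous_fst].
          -- apply continuous_Im_comp, SC; simpl; lra.
    - intros t Ht. unfold f. apply goursat; [exact Hab | lra |].
      intros x y Hx Hy; apply SD; lra. }
  unfold f in f0. rewrite Rminus_0_r in f0.
  rewrite boundary_integral_E in f0; [|exact Hab | lra | intros x y Hx Hy; apply SC; lra].
  assert (per : RInt (fun x => Im (S (x, 2 * PI))) a b = RInt (fun x => Im (S (x, 0))) a b).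
  { apply RInt_ext; intros x _. unfold S, Cexp; simpl.
    now rewrite cos_2PI, sin_2PI, cos_0, sin_0. }
  rewrite per in f0.
  assert (L1 : RInt (fun y => Re (S (a, y))) 0 (2 * PI) = RInt (fun t => Re (H (polar r1 t))) 0 (2 * PI)).
  { apply RInt_ext; intros y _; unfold S; rewrite Cexp_polar, Ea; reflexivity. }
  assert (L2 : RInt (fun y => Re (S (b, y))) 0 (2 * PI) = RInt (fun t => Re (H (polar r2 t))) 0 (2 * PI)).
  { apply RInt_ext; intros y _; unfold S; rewrite Cexp_polar, Eb; reflexivity. }
  rewrite L1, L2 in f0. lra.
Qed.

Lemma circle_mean (H : C -> C) (rad r : R) :
  (forall z, Cmod z < rad -> continuous H z) ->
  (forall z, Cmod z < rad -> off_slit z -> ex_derive H z) ->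
  0 < r < rad ->
  RInt (fun t => Re (H (polar r t))) 0 (2 * PI) = 2 * PI * Re (H 0).
Proof.
  intros HC HD Hr. assert (Hpi := PI_RGT_0).
  set (c := RInt (fun t => Re (H (polar r t))) 0 (2 * PI)).
  assert (Z : (fun s => RInt (fun t => Re (H (polar (r * s) t))) 0 (2 * PI) - c) 0 = 0).
  { refine (continuous_zero_limit (fun s => RInt (fun t => Re (H (polar (r * s) t))) 0 (2 * PI) - c) _ _).
    - apply continuous_Rminus; [|apply continuous_const].
      apply (continuous_RInt_param (fun s t => Re (H (polar (r * s) t)))); [lra|].
      exists (mkposreal 1 Rlt_0_1); intros s Hs t _.
      change (Rabs (s - 0) < 1) in Hs. rewrite Rminus_0_r in Hs.
      apply (continuous_comp (fun p : R * R => polar (r * fst p) (snd p)) (fun z => Re (H z))).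
      + apply (continuous_comp_2 (fun p : R * R => r * fst p) (fun p : R * R => snd p) polar).
        * apply continuous_Rmult; [apply continuous_const | apply continuous_fst].
        * apply continuous_snd.
        * apply (continuous_polar (_, _)).
      + apply continuous_Re_comp, HC. simpl fst; simpl snd.
        replace (polar (r * s) t) with (RtoC s * polar r t)%C
          by (apply injective_projections; simpl; ring).
        rewrite Cmod_mult, Cmod_R, Cmod_polar by lra. assert (A := Rabs_pos s); nra.
    - intros s Hs. unfold c.
      rewrite (circle_integral_const H rad (r * s) r); try assumption; try lra.
      + intros z Hz; apply HC; lra.
      + nra. }
  simpl in Z.
  rewrite (RInt_ext _ (fun _ => Re (H 0))) in Z.
  - rewrite RInt_const in Z. unfold scal in Z; simpl in Z; unfold mult in Z; simpl in Z.
    fold c; lra.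
  - intros t _. do 2 f_equal. apply injective_projections; simpl; ring.
Qed.

(** * Logarithms of functions without zeros *)

Definition Clog (u : C) : C := (ln (Cmod u), atan (Im u / Re u)).

Lemma Cexp_Clog (u : C) : 0 < Re u -> Cexp (Clog u) = u.
Proof.
  intros Hu. assert (Hm : 0 < Cmod u).
  { eapply Rlt_le_trans; [|apply re_le_Cmod]. rewrite Rabs_pos_eq; lra. }
  unfold Cexp, Clog; simpl. rewrite exp_ln, cos_atan, sin_atan by assumption.
  assert (E : sqrt (1 + (Im u / Re u)²) = Cmod u / Re u).
  { rewrite <- (sqrt_pow2 (Cmod u / Re u)).
    - f_equal. unfold Rsqr, Rdiv. rewrite Rpow_mult_distr, Cmod2_alt. field. lra.
    - left; apply Rdiv_lt_0_compat; assumption. }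
  rewrite E. apply injective_projections; simpl; unfold Re, Im in *; field; lra.
Qed.

Lemma continuous_Clog (u : C) : 0 < Re u -> continuous Clog u.
Proof.
  intros Hu. assert (Hm : 0 < Cmod u).
  { eapply Rlt_le_trans; [|apply re_le_Cmod]. rewrite Rabs_pos_eq; lra. }
  apply continuous_C; simpl.
  - apply (continuous_comp Cmod ln); [apply (continuous_Cmod (fun z => z)), continuous_id|].
    apply continuity_pt_filterlim, derivable_continuous_pt.
    exists (/ Cmod u); apply derivable_pt_lim_ln, Hm.
  - apply (continuous_comp (fun u => Im u / Re u) atan).
    + apply continuous_Rmult; [apply continuous_Im|].
      apply continuous_Rinv_comp; [apply continuous_Re | lra].
    + apply continuous_atan.
Qed.

(** Compactness of the disc, as a Lebesgue number of a cover by discs. It is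
    derived from the compactness of the square around it. *)
Lemma disc_lebesgue_number (dl : C -> posreal) (r : R) :
  exists d, 0 < d /\ forall x, Cmod x <= r ->
    exists t, Cmod t <= r /\ Cmod (x - t) < dl t /\ d <= dl t.
Proof.
  assert (half_pos : forall x : R, 0 < x -> 0 < x / 2) by (intros; lra).
  (* outside the disc, the gauge is too small to reach a point of the disc *)
  set (g (u v : R) := match Rle_dec (Cmod (u, v)) r with
    | left _ => mkposreal _ (half_pos _ (cond_pos (dl (u, v))))
    | right n => mkposreal _ (half_pos _ (proj2 (Rlt_0_minus _ _) (Rnot_le_lt _ _ n)))
    end).
  destruct (compactness_value_2d (-r) r (-r) r g) as [d Hd].
  exists d; split; [apply cond_pos|]. intros x Hx.
  assert (X1 := re_le_Cmod x).
  assert (X2 : Rabs (Im x) <= Cmod x) by (eapply Rle_trans; [|apply Rmax_Cmod]; apply Rmax_r).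
  assert (X1' : Rabs (Re x) <= r) by lra. assert (X2' : Rabs (Im x) <= r) by lra.
  apply Rabs_le_between in X1'; apply Rabs_le_between in X2'.
  destruct (NNPP _ (Hd (Re x) (Im x) X1' X2')) as (u & v & _ & _ & Hu & Hv & Hg).
  assert (D : Cmod (x - (u, v)) <= Rabs (Re x - u) + Rabs (Im x - v)).
  { replace (x - (u, v))%C with (RtoC (Re x - u) + Ci * RtoC (Im x - v))%C
      by (apply injective_projections; simpl; unfold Re, Im; ring).
    eapply Rle_trans; [apply Cmod_triangle|].
    rewrite Cmod_mult, Cmod_Ci, !Cmod_R, Rmult_1_l. apply Rle_refl. }
  exists (u, v). unfold g in *. destruct Rle_dec as [Hr|Hr]; simpl in *.
  - assert (P := cond_pos (dl (u, v))). repeat split; lra.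
  - exfalso. assert (T := Cmod_triangle (- (x - (u, v))) x). rewrite Cmod_opp in T.
    replace (- (x - (u, v)) + x)%C with ((u, v) : C) in T
      by (apply injective_projections; simpl; ring).
    lra.
Qed.

(** The ratios telescope to [F ((m / n) z) / F 0], so this is a logarithm of
    [F ((m / n) z)] if [F 0 = 1] and each term is the logarithm of its ratio. *)
Fixpoint log_along (F : C -> C) (n m : nat) (z : C) : C :=
  match m with
  | O => RtoC 0
  | S k => (log_along F n k z
            + Clog (F (RtoC (INR (S k) / INR n) * z) / F (RtoC (INR k / INR n) * z)))%C
  end.

(** If [n] is large, consecutive values of [F] are so close that their ratio is
    in the half-plane where the principal logarithm is continuous. *)
Lemma exists_log (F : C -> C) (rad r : R) :
  (forall z, Cmod z < rad -> continuous F z) ->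
  (forall z, Cmod z < rad -> F z <> RtoC 0) ->
  F (RtoC 0) = RtoC 1 -> 0 < r < rad ->
  exists l : C -> C, l (RtoC 0) = RtoC 0 /\
    forall z, Cmod z < r -> continuous l z /\ Cexp (l z) = F z.
Proof.
  intros FC F0 F1 Hr.
  assert (gauge : forall t, exists d : posreal, Cmod t <= r ->
     forall x y, Cmod (x - t) < d -> Cmod (y - x) < d -> Cmod (F y - F x) < Cmod (F x)).
  { intros t. destruct (classic (Cmod t <= r)) as [Ht|Ht].
    - assert (Ht' : Cmod t < rad) by lra.
      assert (M : 0 < Cmod (F t)) by (apply Cmod_gt_0, F0, Ht').
      destruct (proj1 (continuous_CC_iff F t) (FC t Ht') (Cmod (F t) / 4)) as [d [Hd K]]; [lra|].
      assert (Hd2 : 0 < d / 2) by lra.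
      exists (mkposreal _ Hd2); simpl; intros _ x y Hx Hy.
      assert (K1 := K x ltac:(lra)).
      assert (T := Cmod_triangle (y - x) (x - t)).
      replace (y - x + (x - t))%C with (y - t)%C in T by ring.
      assert (K2 := K y ltac:(lra)).
      assert (T2 := Cmod_triangle (F y - F t) (- (F x - F t))). rewrite Cmod_opp in T2.
      replace (F y - F t + - (F x - F t))%C with (F y - F x)%C in T2 by ring.
      assert (T3 := Cmod_triangle (- (F x - F t)) (F x)). rewrite Cmod_opp in T3.
      replace (- (F x - F t) + F x)%C with (F t) in T3 by ring.
      lra.
    - exists (mkposreal 1 Rlt_0_1); tauto. }
  set (dl t := proj1_sig (constructive_indefinite_description _ (gauge t))).
  assert (Hdl : forall t, Cmod t <= r ->
     forall x y, Cmod (x - t) < dl t -> Cmod (y - x) < dl t -> Cmod (F y - F x) < Cmod (F x)).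
  { intros t; unfold dl; destruct constructive_indefinite_description; assumption. }
  destruct (disc_lebesgue_number dl r) as [d [Hd K]].
  destruct (INR_unbounded (r / d)) as [n Hn].
  assert (rd : 0 < r / d) by (apply Rdiv_lt_0_compat; lra).
  assert (n0 : 0 < INR n) by lra.
  assert (rn : r < d * INR n).
  { apply (Rmult_lt_compat_l d) in Hn; [|assumption].
    replace (d * (r / d)) with r in Hn by (field; lra). lra. }
  assert (part : forall k z, (k <= n)%nat -> Cmod z < r -> Cmod (RtoC (INR k / INR n) * z) < r).
  { intros k z Hk Hz. rewrite Cmod_mult, Cmod_R.
    assert (Hk' := le_INR _ _ Hk). assert (k0 := pos_INR k).
    rewrite Rabs_pos_eq by (apply Rmult_le_pos; [lra | left; apply Rinv_0_lt_compat; lra]).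
    assert (INR k / INR n <= 1).
    { apply Rmult_le_reg_r with (INR n); [lra|]. unfold Rdiv; rewrite Rmult_assoc, Rinv_l by lra; lra. }
    assert (M := Cmod_ge_0 z). nra. }
  assert (ratio : forall k z, (k < n)%nat -> Cmod z < r ->
    0 < Re (F (RtoC (INR (S k) / INR n) * z) / F (RtoC (INR k / INR n) * z))%C).
  { intros k z Hk Hz.
    set (x := (RtoC (INR k / INR n) * z)%C). set (y := (RtoC (INR (S k) / INR n) * z)%C).
    assert (Hx : Cmod x < r) by (apply part; [lia | assumption]).
    destruct (K x) as (t & Ht & Hxt & Hdt); [lra|].
    assert (xy : Cmod (y - x) < dl t).
    { apply Rlt_le_trans with d; [|assumption].
      replace (y - x)%C with (RtoC (/ INR n) * z)%C.
      2: { unfold x, y. rewrite S_INR. apply injective_projections; simpl; field; lra. }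
      rewrite Cmod_mult, Cmod_R, Rabs_pos_eq by (left; apply Rinv_0_lt_compat; lra).
      apply Rmult_lt_reg_l with (INR n); [lra|].
      rewrite <- Rmult_assoc, Rinv_r, Rmult_1_l by lra. lra. }
    assert (L := Hdl t Ht x y Hxt xy).
    assert (Fx : F x <> 0%C) by (apply F0; lra).
    assert (M : 0 < Cmod (F x)) by (apply Cmod_gt_0, Fx).
    assert (Q : Cmod (F y / F x - 1)%C < 1).
    { replace (F y / F x - 1)%C with ((F y - F x) / F x)%C by (field; assumption).
      rewrite Cmod_div by assumption. apply Rmult_lt_reg_r with (Cmod (F x)); [assumption|].
      unfold Rdiv; rewrite Rmult_assoc, Rinv_l by lra. lra. }
    assert (Q2 := re_le_Cmod (F y / F x - 1)%C).
    assert (Q3 : Rabs (Re (F y / F x - 1)%C) < 1) by lra.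
    apply Rabs_lt_between in Q3.
    replace (Re (F y / F x - 1)%C) with (Re (F y / F x)%C - 1) in Q3 by reflexivity. lra. }
  assert (s0 : forall z : C, (RtoC (INR 0 / INR n) * z)%C = RtoC 0).
  { intros z; simpl INR. apply injective_projections; simpl; field; lra. }
  assert (main : forall m z, (m <= n)%nat -> Cmod z < r ->
    continuous (log_along F n m) z /\ Cexp (log_along F n m z) = F (RtoC (INR m / INR n) * z)%C).
  { induction m; intros z Hm Hz.
    - split; [apply continuous_const|]. cbn [log_along]. now rewrite s0, Cexp_0, F1.
    - destruct (IHm z ltac:(lia) Hz) as [IH1 IH2].
      assert (cF : forall k, (k <= n)%nat -> continuous (fun z : C => F (RtoC (INR k / INR n) * z)%C) z).
      { intros k Hk. apply (continuous_comp (fun z : C => RtoC (INR k / INR n) * z)%C F).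
        - apply continuous_Cmult; [apply continuous_const | apply continuous_id].
        - apply FC. assert (B := part k z Hk Hz). lra. }
      assert (nz : F (RtoC (INR m / INR n) * z)%C <> RtoC 0).
      { apply F0. assert (B := part m z ltac:(lia) Hz). lra. }
      split.
      + cbn [log_along]. apply continuous_Cplus; [exact IH1|].
        apply (continuous_comp
          (fun z : C => F (RtoC (INR (S m) / INR n) * z) / F (RtoC (INR m / INR n) * z))%C Clog).
        * apply continuous_Cmult; [apply cF; lia|].
          apply continuous_Cinv; [apply cF; lia | exact nz].
        * apply continuous_Clog, ratio; [lia | assumption].
      + cbn [log_along]. rewrite Cexp_plus, IH2, Cexp_Clog by (apply ratio; [lia | assumption]).
        field. exact nz. }
  exists (log_along F n n). split.
  - clear - F1 n0.
    assert (G : forall m, log_along F n m (RtoC 0) = RtoC 0).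
    { induction m; [reflexivity|]. cbn [log_along]. rewrite IHm, !Cmult_0_r, F1.
      unfold Clog. replace (1 / 1)%C with (RtoC 1) by (field; apply C1_nz).
      rewrite Cmod_1, ln_1. simpl. unfold Rdiv. rewrite Rmult_0_l, atan_0.
      apply injective_projections; simpl; ring. }
    apply G.
  - intros z Hz. destruct (main n z (Nat.le_refl n) Hz) as [M1 M2]. split; [exact M1|].
    rewrite M2. f_equal. replace (INR n / INR n) with 1 by (field; lra). ring.
Qed.

(** [Cexp] is locally invertible with derivative [F z] at [l z], so a continuous
    logarithm is as smooth as [F]. *)
Lemma is_derive_log (l F : C -> C) (z m : C) :
  continuous l z -> locally z (fun w => Cexp (l w) = F w) -> is_derive F z m ->
  is_derive l z (m / F z)%C.
Proof.
  intros Cl HE HF.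
  assert (Ez : Cexp (l z) = F z) by (exact (locally_singleton _ _ HE)).
  assert (Fz : F z <> RtoC 0) by (rewrite <- Ez; apply Cexp_neq_0).
  assert (A : 0 < Cmod (F z)) by (apply Cmod_gt_0, Fz).
  assert (Bm := Cmod_ge_0 m).
  apply is_derive_CC_iff; intros eps Heps.
  (* [e1] controls the second-order error of [Cexp], [e2] that of [F] *)
  set (e1 := Rmin (1 / 2) (eps * Cmod (F z) / (4 * (Cmod m + 1)))).
  assert (He1 : 0 < e1).
  { apply Rmin_glb_lt; [lra|]. apply Rdiv_lt_0_compat; nra. }
  assert (e1a : e1 <= 1 / 2) by apply Rmin_l.
  assert (e1b : e1 * (4 * (Cmod m + 1)) <= eps * Cmod (F z)).
  { apply Rle_trans with (eps * Cmod (F z) / (4 * (Cmod m + 1)) * (4 * (Cmod m + 1))).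
    - apply Rmult_le_compat_r; [lra | apply Rmin_r].
    - right; field; lra. }
  set (e2 := Rmin 1 (eps * Cmod (F z) / 2)).
  assert (He2 : 0 < e2) by (apply Rmin_glb_lt; [lra | nra]).
  assert (e2a : e2 <= 1) by apply Rmin_l. assert (e2b : e2 <= eps * Cmod (F z) / 2) by apply Rmin_r.
  destruct (proj1 (is_derive_CC_iff _ _ _) is_derive_Cexp_0 e1 He1) as [d1 [D1 K1]].
  destruct (proj1 (is_derive_CC_iff _ _ _) HF e2 He2) as [d2 [D2 K2]].
  destruct (proj1 (continuous_CC_iff _ _) Cl d1 D1) as [d3 [D3 K3]].
  apply locally_Cmod in HE as [d4 [D4 K4]].
  exists (Rmin (Rmin d2 d3) d4); split; [repeat apply Rmin_glb_lt; assumption|].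
  intros w Hw.
  assert (W : Cmod (w - z) < d2 /\ Cmod (w - z) < d3 /\ Cmod (w - z) < d4).
  { assert (M1 := Rmin_l (Rmin d2 d3) d4). assert (M2 := Rmin_r (Rmin d2 d3) d4).
    assert (M3 := Rmin_l d2 d3). assert (M4 := Rmin_r d2 d3). lra. }
  destruct W as (W2 & W3 & W4).
  specialize (K2 w W2); specialize (K3 w W3); specialize (K4 w W4).
  set (D := (l w - l z)%C) in *.
  assert (ED : Cexp D = (F w / F z)%C).
  { rewrite <- K4, <- Ez. replace (l w) with (D + l z)%C by (unfold D; ring).
    rewrite Cexp_plus. field. apply Cexp_neq_0. }
  specialize (K1 D). replace (D - 0)%C with D in K1 by ring. specialize (K1 K3).
  rewrite Cexp_0, ED in K1.
  set (X := (F w / F z - 1)%C).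
  set (E := (F w / F z - 1 - D * 1)%C) in *.
  assert (DX : D = (X - E)%C) by (unfold X, E; ring).
  assert (T1 := Cmod_triangle X (- E)). rewrite Cmod_opp in T1.
  change (X + - E)%C with (X - E)%C in T1. rewrite <- DX in T1.
  assert (D0 := Cmod_ge_0 D).
  assert (hD : Cmod D <= 2 * Cmod X) by nra.
  set (N := (F w - F z - (w - z) * m)%C) in *.
  assert (XN : X = ((N + (w - z) * m) / F z)%C) by (unfold X, N; field; assumption).
  assert (hX : Cmod X * Cmod (F z) <= (1 + Cmod m) * Cmod (w - z)).
  { rewrite XN, Cmod_div by assumption.
    replace (Cmod (N + (w - z) * m) / Cmod (F z) * Cmod (F z)) with (Cmod (N + (w - z) * m)) by (field; lra).
    eapply Rle_trans; [apply Cmod_triangle|]. rewrite Cmod_mult.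
    assert (V := Cmod_ge_0 (w - z)). nra. }
  replace (D - (w - z) * (m / F z))%C with (N / F z - E)%C.
  2: { rewrite DX, XN. field. assumption. }
  assert (T2 := Cmod_triangle (N / F z) (- E)). rewrite Cmod_opp in T2.
  eapply Rle_trans; [exact T2|].
  rewrite Cmod_div by assumption.
  apply Rmult_le_reg_r with (Cmod (F z)); [assumption|].
  replace ((Cmod N / Cmod (F z) + Cmod E) * Cmod (F z)) with (Cmod N + Cmod E * Cmod (F z)) by (field; lra).
  assert (V := Cmod_ge_0 (w - z)).
  assert (N1 : Cmod N <= eps * Cmod (F z) / 2 * Cmod (w - z)).
  { eapply Rle_trans; [exact K2|]. apply Rmult_le_compat_r; assumption. }
  assert (E1 : Cmod E * Cmod (F z) <= e1 * (2 * ((1 + Cmod m) * Cmod (w - z)))).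
  { apply Rle_trans with (e1 * (2 * Cmod X) * Cmod (F z)).
    - apply Rmult_le_compat_r; [lra|]. eapply Rle_trans; [exact K1|]. apply Rmult_le_compat_l; lra.
    - replace (e1 * (2 * Cmod X) * Cmod (F z)) with (e1 * (2 * (Cmod X * Cmod (F z)))) by ring.
      apply Rmult_le_compat_l; lra. }
  assert (E2 : e1 * (4 * (Cmod m + 1)) * Cmod (w - z) <= eps * Cmod (F z) * Cmod (w - z))
    by (apply Rmult_le_compat_r; assumption).
  lra.
Qed.

(* The type of an integral is only convertible to [R], which stops [ring]. *)
Ltac ring_R := match goal with |- @eq _ ?a ?b => change (@eq R a b); ring end.

Lemma RInt_minus_R (f g : R -> R) a b : ex_RInt f a b -> ex_RInt g a b ->
  RInt (fun t => f t - g t) a b = RInt f a b - RInt g a b.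
Proof. exact (RInt_minus (V := R_CompleteNormedModule) f g a b). Qed.

Lemma RInt_plus_R (f g : R -> R) a b : ex_RInt f a b -> ex_RInt g a b ->
  RInt (fun t => f t + g t) a b = RInt f a b + RInt g a b.
Proof. exact (RInt_plus (V := R_CompleteNormedModule) f g a b). Qed.

Lemma RInt_scal_R (k : R) (f : R -> R) a b : ex_RInt f a b ->
  RInt (fun t => k * f t) a b = k * RInt f a b.
Proof. exact (RInt_scal (V := R_CompleteNormedModule) f a b k). Qed.

Lemma RInt_const_R (k : R) a b : RInt (fun _ => k) a b = (b - a) * k.
Proof. exact (RInt_const (V := R_CompleteNormedModule) a b k). Qed.

Lemma ex_RInt_continuous_R (f : R -> R) a b : (forall t, continuous f t) -> ex_RInt f a b.
Proof. intros H. apply (ex_RInt_continuous (V := R_CompleteNormedModule)); auto. Qed.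

(** * First Fourier coefficients on circles *)

Definition wave (u : C) (t : R) : R := Re (u * polar 1 t).

Lemma continuous_wave u t : continuous (wave u) t.
Proof.
  apply continuous_Re_comp, continuous_Cmult; [apply continuous_const | apply continuous_polar_t].
Qed.

Lemma RInt_wave u : RInt (wave u) 0 (2 * PI) = 0.
Proof.
  apply is_RInt_unique.
  replace 0 with (minus ((fun t => Re u * sin t + Im u * cos t) (2 * PI))
                        ((fun t => Re u * sin t + Im u * cos t) 0)) at 2.
  2: { unfold minus, plus, opp; simpl. rewrite sin_2PI, cos_2PI, sin_0, cos_0; ring. }
  apply (is_RInt_derive (V := R_CompleteNormedModule) (fun t => Re u * sin t + Im u * cos t)).
  - intros t _. unfold wave, polar; simpl. auto_derive; [trivial | unfold Re, Im; ring].
  - intros t _; apply continuous_wave.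
Qed.

(** In terms of [z = polar r t], [wave u t * Re (H z)] is half the real part of
    [(u z / r + Cconj u r / z) H z]. The only singularity of this function is
    the pole [Cconj u r H(0) / z], whose real part has mean 0. *)
Lemma circle_wave_mean (H : C -> C) (rad r : R) (d u : C) :
  (forall z, Cmod z < rad -> continuous H z) ->
  (forall z, Cmod z < rad -> off_slit z -> ex_derive H z) ->
  is_derive H (RtoC 0) d -> 0 < r < rad ->
  RInt (fun t => wave u t * Re (H (polar r t))) 0 (2 * PI) = PI * r * Re (d * Cconj u).
Proof.
  intros HC HD H0 Hr.
  assert (dec : forall z : C, {z = RtoC 0} + {z <> RtoC 0}) by (intros z; apply excluded_middle_informative).
  set (k := fun z : C => if dec z then d else ((H z - H 0) / z)%C).
  assert (kE : forall z, z <> RtoC 0 -> k z = ((H z - H 0) / z)%C).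
  { intros z Hz; unfold k; destruct (dec z); [contradiction | reflexivity]. }
  assert (k0 : k (RtoC 0) = d) by (unfold k; destruct (dec 0); [reflexivity | contradiction]).
  assert (nz : forall z : C, z <> RtoC 0 -> locally z (fun w : C => ((H w - H 0) / w)%C = k w)).
  { intros z Hz. apply locally_Cmod. exists (Cmod z); split; [now apply Cmod_gt_0|].
    intros w Hw. symmetry; apply kE; intros ->.
    replace (0 - z)%C with (- z)%C in Hw by ring. rewrite Cmod_opp in Hw; lra. }
  assert (kC : forall z, Cmod z < rad -> continuous k z).
  { intros z Hz. destruct (dec z) as [->|Nz].
    - apply continuous_CC_iff; intros eps He.
      destruct (proj1 (is_derive_CC_iff _ _ _) H0 (eps / 2)) as [e [He2 K]]; [lra|].
      exists e; split; [assumption|]; intros w Hw. rewrite k0.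
      destruct (dec w) as [->|Nw].
      + rewrite k0. replace (d - d)%C with (RtoC 0) by ring. rewrite Cmod_0; assumption.
      + rewrite kE by assumption. specialize (K w Hw).
        replace (w - 0)%C with w in K by ring.
        replace ((H w - H 0) / w - d)%C with ((H w - H 0 - w * d) / w)%C by (field; assumption).
        assert (M : 0 < Cmod w) by (now apply Cmod_gt_0).
        rewrite Cmod_div by assumption. apply Rmult_lt_reg_r with (Cmod w); [assumption|].
        unfold Rdiv; rewrite Rmult_assoc, Rinv_l by lra. nra.
    - apply (continuous_ext_loc _ (fun w : C => (H w - H 0) / w)%C); [now apply nz|].
      apply continuous_Cmult; [apply continuous_Cminus; [now apply HC | apply continuous_const]|].
      apply continuous_Cinv; [apply continuous_id | assumption]. }
  assert (kD : forall z, Cmod z < rad -> off_slit z -> ex_derive k z).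
  { intros z Hz Sz.
    assert (Nz : z <> RtoC 0).
    { intros ->; destruct Sz as [S|S]; simpl in S; lra. }
    apply (ex_derive_CC_ext_loc (fun w => (H w - H 0) / w)%C); [now apply nz|].
    apply ex_derive_Cmult.
    - apply ex_derive_Cminus; [now apply HD | apply ex_derive_Cconst].
    - apply ex_derive_Cinv; [apply ex_derive_Cid | assumption]. }
  set (T := fun z : C => (RtoC (/ (2 * r)) * u * (z * H z) + RtoC (r / 2) * Cconj u * k z)%C).
  assert (TM := circle_mean T rad r).
  rewrite (RInt_ext _ (fun t => Re (T (polar r t)) + wave (u * Cconj (H 0) / 2) t)).
  - rewrite RInt_plus_R.
    + rewrite RInt_wave, TM; trivial.
      * unfold T. rewrite k0. replace (RtoC (/ (2 * r)) * u * (0 * H 0))%C with (RtoC 0) by ring.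
        destruct d, u; unfold Re; simpl; field.
      * intros z Hz. apply continuous_Cplus; apply continuous_Cmult.
        -- apply continuous_const.
        -- apply continuous_Cmult; [apply continuous_id | now apply HC].
        -- apply continuous_const.
        -- now apply kC.
      * intros z Hz Sz. apply ex_derive_Cplus; apply ex_derive_Cmult.
        -- apply ex_derive_Cconst.
        -- apply ex_derive_Cmult; [apply ex_derive_Cid | now apply HD].
        -- apply ex_derive_Cconst.
        -- now apply kD.
    + apply ex_RInt_continuous_R; intros t.
      apply continuous_Re_comp, (continuous_comp (polar r) T); [apply continuous_polar_t|].
      assert (B : Cmod (polar r t) < rad) by (rewrite Cmod_polar; lra).
      apply continuous_Cplus; apply continuous_Cmult.
      -- apply continuous_const.
      -- apply continuous_Cmult; [apply continuous_id | now apply HC].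
      -- apply continuous_const.
      -- now apply kC.
    + apply ex_RInt_continuous_R; intros t; apply continuous_wave.
  - intros t _. unfold T. rewrite kE by (apply polar_neq_0; lra).
    set (e := polar 1 t).
    assert (Ep : polar r t = (RtoC r * e)%C) by (apply injective_projections; simpl; ring).
    assert (Ec : (e * Cconj e)%C = RtoC 1).
    { rewrite <- Cmod2_conj. unfold e. rewrite Cmod_polar by lra. f_equal; ring. }
    assert (Ne : e <> RtoC 0) by (apply polar_neq_0; lra).
    assert (Ei : forall x : C, (x / (RtoC r * e))%C = (RtoC (/ r) * (x * Cconj e))%C).
    { intros x.
      assert (Ie : Cconj e = (/ e)%C).
      { transitivity (/ e * (e * Cconj e))%C; [field; assumption | rewrite Ec; ring]. }
      assert (Nr : RtoC r <> RtoC 0) by (intros E; apply RtoC_inj in E; lra).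
      rewrite Ie, RtoC_inv by lra. field; split; assumption. }
    unfold wave. fold e. set (h := H (polar r t)). set (h0 := H 0). rewrite Ep, Ei.
    transitivity (Re ((RtoC (/ 2) * u * e * h + RtoC (/ 2) * (Cconj u * Cconj e) * h))%C).
    { destruct u as [u1 u2], e as [e1 e2], h as [h1 h2]; unfold Re; simpl; field. }
    replace (RtoC (/ (2 * r)) * u * (RtoC r * e * h))%C with (RtoC (/ 2) * u * e * h)%C.
    2: { transitivity (RtoC (/ (2 * r)) * RtoC r * (u * e * h))%C; [|ring].
         rewrite <- RtoC_mult. replace (/ (2 * r) * r) with (/ 2) by (field; lra). ring. }
    replace (RtoC (r / 2) * Cconj u * (RtoC (/ r) * ((h - h0) * Cconj e)))%C
      with (RtoC (/ 2) * (Cconj u * Cconj e) * (h - h0))%C.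
    2: { transitivity (RtoC (r / 2) * RtoC (/ r) * (Cconj u * ((h - h0) * Cconj e)))%C; [|ring].
         rewrite <- RtoC_mult. replace (r / 2 * / r) with (/ 2) by (field; lra). ring. }
    destruct u as [u1 u2], e as [e1 e2], h as [h1 h2], h0 as [g1 g2]; unfold Re; simpl; field.
Qed.

(** A function without zeros has a holomorphic logarithm, to which the mean
    values of [circle_mean] and [circle_wave_mean] apply. *)
Lemma circle_log_means (F : C -> C) (rad r : R) (d u : C) :
  (forall z, Cmod z < rad -> continuous F z) ->
  (forall z, Cmod z < rad -> off_slit z -> ex_derive F z) ->
  (forall z, Cmod z < rad -> F z <> RtoC 0) ->
  F (RtoC 0) = RtoC 1 -> is_derive F (RtoC 0) d -> 0 < r < rad ->
  RInt (fun t => ln (Cmod (F (polar r t)))) 0 (2 * PI) = 0 /\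
  RInt (fun t => wave u t * ln (Cmod (F (polar r t)))) 0 (2 * PI) = PI * r * Re (d * Cconj u).
Proof.
  intros FC FD F0 F1 Fd Hr.
  set (rad' := (r + rad) / 2).
  destruct (exists_log F rad rad') as [l [l0 Hl]]; trivial; [unfold rad'; lra|].
  assert (Hr' : 0 < r < rad') by (unfold rad'; lra).
  assert (lR : forall t, ln (Cmod (F (polar r t))) = Re (l (polar r t))).
  { intros t. destruct (Hl (polar r t)) as [_ <-]; [rewrite Cmod_polar; lra|].
    rewrite Cmod_Cexp; apply ln_exp. }
  assert (loc : forall z, Cmod z < rad' -> locally z (fun w => Cexp (l w) = F w)).
  { intros z Hz. apply locally_Cmod. exists (rad' - Cmod z); split; [lra|]. intros w Hw.
    apply Hl. assert (T := Cmod_triangle (w - z) z). replace (w - z + z)%C with w in T by ring. lra. }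
  assert (lC : forall z, Cmod z < rad' -> continuous l z) by (intros z Hz; now apply Hl).
  assert (lD : forall z, Cmod z < rad' -> off_slit z -> ex_derive l z).
  { intros z Hz Sz. destruct (FD z) as [m Hm]; [unfold rad' in *; lra | assumption|].
    eexists; apply (is_derive_log l F); [now apply lC | now apply loc | exact Hm]. }
  split.
  - rewrite (RInt_ext _ (fun t => Re (l (polar r t)))) by (intros t _; apply lR).
    rewrite (circle_mean l rad' r) by assumption. rewrite l0; simpl; ring.
  - rewrite (RInt_ext _ (fun t => wave u t * Re (l (polar r t)))) by (intros t _; now rewrite lR).
    apply (circle_wave_mean l rad'); trivial.
    apply (is_derive_CC_eq _ _ (d / F (RtoC 0))%C).
    + apply is_derive_log; trivial; [apply lC | apply loc]; rewrite Cmod_0; lra.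
    + rewrite F1. field.
Qed.

(** * Double integrals over the torus *)

Definition continuous_2 (K : R -> R -> R) : Prop :=
  forall p : R * R, continuous (fun p : R * R => K (fst p) (snd p)) p.

Definition torus_integral (K : R -> R -> R) : R :=
  RInt (fun x => RInt (K x) 0 (2 * PI)) 0 (2 * PI).

Lemma two_PI_pos : 0 < 2 * PI.
Proof. assert (H := PI_RGT_0); lra. Qed.

Section Continuous2.
Implicit Types K L : R -> R -> R.

Lemma continuous_2_const k : continuous_2 (fun _ _ => k).
Proof. intros p; apply continuous_const. Qed.

Lemma continuous_2_fst (f : R -> R) :
  (forall t, continuous f t) -> continuous_2 (fun x _ => f x).
Proof. intros H p. apply (continuous_comp fst f); [destruct p; apply continuous_fst | apply H]. Qed.

Lemma continuous_2_snd (f : R -> R) :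
  (forall t, continuous f t) -> continuous_2 (fun _ y => f y).
Proof. intros H p. apply (continuous_comp snd f); [destruct p; apply continuous_snd | apply H]. Qed.

Lemma continuous_2_plus K L :
  continuous_2 K -> continuous_2 L -> continuous_2 (fun x y => K x y + L x y).
Proof. intros HK HL p; apply continuous_Rplus; [apply HK | apply HL]. Qed.

Lemma continuous_2_minus K L :
  continuous_2 K -> continuous_2 L -> continuous_2 (fun x y => K x y - L x y).
Proof. intros HK HL p; apply continuous_Rminus; [apply HK | apply HL]. Qed.

Lemma continuous_2_mult K L :
  continuous_2 K -> continuous_2 L -> continuous_2 (fun x y => K x y * L x y).
Proof. intros HK HL p; apply continuous_Rmult; [apply HK | apply HL]. Qed.

Lemma continuous_2_pow K n : continuous_2 K -> continuous_2 (fun x y => K x y ^ n).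
Proof.
  intros HK; induction n; simpl; [apply continuous_2_const | now apply continuous_2_mult].
Qed.

Lemma continuous_2_sum (F : nat -> R -> R -> R) n :
  (forall i, continuous_2 (F i)) -> continuous_2 (fun x y => sum_n (fun i => F i x y) n).
Proof.
  intros H; induction n.
  - intros p; apply (continuous_ext (fun p => F O (fst p) (snd p))); [|apply H].
    intros q; now rewrite sum_O.
  - intros p; apply (continuous_ext (fun p => sum_n (fun i => F i (fst p) (snd p)) n + F (S n) (fst p) (snd p))).
    + intros q; now rewrite sum_Sn.
    + exact (continuous_2_plus _ _ IHn (H (S n)) p).
Qed.

Lemma continuous_2_slice K x y : continuous_2 K -> continuous (K x) y.
Proof.
  intros H. apply (continuous_comp_2 (fun _ => x) (fun y => y) K);
    [apply continuous_const | apply continuous_id | apply (H (x, y))].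
Qed.

Lemma ex_RInt_slice K x a b : continuous_2 K -> ex_RInt (K x) a b.
Proof. intros H; apply ex_RInt_continuous_R; intros t; now apply continuous_2_slice. Qed.

Lemma continuous_inner_integral K x :
  continuous_2 K -> continuous (fun x => RInt (K x) 0 (2 * PI)) x.
Proof.
  intros H. apply (continuous_RInt_param K); [left; apply two_PI_pos|].
  apply filter_forall; intros; apply H.
Qed.

Lemma ex_RInt_inner K a b :
  continuous_2 K -> ex_RInt (fun x => RInt (K x) 0 (2 * PI)) a b.
Proof. intros H; apply ex_RInt_continuous_R; intros t; now apply continuous_inner_integral. Qed.

Lemma torus_integral_ext K L : (forall x y, K x y = L x y) -> torus_integral K = torus_integral L.
Proof. intros H; apply RInt_ext; intros x _; apply RInt_ext; intros y _; apply H. Qed.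

Lemma torus_integral_plus K L : continuous_2 K -> continuous_2 L ->
  torus_integral (fun x y => K x y + L x y) = torus_integral K + torus_integral L.
Proof.
  intros HK HL. unfold torus_integral. rewrite <- RInt_plus_R by (now apply ex_RInt_inner).
  apply RInt_ext; intros x _. apply RInt_plus_R; now apply ex_RInt_slice.
Qed.

Lemma torus_integral_minus K L : continuous_2 K -> continuous_2 L ->
  torus_integral (fun x y => K x y - L x y) = torus_integral K - torus_integral L.
Proof.
  intros HK HL. unfold torus_integral. rewrite <- RInt_minus_R by (now apply ex_RInt_inner).
  apply RInt_ext; intros x _. apply RInt_minus_R; now apply ex_RInt_slice.
Qed.

Lemma torus_integral_scal k K : continuous_2 K ->
  torus_integral (fun x y => k * K x y) = k * torus_integral K.
Proof.
  intros HK. unfold torus_integral. rewrite <- RInt_scal_R by (now apply ex_RInt_inner).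
  apply RInt_ext; intros x _. apply RInt_scal_R; now apply ex_RInt_slice.
Qed.

Lemma torus_integral_le K L : continuous_2 K -> continuous_2 L ->
  (forall x y, K x y <= L x y) -> torus_integral K <= torus_integral L.
Proof.
  intros HK HL H. assert (P := two_PI_pos).
  apply RInt_le; [lra | now apply ex_RInt_inner | now apply ex_RInt_inner |].
  intros x _. apply RInt_le; [lra | now apply ex_RInt_slice | now apply ex_RInt_slice |].
  intros y _; apply H.
Qed.

Lemma torus_integral_const k : torus_integral (fun _ _ => k) = 2 * PI * (2 * PI) * k.
Proof.
  unfold torus_integral. rewrite RInt_const_R, RInt_const_R. ring.
Qed.

Lemma torus_integral_prod (f g : R -> R) :
  (forall t, continuous f t) -> (forall t, continuous g t) ->
  torus_integral (fun x y => f x * g y) = RInt f 0 (2 * PI) * RInt g 0 (2 * PI).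
Proof.
  intros Hf Hg. unfold torus_integral.
  rewrite (Rmult_comm (RInt f 0 _)), <- RInt_scal_R by (now apply ex_RInt_continuous_R).
  apply RInt_ext; intros x _. rewrite RInt_scal_R by (now apply ex_RInt_continuous_R).
  apply Rmult_comm.
Qed.

Lemma torus_integral_sum (F : nat -> R -> R -> R) n :
  (forall i, continuous_2 (F i)) ->
  torus_integral (fun x y => sum_n (fun i => F i x y) n) =
  sum_n (fun i => torus_integral (F i)) n.
Proof.
  intros H; induction n.
  - rewrite sum_O. apply torus_integral_ext; intros; now rewrite sum_O.
  - rewrite sum_Sn, <- IHn.
    rewrite (torus_integral_ext _ (fun x y => sum_n (fun i => F i x y) n + F (S n) x y))
      by (intros; now rewrite sum_Sn).
    apply torus_integral_plus; [now apply continuous_2_sum | apply H].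
Qed.

(** Both sides have the same derivative as functions of the upper bound of the
    integral in [x]. *)
Lemma torus_integral_swap K : continuous_2 K ->
  torus_integral K = torus_integral (fun x y => K y x).
Proof.
  intros H. unfold torus_integral.
  set (psi X := RInt (fun y => RInt (fun t => K t y) 0 X) 0 (2 * PI)).
  assert (cs : forall x y, continuous (fun t => K t y) x).
  { intros x y. apply (continuous_comp_2 (fun x => x) (fun _ => y) K);
    [apply continuous_id | apply continuous_const | apply (H (x, y))]. }
  assert (di : forall y X, is_derive (fun X => RInt (fun t => K t y) 0 X) X (K X y)).
  { intros y X. apply (is_derive_RInt (V := R_NormedModule) (fun t => K t y) _ 0); [|apply cs].
    apply filter_forall; intros z. apply (RInt_correct (V := R_CompleteNormedModule)).
    apply ex_RInt_continuous_R; intros; apply cs. }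
  apply is_RInt_unique.
  replace (RInt (fun x => RInt (fun y => K y x) 0 (2 * PI)) 0 (2 * PI))
    with (minus (psi (2 * PI)) (psi 0)).
  2: { unfold psi at 2. rewrite (RInt_ext (fun y => RInt (fun t => K t y) 0 0) (fun _ => 0)).
       - rewrite RInt_const_R. unfold minus, plus, opp; simpl. unfold psi. ring.
       - intros y _. apply (RInt_point (V := R_CompleteNormedModule)). }
  apply (is_RInt_derive (V := R_CompleteNormedModule) psi).
  - intros X _.
    replace (RInt (K X) 0 (2 * PI))
      with (RInt (fun y => Derive (fun X => RInt (fun t => K t y) 0 X) X) 0 (2 * PI)).
    2: { apply RInt_ext; intros y _. apply is_derive_unique, di. }
    apply (is_derive_RInt_param (fun X y => RInt (fun t => K t y) 0 X)).
    + apply filter_forall; intros X' y _. eexists; apply di.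
    + intros y _. apply (continuity_2d_pt_ext K).
      * intros u v. symmetry; apply is_derive_unique, di.
      * apply continuity_2d_pt_filterlim, (H (X, y)).
    + apply filter_forall; intros X'. apply ex_RInt_continuous_R; intros y.
      (* rescaled to a fixed interval of integration, for [continuous_RInt_param] *)
      apply (continuous_ext (fun y => X' * RInt (fun s => K (X' * s + 0) y) 0 1)).
      * intros y'. rewrite <- RInt_scal_R.
        -- transitivity (RInt (fun t => K t y') (X' * 0 + 0) (X' * 1 + 0)); [|f_equal; ring].
           apply (RInt_comp_lin (V := R_CompleteNormedModule) (fun t => K t y') X' 0 0 1).
           apply ex_RInt_continuous_R; intros; apply cs.
        -- apply ex_RInt_continuous_R; intros s.
           apply (continuous_comp (fun s => X' * s + 0) (fun t => K t y')); [|apply cs].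
           apply continuous_Rplus; [|apply continuous_const].
           apply continuous_Rmult; [apply continuous_const | apply continuous_id].
      * apply continuous_Rmult; [apply continuous_const|].
        apply (continuous_RInt_param (fun y s => K (X' * s + 0) y)); [lra|].
        apply filter_forall; intros y' s _.
        apply (continuous_comp_2 (fun p : R * R => X' * snd p + 0) (fun p : R * R => fst p) K).
        -- apply continuous_Rplus; [|apply continuous_const].
           apply continuous_Rmult; [apply continuous_const | apply continuous_snd].
        -- apply continuous_fst.
        -- apply (H (_, _)).
  - intros X _. now apply continuous_inner_integral.
Qed.

End Continuous2.

(** * Positivity of the logarithmic energy *)

Definition sum2 (M : nat) (F : nat -> nat -> R) : R := sum_n (fun i => sum_n (F i) M) M.

Lemma sum_n_le_const (f : nat -> R) (k : R) n :
  (forall i, f i <= k) -> sum_n f n <= INR (S n) * k.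
Proof.
  intros H; induction n.
  - rewrite sum_O; simpl; rewrite Rmult_1_l; apply H.
  - rewrite sum_Sn. change (sum_n f n + f (S n) <= INR (S (S n)) * k).
    rewrite (S_INR (S n)). specialize (H (S n)). lra.
Qed.

Lemma sum2_ext M F G : (forall i j, F i j = G i j) -> sum2 M F = sum2 M G.
Proof. intros H; apply sum_n_ext; intros i; apply sum_n_ext; intros j; apply H. Qed.

Lemma sum2_plus M F G : sum2 M (fun i j => F i j + G i j) = sum2 M F + sum2 M G.
Proof.
  unfold sum2. rewrite <- (sum_n_plus (G := R_AbelianMonoid)).
  apply sum_n_ext; intros i. apply (sum_n_plus (G := R_AbelianMonoid)).
Qed.

Lemma sum2_scal M k F : sum2 M (fun i j => k * F i j) = k * sum2 M F.
Proof.
  unfold sum2. rewrite <- (sum_n_mult_l (K := R_Ring)).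
  apply sum_n_ext; intros i. apply (sum_n_mult_l (K := R_Ring)).
Qed.

Lemma sum2_prod M (f g : nat -> R) : sum2 M (fun i j => f i * g j) = sum_n f M * sum_n g M.
Proof.
  unfold sum2. rewrite <- (sum_n_mult_r (K := R_Ring)).
  apply sum_n_ext; intros i. apply (sum_n_mult_l (K := R_Ring)).
Qed.

Lemma sum2_le_const M F k :
  (forall i j, F i j <= k) -> sum2 M F <= INR (S M) * (INR (S M) * k).
Proof. intros H; apply sum_n_le_const; intros i; apply sum_n_le_const; intros j; apply H. Qed.

Lemma continuous_2_sum2 M (F : nat -> nat -> R -> R -> R) :
  (forall i j, continuous_2 (F i j)) -> continuous_2 (fun x y => sum2 M (fun i j => F i j x y)).
Proof.
  intros H. apply (continuous_2_sum (fun i x y => sum_n (fun j => F i j x y) M)).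
  intros i. apply continuous_2_sum, H.
Qed.

Lemma torus_integral_sum2 M (F : nat -> nat -> R -> R -> R) :
  (forall i j, continuous_2 (F i j)) ->
  torus_integral (fun x y => sum2 M (fun i j => F i j x y)) =
  sum2 M (fun i j => torus_integral (F i j)).
Proof.
  intros H. unfold sum2.
  rewrite (torus_integral_sum (fun i x y => sum_n (fun j => F i j x y) M)).
  - apply sum_n_ext; intros i. now apply torus_integral_sum.
  - intros i; now apply continuous_2_sum.
Qed.

Definition dot3 (u v : nat -> R) : R := u 0%nat * v 0%nat + u 1%nat * v 1%nat + u 2%nat * v 2%nat.

(** The kernel is the Gram kernel of the [n]-fold tensor powers of the vectors
    [v i x]: expanding one factor of the power reduces [n] by 1 and multiplies
    the weights by the coordinates of [v]. *)
Lemma gram_power_nonneg M (v : nat -> R -> nat -> R) n :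
  (forall i k t, continuous (fun x => v i x k) t) ->
  forall c : nat -> R -> R, (forall i t, continuous (c i) t) ->
  0 <= torus_integral (fun x y => sum2 M (fun i j => c i x * c j y * dot3 (v i x) (v j y) ^ n)).
Proof.
  intros Hv.
  assert (cd : forall i j, continuous_2 (fun x y => dot3 (v i x) (v j y))).
  { intros i j. repeat apply continuous_2_plus; apply continuous_2_mult;
      apply continuous_2_fst || apply continuous_2_snd; intros; apply Hv. }
  assert (cc : forall n (c : nat -> R -> R), (forall i t, continuous (c i) t) ->
     continuous_2 (fun x y => sum2 M (fun i j => c i x * c j y * dot3 (v i x) (v j y) ^ n))).
  { intros m c Hc. apply (continuous_2_sum2 M (fun i j x y => c i x * c j y * dot3 (v i x) (v j y) ^ m)).
    intros i j. apply continuous_2_mult.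
    - apply continuous_2_mult; [apply continuous_2_fst | apply continuous_2_snd]; apply Hc.
    - now apply (continuous_2_pow (fun x y => dot3 (v i x) (v j y))). }
  induction n; intros c Hc.
  - rewrite (torus_integral_ext _ (fun x y => sum_n (fun i => c i x) M * sum_n (fun i => c i y) M)).
    + rewrite torus_integral_prod; [nra | |];
      intros t; apply (continuous_2_slice (fun _ y => sum_n (fun i => c i y) M) 0);
      apply (continuous_2_sum (fun i _ y => c i y)); intros i; apply continuous_2_snd, Hc.
    + intros x y. rewrite <- sum2_prod. apply sum2_ext; intros; simpl; ring.
  - set (cv := fun (k : nat) (i : nat) (x : R) => c i x * v i x k).
    assert (Hcv : forall k i t, continuous (cv k i) t)
      by (intros; apply continuous_Rmult; [apply Hc | apply Hv]).
    set (Q := fun k x y => sum2 M (fun i j => cv k i x * cv k j y * dot3 (v i x) (v j y) ^ n)).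
    rewrite (torus_integral_ext _ (fun x y => Q 0%nat x y + Q 1%nat x y + Q 2%nat x y)).
    + assert (cQ : forall k, continuous_2 (Q k)) by (intros; now apply cc).
      assert (c01 := continuous_2_plus _ _ (cQ 0%nat) (cQ 1%nat)).
      rewrite (torus_integral_plus _ _ c01 (cQ 2%nat)).
      rewrite (torus_integral_plus _ _ (cQ 0%nat) (cQ 1%nat)).
      assert (P0 := IHn _ (Hcv 0%nat)). assert (P1 := IHn _ (Hcv 1%nat)).
      assert (P2 := IHn _ (Hcv 2%nat)). unfold Q; lra.
    + intros x y. unfold Q. rewrite <- !sum2_plus. apply sum2_ext; intros i j.
      unfold cv. simpl pow. unfold dot3 at 1. ring.
Qed.

Definition log_series (n : nat) (x : R) : R := sum_n (fun k => x ^ S k / INR (S k)) n.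

Lemma log_series_S n x :
  log_series (S n) x = log_series n x + x ^ S (S n) / INR (S (S n)).
Proof. exact (sum_Sn (fun k => x ^ S k / INR (S k)) n). Qed.

Lemma is_derive_log_series_error n x : x < 1 ->
  is_derive (fun x => - ln (1 - x) - log_series n x) x
    (/ (1 - x) - sum_n (fun k => x ^ k) n).
Proof.
  intros H.
  apply (is_derive_minus (V := R_NormedModule) (fun x => - ln (1 - x))).
  - auto_derive; [lra | field; lra].
  - unfold log_series. apply (is_derive_ext (fun x => sum_n (fun k => (fun k x => x ^ S k / INR (S k)) k x) n));
      [intros; reflexivity|].
    induction n.
    + rewrite sum_O. apply (is_derive_ext (fun x => x)).
      * intros t. rewrite sum_O. assert (E : forall s : R, s = s ^ 1 / 1) by (intros; field). apply E.
      * simpl. apply (is_derive_id (K := R_AbsRing)).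
    + rewrite sum_Sn.
      apply (is_derive_ext (fun x => sum_n (fun k => x ^ S k / INR (S k)) n + x ^ S (S n) / INR (S (S n)))).
      * intros t; now rewrite sum_Sn.
      * apply (is_derive_plus (V := R_NormedModule) _ (fun x => x ^ S (S n) / INR (S (S n)))); [exact IHn|].
        assert (N : INR (S (S n)) <> 0) by (apply not_0_INR; lia).
        set (m := INR (S (S n))) in *.
        auto_derive; [trivial|]. fold m.
        change (1 * (m * (x * x ^ n)) * / m = x * x ^ n). field. exact N.
Qed.

(** The derivative of the error is [x^(n+1) / (1 - x)]. *)
Lemma log_series_error n q x : 0 <= q < 1 -> Rabs x <= q ->
  Rabs (- ln (1 - x) - log_series n x) <= q ^ S n / (1 - q).
Proof.
  intros Hq Hx.
  assert (geo : forall y, y <> 1 -> / (1 - y) - sum_n (fun k => y ^ k) n = y ^ S n / (1 - y)).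
  { intros y Hy. assert (Ny : 1 - y <> 0) by lra.
    clear - Ny. induction n.
    - rewrite sum_O; simpl; field; exact Ny.
    - rewrite sum_Sn. unfold plus; simpl Hierarchy.AbelianMonoid.plus. 
      transitivity (/ (1 - y) - sum_n (fun k => y ^ k) n - y ^ S n); [simpl; ring|].
      rewrite IHn. simpl; field; exact Ny. }
  destruct (MVT_gen (fun x => - ln (1 - x) - log_series n x) 0 x
              (fun x => / (1 - x) - sum_n (fun k => x ^ k) n)) as [c [Hc E]].
  - intros y Hy. apply is_derive_log_series_error.
    apply Rabs_le_between in Hx. unfold Rmin, Rmax in Hy; destruct Rle_dec; lra.
  - intros y Hy. apply continuity_pt_filterlim.
    apply (ex_derive_continuous (V := R_NormedModule) (fun x => - ln (1 - x) - log_series n x)).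
    eexists; apply is_derive_log_series_error.
    apply Rabs_le_between in Hx. unfold Rmin, Rmax in Hy; destruct Rle_dec; lra.
  - assert (cq : Rabs c <= q).
    { apply Rabs_le_between in Hx; apply Rabs_le_between.
      unfold Rmin, Rmax in Hc; destruct Rle_dec; lra. }
    assert (z0 : log_series n 0 = 0).
    { unfold log_series. clear. induction n; [rewrite sum_O; simpl; field|].
      rewrite sum_Sn, IHn. unfold plus; simpl; unfold Rdiv; rewrite !Rmult_0_l; ring. }
    cbv beta in E; rewrite z0, (Rminus_0_r 1), ln_1, Ropp_0, !Rminus_0_r in E. rewrite E.
    assert (cq2 := cq). apply Rabs_le_between in cq2.
    rewrite geo by lra. unfold Rdiv. rewrite !Rabs_mult, <- RPow_abs, Rabs_inv.
    rewrite (Rabs_pos_eq (1 - c)) by lra.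
    assert (P : Rabs c ^ S n <= q ^ S n) by (apply pow_incr; split; [apply Rabs_pos | assumption]).
    assert (P0 : 0 <= Rabs c ^ S n) by (apply pow_le, Rabs_pos).
    assert (I : / (1 - c) <= / (1 - q)) by (apply Rinv_le_contravar; lra).
    assert (I0 : 0 < / (1 - c)) by (apply Rinv_0_lt_compat; lra).
    apply Rle_trans with (Rabs c ^ S n * / (1 - c) * 1).
    + apply Rmult_le_compat_l; [nra | lra].
    + rewrite Rmult_1_r. apply Rmult_le_compat; lra.
Qed.

Section Stereographic.
Variable eps : R.
Hypothesis eps_pos : 0 < eps.

Definition stereo_height (z : C) : R := Cmod z ^ 2 + eps ^ 2 / 2.

(** The plane lifted to the paraboloid [stereo_height] and then mapped
    projectively into the open unit ball of R^3. *)
Definition stereo (z : C) (k : nat) : R :=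
  match k with
  | O => (1 - stereo_height z) / (1 + stereo_height z)
  | 1%nat => 2 * Re z / (1 + stereo_height z)
  | _ => 2 * Im z / (1 + stereo_height z)
  end.

Lemma stereo_height_pos z : 0 < 1 + stereo_height z.
Proof. unfold stereo_height. assert (H := pow2_ge_0 (Cmod z)). assert (E := pow2_ge_0 eps). lra. Qed.

Lemma stereo_dist (z w : C) :
  Cmod (z - w) ^ 2 + eps ^ 2 =
  / 2 * (1 + stereo_height z) * (1 + stereo_height w) * (1 - dot3 (stereo z) (stereo w)).
Proof.
  assert (Hz := stereo_height_pos z). assert (Hw := stereo_height_pos w).
  unfold dot3, stereo.
  transitivity (stereo_height z + stereo_height w - 2 * (Re z * Re w + Im z * Im w)).
  - unfold stereo_height. rewrite !Cmod2_alt. destruct z, w; unfold Re, Im; simpl; field.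
  - field; split; lra.
Qed.

Lemma ln_stereo_dist (z w : C) :
  dot3 (stereo z) (stereo w) < 1 ->
  ln (Cmod (z - w) ^ 2 + eps ^ 2) =
  (ln (1 + stereo_height z) - ln 2) + ln (1 + stereo_height w) +
  ln (1 - dot3 (stereo z) (stereo w)).
Proof.
  intros H. assert (Hz := stereo_height_pos z). assert (Hw := stereo_height_pos w).
  rewrite stereo_dist.
  assert (P1 : 0 < / 2) by lra.
  assert (P2 : 0 < / 2 * (1 + stereo_height z)) by (apply Rmult_lt_0_compat; lra).
  assert (P3 : 0 < / 2 * (1 + stereo_height z) * (1 + stereo_height w))
    by (apply Rmult_lt_0_compat; lra).
  rewrite ln_mult, ln_mult, ln_mult, ln_Rinv by lra. ring.
Qed.

Lemma stereo_norm (z : C) :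
  dot3 (stereo z) (stereo z) = 1 - 2 * eps ^ 2 / (1 + stereo_height z) ^ 2.
Proof.
  assert (Hz := stereo_height_pos z). unfold dot3, stereo.
  transitivity (((1 - stereo_height z) ^ 2 + 4 * Cmod z ^ 2) / (1 + stereo_height z) ^ 2).
  - rewrite Cmod2_alt. field; lra.
  - unfold stereo_height in *. field. lra.
Qed.

Lemma continuous_stereo_height {U : UniformSpace} (f : U -> C) t :
  continuous f t -> continuous (fun t => stereo_height (f t)) t.
Proof.
  intros H; apply continuous_Rplus; [now apply continuous_Cmod_sqr | apply continuous_const].
Qed.

Lemma continuous_stereo {U : UniformSpace} (f : U -> C) k t :
  continuous f t -> continuous (fun t => stereo (f t) k) t.
Proof.
  intros H. assert (P := stereo_height_pos (f t)).
  assert (D : continuous (fun t => / (1 + stereo_height (f t))) t).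
  { apply continuous_Rinv_comp; [|lra].
    apply continuous_Rplus; [apply continuous_const | now apply continuous_stereo_height]. }
  destruct k as [|[|k]]; apply continuous_Rmult; try exact D.
  - apply continuous_Rminus; [apply continuous_const | now apply continuous_stereo_height].
  - apply continuous_Rmult; [apply continuous_const | now apply continuous_Re_comp].
  - apply continuous_Rmult; [apply continuous_const | now apply continuous_Im_comp].
Qed.

(** On a bounded set the squared norm of [stereo_norm] stays below a number less
    than 1, and the inner product is at most the mean of the squared norms. *)
Lemma stereo_bound (B : R) : exists q, 0 <= q < 1 /\
  forall z w : C, Cmod z <= B -> Cmod w <= B -> Rabs (dot3 (stereo z) (stereo w)) <= q.
Proof.
  set (A := 1 + (B ^ 2 + eps ^ 2 / 2)).
  assert (HA : 1 < A).
  { unfold A. assert (H := pow2_ge_0 B). assert (E : 0 < eps ^ 2) by (apply pow_lt, eps_pos). lra. }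
  assert (E : 0 < eps ^ 2) by (apply pow_lt, eps_pos).
  assert (HA2 : 0 < A ^ 2) by (apply pow_lt; lra).
  exists (1 - 2 * eps ^ 2 / A ^ 2). split.
  - split.
    + assert (2 * eps ^ 2 / A ^ 2 <= 1); [|lra].
      apply Rmult_le_reg_r with (A ^ 2); [assumption|].
      unfold Rdiv; rewrite Rmult_assoc, Rinv_l by lra.
      assert (H := pow2_ge_0 B). assert (K := pow2_ge_0 (1 - eps ^ 2 / 2)).
      unfold A. assert (0 <= B ^ 2 * eps ^ 2) by nra. nra.
    + assert (0 < 2 * eps ^ 2 / A ^ 2) by (apply Rdiv_lt_0_compat; lra). lra.
  - intros z w Hz Hw.
    assert (nrm : forall z, Cmod z <= B -> dot3 (stereo z) (stereo z) <= 1 - 2 * eps ^ 2 / A ^ 2).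
    { intros x Hx. rewrite stereo_norm.
      assert (P := stereo_height_pos x).
      assert (Q : 1 + stereo_height x <= A).
      { unfold A, stereo_height. assert (Cmod x ^ 2 <= B ^ 2); [|lra].
        apply pow_incr; split; [apply Cmod_ge_0 | assumption]. }
      assert (/ A ^ 2 <= / (1 + stereo_height x) ^ 2).
      { apply Rinv_le_contravar; [apply pow_lt; assumption | apply pow_incr; lra]. }
      unfold Rdiv. nra. }
    assert (Nz := nrm z Hz). assert (Nw := nrm w Hw).
    apply Rle_trans with ((dot3 (stereo z) (stereo z) + dot3 (stereo w) (stereo w)) / 2); [|lra].
    unfold dot3. set (u := stereo z). set (v := stereo w).
    apply Rabs_le_between; split.
    + assert (H0 := pow2_ge_0 (u 0%nat + v 0%nat)). assert (H1 := pow2_ge_0 (u 1%nat + v 1%nat)).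
      assert (H2 := pow2_ge_0 (u 2%nat + v 2%nat)). nra.
    + assert (H0 := pow2_ge_0 (u 0%nat - v 0%nat)). assert (H1 := pow2_ge_0 (u 1%nat - v 1%nat)).
      assert (H2 := pow2_ge_0 (u 2%nat - v 2%nat)). nra.
Qed.

End Stereographic.

Lemma continuous_ln_comp {U : UniformSpace} (f : U -> R) x :
  continuous f x -> 0 < f x -> continuous (fun t => ln (f t)) x.
Proof.
  intros Hf H. apply (continuous_comp f ln); [exact Hf|].
  apply continuity_pt_filterlim, derivable_continuous_pt.
  exists (/ f x); now apply derivable_pt_lim_ln.
Qed.

(** By [stereo_dist] the kernel is, up to terms depending on one variable only,
    [ln (1 - s)] for a Gram kernel [s] of modulus less than 1. The other terms
    do not contribute because [c] has mean 0, and [- ln (1 - s)] is a power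
    series in [s] with positive coefficients. *)
Lemma log_energy_nonpos M (w : nat -> R -> C) (c : R -> R) (B eps : R) :
  (forall i t, continuous (w i) t) -> (forall i t, Cmod (w i t) <= B) ->
  (forall t, continuous c t) -> (forall t, Rabs (c t) <= 1) ->
  RInt c 0 (2 * PI) = 0 -> 0 < eps ->
  torus_integral (fun x y =>
    sum2 M (fun i j => c x * c y * ln (Cmod (w i x - w j y)%C ^ 2 + eps ^ 2))) <= 0.
Proof.
  intros Hw HB Hc Hc1 Hc0 He.
  destruct (stereo_bound eps He B) as [q [Hq Hs]].
  set (s := fun i j x y => dot3 (stereo eps (w i x)) (stereo eps (w j y))).
  assert (sq : forall i j x y, Rabs (s i j x y) <= q) by (intros; apply Hs; apply HB).
  assert (s1 : forall i j x y, 0 < 1 - s i j x y).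
  { intros. assert (A := sq i j x y). apply Rabs_le_between in A. lra. }
  set (h := fun i x => ln (1 + stereo_height eps (w i x))).
  assert (hC : forall i t, continuous (h i) t).
  { intros i t. apply continuous_ln_comp; [|apply stereo_height_pos].
    apply continuous_Rplus; [apply continuous_const | apply continuous_stereo_height, Hw]. }
  assert (sC : forall i j, continuous_2 (s i j)).
  { intros i j. assert (v : forall k t i, continuous (fun x => stereo eps (w i x) k) t)
      by (intros; apply continuous_stereo, Hw).
    repeat apply continuous_2_plus; apply continuous_2_mult;
      apply continuous_2_fst || apply continuous_2_snd; intros; apply v. }
  assert (ccC : continuous_2 (fun x y => c x * c y)).
  { apply continuous_2_mult; [apply continuous_2_fst | apply continuous_2_snd]; apply Hc. }
  set (A := fun x => sum2 M (fun i j => h i x - ln 2)).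
  set (A' := fun y => sum2 M (fun i j => h j y)).
  set (E := fun x y => sum2 M (fun i j => c x * c y * - ln (1 - s i j x y))).
  assert (EC : continuous_2 E).
  { apply (continuous_2_sum2 M (fun i j x y => c x * c y * - ln (1 - s i j x y))).
    intros i j. apply continuous_2_mult; [exact ccC|].
    intros p. apply (continuous_opp (K := R_AbsRing) (fun p => ln (1 - s i j (fst p) (snd p)))).
    apply continuous_ln_comp; [|apply s1].
    apply continuous_Rminus; [apply continuous_const | apply sC]. }
  assert (AC : continuous_2 (fun x _ => A x)).
  { apply (continuous_2_sum2 M (fun i j x _ => h i x - ln 2)). intros i j.
    apply continuous_2_fst; intros t. apply continuous_Rminus; [apply hC | apply continuous_const]. }
  assert (A'C : continuous_2 (fun _ y => A' y)).
  { apply (continuous_2_sum2 M (fun i j _ y => h j y)). intros i j.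
    apply continuous_2_snd; intros t; apply hC. }
  assert (A1C : forall t, continuous A t).
  { intros t. apply (continuous_comp_2 (fun x => x) (fun _ : R => 0) (fun x _ => A x));
      [apply continuous_id | apply continuous_const | apply (AC (t, 0))]. }
  assert (A1'C : forall t, continuous A' t) by (intros t; apply (continuous_2_slice (fun _ y => A' y) 0), A'C).
  rewrite (torus_integral_ext _ (fun x y => (c x * A x) * c y + c x * (c y * A' y) - E x y)).
  2: { intros x y. unfold A, A', E.
       transitivity (sum2 M (fun i j => c x * c y * (h i x - ln 2)) + sum2 M (fun i j => c x * c y * h j y)
                     + sum2 M (fun i j => -1 * (c x * c y * - ln (1 - s i j x y)))).
       - rewrite <- !sum2_plus. apply sum2_ext; intros i j.
         assert (P := s1 i j x y).
         rewrite (ln_stereo_dist eps); fold (s i j x y); [unfold h; ring | lra].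
       - rewrite !sum2_scal. ring. }
  assert (T1 : torus_integral (fun x y => (c x * A x) * c y) = 0).
  { rewrite (torus_integral_prod (fun x => c x * A x) c); [rewrite Hc0; ring | | exact Hc].
    intros t; apply continuous_Rmult; [apply Hc | apply A1C]. }
  assert (T2 : torus_integral (fun x y => c x * (c y * A' y)) = 0).
  { rewrite (torus_integral_prod c (fun y => c y * A' y)); [rewrite Hc0; ring | exact Hc |].
    intros t; apply continuous_Rmult; [apply Hc | apply A1'C]. }
  assert (K1 : continuous_2 (fun x y => (c x * A x) * c y)).
  { apply continuous_2_mult; [apply continuous_2_mult|]; try exact AC;
      [apply continuous_2_fst | apply continuous_2_snd]; apply Hc. }
  assert (K2 : continuous_2 (fun x y => c x * (c y * A' y))).
  { apply continuous_2_mult; [apply continuous_2_fst; apply Hc|].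
    apply continuous_2_mult; [apply continuous_2_snd; apply Hc | exact A'C]. }
  rewrite (torus_integral_minus _ _ (continuous_2_plus _ _ K1 K2) EC).
  rewrite (torus_integral_plus _ _ K1 K2), T1, T2.
  enough (0 <= torus_integral E) by lra.
  (* [E] is the uniform limit of the [P n] below, by [log_series_error] *)
  set (P := fun n x y => sum2 M (fun i j => c x * c y * log_series n (s i j x y))).
  set (G := fun n x y => sum2 M (fun i j => c x * c y * s i j x y ^ n)).
  assert (GC : forall n, continuous_2 (G n)).
  { intros n. apply (continuous_2_sum2 M (fun i j x y => c x * c y * s i j x y ^ n)).
    intros i j. apply continuous_2_mult; [exact ccC|]. apply continuous_2_pow, sC. }
  assert (G0 : forall n, 0 <= torus_integral (G n)).
  { intros n. apply (gram_power_nonneg M (fun i x => stereo eps (w i x)) n) with (c := fun _ => c).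
    - intros; apply continuous_stereo, Hw.
    - intros; apply Hc. }
  assert (P0 : forall n, continuous_2 (P n) /\ 0 <= torus_integral (P n)).
  { assert (ps : forall n, continuous_2 (fun x y => / INR (S n) * G (S n) x y) /\
                   0 <= torus_integral (fun x y => / INR (S n) * G (S n) x y)).
    { intros n. split.
      - apply continuous_2_mult; [apply continuous_2_const | apply GC].
      - rewrite torus_integral_scal by apply GC. apply Rmult_le_pos; [|apply G0].
        left; apply Rinv_0_lt_compat, lt_0_INR; lia. }
    induction n.
    - assert (E0 : forall x y, / INR 1 * G 1%nat x y = P 0%nat x y).
      { intros x y. unfold P, G. rewrite <- sum2_scal. apply sum2_ext; intros i j.
        unfold log_series. rewrite sum_O. simpl; field. }
      split.
      + intros p; apply (continuous_ext (fun p => / INR 1 * G 1%nat (fst p) (snd p))); [intros; apply E0 | apply ps].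
      + rewrite <- (torus_integral_ext _ _ E0). apply ps.
    - destruct IHn as [IC I0].
      assert (E0 : forall x y, P n x y + / INR (S (S n)) * G (S (S n)) x y = P (S n) x y).
      { intros x y. unfold P, G. rewrite <- sum2_scal, <- sum2_plus. apply sum2_ext; intros i j.
        rewrite log_series_S. unfold Rdiv. ring. }
      destruct (ps (S n)) as [Q1 Q2].
      split.
      + intros p; apply (continuous_ext (fun p => P n (fst p) (snd p) + / INR (S (S n)) * G (S (S n)) (fst p) (snd p)));
          [intros; apply E0 | apply (continuous_2_plus _ _ IC Q1)].
      + rewrite <- (torus_integral_ext _ _ E0), (torus_integral_plus _ _ IC Q1). lra. }
  set (m := INR (S M)).
  assert (err : forall n, - (2 * PI * (2 * PI) * (m * (m * (q ^ S n / (1 - q))))) <= torus_integral E).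
  { intros n. destruct (P0 n) as [PC P0n].
    assert (L : torus_integral (fun x y => P n x y - E x y) <=
                torus_integral (fun _ _ => m * (m * (q ^ S n / (1 - q))))).
    { apply torus_integral_le; [now apply continuous_2_minus | apply continuous_2_const |].
      intros x y.
      transitivity (sum2 M (fun i j => c x * c y * (log_series n (s i j x y) - - ln (1 - s i j x y)))).
      - right. unfold P, E.
        transitivity (sum2 M (fun i j => c x * c y * log_series n (s i j x y)) +
                      sum2 M (fun i j => -1 * (c x * c y * - ln (1 - s i j x y)))).
        + rewrite (sum2_scal M (-1)). ring.
        + rewrite <- sum2_plus. apply sum2_ext; intros; ring.
      - apply sum2_le_const. intros i j.
        assert (A0 := log_series_error n q _ Hq (sq i j x y)).
        eapply Rle_trans; [apply Rle_abs|]. rewrite !Rabs_mult, Rabs_minus_sym.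
        assert (C1 := Hc1 x). assert (C2 := Hc1 y).
        assert (N1 := Rabs_pos (c x)). assert (N2 := Rabs_pos (c y)).
        assert (N3 := Rabs_pos (- ln (1 - s i j x y) - log_series n (s i j x y))).
        assert (Rabs (c x) * Rabs (c y) <= 1) by nra.
        apply Rle_trans with (1 * Rabs (- ln (1 - s i j x y) - log_series n (s i j x y))); [|lra].
        apply Rmult_le_compat_r; assumption. }
    rewrite (torus_integral_minus _ _ PC EC), torus_integral_const in L. lra. }
  apply le_epsilon; intros e0 He0.
  set (k := 2 * PI * (2 * PI) * (m * m) / (1 - q)).
  assert (k0 : 0 < k).
  { assert (T := two_PI_pos). assert (0 < m) by (apply lt_0_INR; lia).
    assert (0 < m * m) by (now apply Rmult_lt_0_compat).
    apply Rdiv_lt_0_compat; [|lra]. apply Rmult_lt_0_compat; [|assumption].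
    now apply Rmult_lt_0_compat. }
  destruct (pow_lt_1_zero q) with (y := e0 / k) as [n Hn].
  { rewrite Rabs_pos_eq; lra. }
  { apply Rdiv_lt_0_compat; assumption. }
  specialize (Hn (S n) ltac:(lia)). specialize (err n).
  rewrite Rabs_pos_eq in Hn by (apply pow_le; lra).
  apply (Rmult_lt_compat_l k) in Hn; [|assumption].
  replace (k * (e0 / k)) with e0 in Hn by (field; lra).
  replace (2 * PI * (2 * PI) * (m * (m * (q ^ S n / (1 - q))))) with (k * q ^ S n) in err
    by (unfold k; field; lra).
  lra.
Qed.

Lemma Csqrt_exists (z : C) : exists w : C, (w * w)%C = z.
Proof.
  set (m := Cmod z). set (x := Re z). set (y := Im z).
  assert (E : m ^ 2 = x ^ 2 + y ^ 2) by apply Cmod2_alt.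
  assert (m0 : 0 <= m) by apply Cmod_ge_0.
  assert (X : Rabs x <= m) by apply re_le_Cmod. apply Rabs_le_between in X.
  set (a := sqrt ((m + x) / 2)). set (c := sqrt ((m - x) / 2)).
  assert (a2 : a * a = (m + x) / 2) by (apply sqrt_sqrt; lra).
  assert (c2 : c * c = (m - x) / 2) by (apply sqrt_sqrt; lra).
  assert (ac : 2 * (a * c) = Rabs y).
  { unfold a, c. rewrite <- sqrt_mult by lra.
    replace ((m + x) / 2 * ((m - x) / 2)) with ((m ^ 2 - x ^ 2) / 4) by field.
    rewrite E. replace ((x ^ 2 + y ^ 2 - x ^ 2) / 4) with ((Rabs y / 2) ^ 2).
    - rewrite sqrt_pow2; [field|]. assert (H := Rabs_pos y); lra.
    - unfold Rdiv; rewrite Rpow_mult_distr, pow2_abs; field. }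
  destruct (Rle_dec 0 y) as [Hy|Hy].
  - exists (a, c). rewrite Rabs_pos_eq in ac by assumption.
    apply injective_projections; simpl; unfold x, y, Re, Im in *; lra.
  - exists (a, - c). rewrite Rabs_left in ac by lra.
    apply injective_projections; simpl; unfold x, y, Re, Im in *; lra.
Qed.

Lemma wave_bound u t : Cmod u = 1 -> Rabs (wave u t) <= 1.
Proof.
  intros Hu. unfold wave. eapply Rle_trans; [apply re_le_Cmod|].
  rewrite Cmod_mult, Hu, Cmod_polar; lra.
Qed.

(** The gauge at [t] is at most [1 / |q t|], so that a Lebesgue number bounds
    [q]. *)
Lemma bounded_on_disc (q : C -> C) (r : R) :
  (forall z, Cmod z <= r -> continuous q z) ->
  exists B, forall z, Cmod z <= r -> Cmod (q z) <= B.
Proof.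
  intros H.
  assert (gauge : forall t, exists d : posreal, Cmod t <= r ->
     d * Cmod (q t) <= 1 /\ forall x, Cmod (x - t) < d -> Cmod (q x - q t) < 1).
  { intros t. destruct (classic (Cmod t <= r)) as [Ht|Ht].
    - destruct (proj1 (continuous_CC_iff q t) (H t Ht) 1 Rlt_0_1) as [d [Hd K]].
      assert (M := Cmod_ge_0 (q t)).
      assert (Hm : 0 < Rmin d (/ (1 + Cmod (q t)))).
      { apply Rmin_glb_lt; [assumption | apply Rinv_0_lt_compat; lra]. }
      exists (mkposreal _ Hm); simpl; intros _; split.
      + apply Rle_trans with (/ (1 + Cmod (q t)) * (1 + Cmod (q t))).
        * apply Rmult_le_compat; [lra | lra | apply Rmin_r | lra].
        * right; field; lra.
      + intros x Hx; apply K. eapply Rlt_le_trans; [exact Hx | apply Rmin_l].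
    - exists (mkposreal 1 Rlt_0_1); tauto. }
  set (dl t := proj1_sig (constructive_indefinite_description _ (gauge t))).
  assert (Hdl : forall t, Cmod t <= r ->
     dl t * Cmod (q t) <= 1 /\ forall x, Cmod (x - t) < dl t -> Cmod (q x - q t) < 1).
  { intros t; unfold dl; destruct constructive_indefinite_description; assumption. }
  destruct (disc_lebesgue_number dl r) as [d [Hd K]].
  exists (1 + / d). intros z Hz. destruct (K z Hz) as (t & Ht & Hzt & Hdt).
  destruct (Hdl t Ht) as [B1 B2]. specialize (B2 z Hzt).
  assert (M := Cmod_ge_0 (q t)).
  assert (B3 : Cmod (q t) <= / d).
  { apply Rmult_le_reg_l with d; [assumption|]. rewrite Rinv_r by lra. nra. }
  assert (T := Cmod_triangle (q z - q t) (q t)).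
  replace (q z - q t + q t)%C with (q z) in T by ring. lra.
Qed.

Lemma eventually_forall_le (P : nat -> R -> Prop) n :
  (forall i, exists d, 0 < d /\ forall e, 0 < e < d -> P i e) ->
  exists d, 0 < d /\ forall e, 0 < e < d -> forall i, (i <= n)%nat -> P i e.
Proof.
  intros H; induction n.
  - destruct (H 0%nat) as [d [Hd K]]. exists d; split; [assumption|]. intros e He i Hi.
    replace i with 0%nat by lia. now apply K.
  - destruct IHn as [d1 [Hd1 K1]]. destruct (H (S n)) as [d2 [Hd2 K2]].
    exists (Rmin d1 d2); split; [now apply Rmin_glb_lt|]. intros e He i Hi.
    assert (M1 := Rmin_l d1 d2). assert (M2 := Rmin_r d1 d2).
    destruct (Nat.eq_dec i (S n)) as [->|N]; [apply K2; lra | apply K1; [lra | lia]].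
Qed.

Lemma sum_n_ge_const (f : nat -> R) (k : R) n :
  (forall i, (i <= n)%nat -> k <= f i) -> INR (S n) * k <= sum_n f n.
Proof.
  intros H; induction n.
  - rewrite sum_O; simpl; rewrite Rmult_1_l; apply H; lia.
  - rewrite sum_Sn. change (INR (S (S n)) * k <= sum_n f n + f (S n)).
    rewrite (S_INR (S n)). assert (A := H (S n) (Nat.le_refl _)).
    assert (K := IHn (fun i Hi => H i ltac:(lia))). lra.
Qed.

Lemma sum_n_ge_exception (f : nat -> R) (k c : R) n i :
  (i <= n)%nat -> (forall j, (j <= n)%nat -> j <> i -> k <= f j) -> - c <= f i ->
  INR n * k - c <= sum_n f n.
Proof.
  intros Hi H Hc; induction n.
  - rewrite sum_O. replace i with 0%nat in Hc by lia. simpl; lra.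
  - rewrite sum_Sn. change (INR (S n) * k - c <= sum_n f n + f (S n)).
    destruct (Nat.eq_dec i (S n)) as [->|N].
    + assert (A := sum_n_ge_const f k n (fun j Hj => H j ltac:(lia) ltac:(lia))). lra.
    + rewrite S_INR. assert (A := H (S n) (Nat.le_refl _) ltac:(lia)).
      assert (K := IHn ltac:(lia) (fun j Hj => H j ltac:(lia))). lra.
Qed.

(** * The logarithmic energy of the image of a circle *)

Section Energy.
Variables (q : C -> C) (b : C).
Hypothesis q_cont : forall z, Cmod z < 1 -> continuous q z.
Hypothesis q_diff : forall z, Cmod z < 1 -> off_slit z -> ex_derive q z.
Hypothesis q_derive : is_derive q (RtoC 0) b.

Definition with_pole (z : C) : C := (/ z + q z)%C.

Notation G := with_pole.

Hypothesis G_inj : forall z w, 0 < Cmod z < Cmod w -> Cmod w < 1 -> G z <> G w.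

Lemma continuous_with_pole z : 0 < Cmod z < 1 -> continuous G z.
Proof.
  intros Hz. apply continuous_Cplus; [|apply q_cont; lra].
  apply continuous_Cinv; [apply continuous_id | apply Cmod_gt_0; lra].
Qed.

Lemma continuous_G_polar {U : UniformSpace} (f g : U -> R) x :
  continuous f x -> continuous g x -> 0 < f x < 1 ->
  continuous (fun p => G (polar (f p) (g p))) x.
Proof.
  intros Hf Hg H. apply (continuous_comp (fun p => polar (f p) (g p)) G).
  - apply (continuous_comp_2 f g polar); trivial. apply (continuous_polar (_, _)).
  - apply continuous_with_pole. rewrite Cmod_polar; lra.
Qed.

(** By injectivity, [z (G z - G w)] extends to a function without zeros on
    [|z| < |w|], with value 1 and derivative [q 0 - G w] at 0. *)
Lemma log_distance_means (w u : C) (r : R) : 0 < r < Cmod w -> Cmod w < 1 ->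
  RInt (fun t => ln (Cmod (G w - G (polar r t)) ^ 2)) 0 (2 * PI) = - (4 * PI * ln r) /\
  RInt (fun t => wave u t * ln (Cmod (G w - G (polar r t)) ^ 2)) 0 (2 * PI) =
    2 * PI * r * Re ((q (RtoC 0) - G w) * Cconj u).
Proof.
  intros Hr Hw.
  set (F := fun z : C => (1 + z * (q z - G w))%C).
  assert (FG : forall z, z <> RtoC 0 -> F z = (- z * (G w - G z))%C).
  { intros z Hz. unfold F. unfold with_pole at 3. field. exact Hz. }
  assert (FC : forall z, Cmod z < Cmod w -> continuous F z).
  { intros z Hz. apply continuous_Cplus; [apply continuous_const|].
    apply continuous_Cmult; [apply continuous_id|].
    apply continuous_Cminus; [apply q_cont; lra | apply continuous_const]. }
  assert (F0 : forall z, Cmod z < Cmod w -> F z <> RtoC 0).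
  { intros z Hz. destruct (classic (z = RtoC 0)) as [->|Nz].
    - unfold F. rewrite Cmult_0_l, Cplus_0_r. apply C1_nz.
    - rewrite FG by assumption. intros E.
      assert (Mz : 0 < Cmod z) by (now apply Cmod_gt_0).
      apply (G_inj z w); [lra | lra |].
      transitivity (G w - / - z * (- z * (G w - G z)))%C.
      + field. intros E'. apply Nz. transitivity (- - z)%C; [ring | rewrite E'; ring].
      + rewrite E; ring. }
  assert (F1 : F (RtoC 0) = RtoC 1) by (unfold F; ring).
  destruct (circle_log_means F (Cmod w) r (q (RtoC 0) - G w)%C u) as [M1 M2]; trivial.
  - intros z Hz Sz. apply ex_derive_Cplus; [apply ex_derive_Cconst|].
    apply ex_derive_Cmult; [apply ex_derive_Cid|].
    apply ex_derive_Cminus; [apply q_diff; trivial; lra | apply ex_derive_Cconst].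
  - eapply is_derive_CC_eq.
    + apply is_derive_Cplus; [apply is_derive_Cconst|].
      apply is_derive_Cmult; [apply is_derive_Cid|].
      apply is_derive_Cplus; [exact q_derive | apply is_derive_Copp, is_derive_Cconst].
    + simpl; ring.
  - assert (E : forall t, ln (Cmod (G w - G (polar r t)) ^ 2) = 2 * ln (Cmod (F (polar r t))) - 2 * ln r).
    { intros t. assert (N := polar_neq_0 r t ltac:(lra)).
      assert (FN : F (polar r t) <> RtoC 0) by (apply F0; rewrite Cmod_polar; lra).
      rewrite FG in FN |- * by assumption.
      assert (P : 0 < Cmod (G w - G (polar r t))).
      { apply Cmod_gt_0. intros E. apply FN. rewrite E; ring. }
      rewrite Cmod_mult, Cmod_opp, Cmod_polar by lra.
      rewrite ln_mult by lra. simpl. rewrite Rmult_1_r, ln_mult by assumption. ring. }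
    assert (LC : forall t, continuous (fun t => ln (Cmod (F (polar r t)))) t).
    { intros t. assert (B : Cmod (polar r t) < Cmod w) by (rewrite Cmod_polar; lra).
      apply continuous_ln_comp.
      - apply continuous_Cmod, (continuous_comp (polar r) F); [apply continuous_polar_t | now apply FC].
      - apply Cmod_gt_0, F0, B. }
    split.
    + rewrite (RInt_ext _ (fun t => 2 * ln (Cmod (F (polar r t))) - 2 * ln r)) by (intros t _; apply E).
      rewrite RInt_minus_R, RInt_scal_R, M1, RInt_const_R; [ring_R | | |].
      * now apply ex_RInt_continuous_R.
      * apply ex_RInt_continuous_R; intros t; apply continuous_Rmult; [apply continuous_const | apply LC].
      * apply ex_RInt_const.
    + rewrite (RInt_ext _ (fun t => 2 * (wave u t * ln (Cmod (F (polar r t)))) - (2 * ln r) * wave u t))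
        by (intros t _; rewrite E; ring_R).
      assert (WC : forall t, continuous (fun t => wave u t * ln (Cmod (F (polar r t)))) t)
        by (intros t; apply continuous_Rmult; [apply continuous_wave | apply LC]).
      rewrite RInt_minus_R, !RInt_scal_R, M2, RInt_wave; [ring_R | | | |].
      * apply ex_RInt_continuous_R, continuous_wave.
      * now apply ex_RInt_continuous_R.
      * apply ex_RInt_continuous_R; intros t; apply continuous_Rmult; [apply continuous_const | apply WC].
      * apply ex_RInt_continuous_R; intros t; apply continuous_Rmult; [apply continuous_const | apply continuous_wave].
Qed.

Definition log_kernel (eps r s x y : R) : R :=
  ln (Cmod (G (polar r x) - G (polar s y)) ^ 2 + eps ^ 2).

Lemma continuous_log_kernel {U : UniformSpace} (e r s x y : U -> R) (p : U) :
  continuous e p -> continuous r p -> continuous s p -> continuous x p -> continuous y p ->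
  0 < r p < 1 -> 0 < s p < 1 -> e p <> 0 \/ r p <> s p ->
  continuous (fun p => log_kernel (e p) (r p) (s p) (x p) (y p)) p.
Proof.
  intros He Hr Hs Hx Hy Br Bs H. apply continuous_ln_comp.
  - apply continuous_Rplus.
    + apply continuous_Cmod_sqr, continuous_Cminus; now apply continuous_G_polar.
    + apply (continuous_ext (fun p => e p * e p)); [intros; ring_R|]. now apply continuous_Rmult.
  - assert (A := pow2_ge_0 (Cmod (G (polar (r p) (x p)) - G (polar (s p) (y p))))).
    assert (E := pow2_ge_0 (e p)).
    destruct H as [H|H].
    + assert (0 < e p ^ 2); [|lra]. apply pow2_gt_0, H.
    + assert (0 < Cmod (G (polar (r p) (x p)) - G (polar (s p) (y p))) ^ 2); [|lra].
      apply pow_lt, Cmod_gt_0. intros K.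
      assert (EG : G (polar (r p) (x p)) = G (polar (s p) (y p))).
      { transitivity (G (polar (r p) (x p)) - G (polar (s p) (y p)) + G (polar (s p) (y p)))%C;
          [ring | rewrite K; ring]. }
      destruct (Rlt_le_dec (r p) (s p)) as [L|L].
      * apply (G_inj (polar (r p) (x p)) (polar (s p) (y p))); rewrite ?Cmod_polar; trivial; lra.
      * apply (G_inj (polar (s p) (y p)) (polar (r p) (x p))); rewrite ?Cmod_polar; try (now symmetry); lra.
Qed.

Lemma continuous_2_log_kernel eps r s :
  0 < r < 1 -> 0 < s < 1 -> eps <> 0 \/ r <> s -> continuous_2 (log_kernel eps r s).
Proof.
  intros Hr Hs H p.
  apply (continuous_log_kernel (fun _ => eps) (fun _ => r) (fun _ => s) fst snd);
    trivial; try apply continuous_const; destruct p; [apply continuous_fst | apply continuous_snd].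
Qed.

(** The energy, at two radii, of the charge distribution on the curves
    [t |-> G (r e^(i t))] with density [wave u]. *)
Definition energy (u : C) (eps r s : R) : R :=
  torus_integral (fun x y => wave u x * wave u y * log_kernel eps r s x y).

Lemma continuous_2_energy u eps r s :
  0 < r < 1 -> 0 < s < 1 -> eps <> 0 \/ r <> s ->
  continuous_2 (fun x y => wave u x * wave u y * log_kernel eps r s x y).
Proof.
  intros; apply continuous_2_mult; [|now apply continuous_2_log_kernel].
  apply continuous_2_mult; [apply continuous_2_fst | apply continuous_2_snd]; apply continuous_wave.
Qed.

Lemma energy_sym u eps r s :
  0 < r < 1 -> 0 < s < 1 -> eps <> 0 \/ r <> s -> energy u eps r s = energy u eps s r.
Proof.
  intros Hr Hs H. unfold energy. rewrite torus_integral_swap by (now apply continuous_2_energy).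
  apply torus_integral_ext; intros x y. unfold log_kernel.
  replace (Cmod (G (polar r y) - G (polar s x))) with (Cmod (G (polar s x) - G (polar r y)));
    [ring|].
  rewrite <- Cmod_opp; f_equal; ring.
Qed.

(** The inner integral is given by [log_distance_means]. The outer one is a
    first Fourier coefficient of [G = 1 / z + q], where [1 / z] contributes
    [1 / s] and [q] contributes [s Re (b (Cconj u)^2)]. *)
Lemma energy_0 u r s : Cmod u = 1 -> 0 < r < s -> s < 1 ->
  energy u 0 s r = - (2 * PI ^ 2 * (r / s + r * s * Re (b * (Cconj u * Cconj u)))).
Proof.
  intros Hu Hr Hs. unfold energy, torus_integral.
  set (H := fun z : C => ((q z - q 0) * Cconj u)%C).
  assert (HC : forall z, Cmod z < 1 -> continuous H z).
  { intros z Hz. apply continuous_Cmult; [|apply continuous_const].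
    apply continuous_Cminus; [now apply q_cont | apply continuous_const]. }
  assert (u2 : Re (u * Cconj u)%C = 1).
  { rewrite <- Cmod2_conj, Hu. simpl; ring. }
  assert (WW : RInt (fun t => wave u t * wave u t) 0 (2 * PI) = PI).
  { transitivity (PI * 1 * Re (u * Cconj u)%C); [|rewrite u2; ring_R].
    rewrite <- (circle_wave_mean (fun z => u * z)%C 2 1 u u); [reflexivity | | | | lra].
    - intros z _; apply continuous_Cmult; [apply continuous_const | apply continuous_id].
    - intros z _ _; apply ex_derive_Cmult; [apply ex_derive_Cconst | apply ex_derive_Cid].
    - eapply is_derive_CC_eq.
      + apply is_derive_Cmult; [apply is_derive_Cconst | apply is_derive_Cid].
      + simpl; ring. }
  assert (WH : RInt (fun t => wave u t * Re (H (polar s t))) 0 (2 * PI) = PI * s * Re (b * Cconj u * Cconj u)).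
  { apply (circle_wave_mean H 1); trivial; [ | | lra].
    - intros z Hz Sz. apply ex_derive_Cmult; [|apply ex_derive_Cconst].
      apply ex_derive_Cminus; [now apply q_diff | apply ex_derive_Cconst].
    - eapply is_derive_CC_eq.
      + apply is_derive_Cmult; [|apply is_derive_Cconst].
        apply is_derive_Cplus; [exact q_derive | apply is_derive_Copp, is_derive_Cconst].
      + simpl; ring. }
  rewrite (RInt_ext _ (fun x => - (2 * PI * r) * (wave u x * Re (H (polar s x)))
                                - (2 * PI * r / s) * (wave u x * wave u x))).
  - rewrite RInt_minus_R, !RInt_scal_R, WW, WH.
    + replace (b * Cconj u * Cconj u)%C with (b * (Cconj u * Cconj u))%C by ring. field; lra.
    + apply ex_RInt_continuous_R; intros t; apply continuous_Rmult; apply continuous_wave.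
    + apply ex_RInt_continuous_R; intros t; apply continuous_Rmult; [apply continuous_wave|].
      apply continuous_Re_comp, (continuous_comp (polar s) H); [apply continuous_polar_t|].
      apply HC; rewrite Cmod_polar; lra.
    + apply ex_RInt_continuous_R; intros t; apply continuous_Rmult; [apply continuous_const|].
      apply continuous_Rmult; [apply continuous_wave|].
      apply continuous_Re_comp, (continuous_comp (polar s) H); [apply continuous_polar_t|].
      apply HC; rewrite Cmod_polar; lra.
    + apply ex_RInt_continuous_R; intros t; apply continuous_Rmult; [apply continuous_const|].
      apply continuous_Rmult; apply continuous_wave.
  - intros x _.
    transitivity (wave u x * RInt (fun y => wave u y * ln (Cmod (G (polar s x) - G (polar r y)) ^ 2)) 0 (2 * PI)).
    + rewrite <- RInt_scal_R.
      * apply RInt_ext; intros y _. unfold log_kernel.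
        replace (Cmod (G (polar s x) - G (polar r y)) ^ 2 + 0 ^ 2)
          with (Cmod (G (polar s x) - G (polar r y)) ^ 2) by ring. apply Rmult_assoc.
      * apply ex_RInt_continuous_R; intros y. apply continuous_Rmult; [apply continuous_wave|].
        apply (continuous_ext (fun y => log_kernel 0 s r x y)).
        -- intros t. unfold log_kernel. f_equal. ring.
        -- apply continuous_2_slice, continuous_2_log_kernel; lra.
    + destruct (log_distance_means (polar s x) u r) as [_ ->];
        [rewrite Cmod_polar; lra | rewrite Cmod_polar; lra |].
      set (e := polar 1 x).
      assert (Ep : polar s x = (RtoC s * e)%C) by (apply injective_projections; simpl; ring).
      assert (Ne : e <> RtoC 0) by (apply polar_neq_0; lra).
      assert (Ns : RtoC s <> RtoC 0) by (intros K; apply RtoC_inj in K; lra).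
      assert (Ec : (e * Cconj e)%C = RtoC 1).
      { rewrite <- Cmod2_conj. unfold e. rewrite Cmod_polar by lra. f_equal; ring. }
      assert (Ie : (/ polar s x)%C = (RtoC (/ s) * Cconj e)%C).
      { rewrite Ep, RtoC_inv by lra. transitivity (/ (RtoC s * e) * (e * Cconj e))%C.
        - rewrite Ec; ring.
        - field. now split. }
      replace ((q 0 - G (polar s x)) * Cconj u)%C
        with (- (H (polar s x)) - RtoC (/ s) * (Cconj u * Cconj e))%C.
      2: { unfold H, with_pole. rewrite Ie. ring. }
      assert (W : Re (Cconj u * Cconj e)%C = wave u x).
      { unfold wave. fold e. destruct u, e; unfold Re; simpl; ring. }
      rewrite <- W. set (h := H (polar s x)). set (v := (Cconj u * Cconj e)%C).
      destruct h, v; unfold Re; simpl; field; lra.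
Qed.

Lemma energy_continuous_0 u r s : 0 < r < 1 -> 0 < s < 1 -> r <> s ->
  continuous (fun eps => energy u eps r s) 0.
Proof.
  intros Hr Hs N. unfold energy, torus_integral.
  assert (T := two_PI_pos).
  apply (continuous_RInt_param (fun eps x =>
    RInt (fun y => wave u x * wave u y * log_kernel eps r s x y) 0 (2 * PI))); [lra|].
  apply filter_forall; intros eps x _.
  apply (continuous_RInt_param (fun (p : R * R) y =>
    wave u (snd p) * wave u y * log_kernel (fst p) r s (snd p) y)); [lra|].
  apply filter_forall; intros [e x'] y _.
  apply continuous_Rmult; [apply continuous_Rmult|].
  - apply (continuous_comp (fun p : (R * R) * R => snd (fst p)) (wave u)); [|apply continuous_wave].
    apply (continuous_comp fst snd); [apply continuous_fst | apply continuous_snd].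
  - apply (continuous_comp snd (wave u)); [apply continuous_snd | apply continuous_wave].
  - apply (continuous_log_kernel (fun p : (R * R) * R => fst (fst p)) (fun _ => r) (fun _ => s)
             (fun p => snd (fst p)) snd); trivial; try apply continuous_const.
    + apply (continuous_comp fst fst); apply continuous_fst.
    + apply (continuous_comp fst snd); [apply continuous_fst | apply continuous_snd].
    + apply continuous_snd.
    + now right.
Qed.

(** At equal radii the mean of the logarithm can only be estimated from below,
    by approximating the circle from inside. *)
Lemma log_kernel_mean_nonneg eps r x : 0 < eps -> 0 < r < 1 ->
  0 <= RInt (log_kernel eps r r x) 0 (2 * PI).
Proof.
  intros He Hr. assert (T := two_PI_pos).
  set (f := fun s => RInt (log_kernel eps r s x) 0 (2 * PI)).
  assert (fC : continuous f r).
  { apply (continuous_RInt_param (fun s y => log_kernel eps r s x y)); [lra|].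
    assert (Hd : 0 < Rmin (r / 2) ((1 - r) / 2)) by (apply Rmin_glb_lt; lra).
    exists (mkposreal _ Hd). intros s Hs y _. change (Rabs (s - r) < Rmin (r / 2) ((1 - r) / 2)) in Hs.
    assert (R1 := Rmin_l (r / 2) ((1 - r) / 2)). assert (R2 := Rmin_r (r / 2) ((1 - r) / 2)).
    apply Rabs_lt_between in Hs.
    apply (continuous_log_kernel (fun _ : R * R => eps) (fun _ => r) fst (fun _ => x) snd);
      try apply continuous_const; simpl; try lra; [apply continuous_fst | apply continuous_snd]. }
  assert (fpos : forall s, 0 < s < r -> 0 <= f s).
  { intros s Hs.
    apply Rle_trans with (RInt (fun y => ln (Cmod (G (polar r x) - G (polar s y)) ^ 2)) 0 (2 * PI)).
    - destruct (log_distance_means (polar r x) (RtoC 0) s) as [-> _];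
        [rewrite Cmod_polar; lra | rewrite Cmod_polar; lra |].
      assert (L : ln s < 0) by (rewrite <- ln_1; apply ln_increasing; lra). nra.
    - assert (E0 : forall y, log_kernel 0 r s x y = ln (Cmod (G (polar r x) - G (polar s y)) ^ 2))
        by (intros y; unfold log_kernel; f_equal; ring).
      assert (P : forall y, 0 < Cmod (G (polar r x) - G (polar s y)) ^ 2).
      { intros y. apply pow_lt, Cmod_gt_0. intros K.
        apply (G_inj (polar s y) (polar r x)); rewrite ?Cmod_polar; try lra.
        transitivity (G (polar r x) - (G (polar r x) - G (polar s y)))%C; [ring | rewrite K; ring]. }
      apply RInt_le; [lra | | |].
      + apply (ex_RInt_ext (log_kernel 0 r s x)); [intros; apply E0|].
        apply ex_RInt_slice, continuous_2_log_kernel; lra.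
      + apply ex_RInt_slice, continuous_2_log_kernel; lra.
      + intros y _. unfold log_kernel.
        assert (E : 0 < eps ^ 2) by (now apply pow_lt). left; apply ln_increasing; [apply P | lra]. }
  change (0 <= f r). apply Rnot_lt_le; intros N.
  destruct (fC (fun v => v < 0)) as [d Hd].
  { assert (Hn : 0 < - f r) by lra. exists (mkposreal _ Hn). intros v Hv.
    change (Rabs (v - f r) < - f r) in Hv. apply Rabs_lt_between in Hv; lra. }
  set (s := r - Rmin (d / 2) (r / 2)). assert (D := cond_pos d).
  assert (R0 : 0 < Rmin (d / 2) (r / 2)) by (apply Rmin_glb_lt; lra).
  assert (R1 := Rmin_l (d / 2) (r / 2)). assert (R2 := Rmin_r (d / 2) (r / 2)).
  assert (K := fpos s ltac:(unfold s; lra)).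
  assert (K2 : f s < 0); [|lra].
  apply (Hd s). change (Rabs (s - r) < d). unfold s. apply Rabs_lt_between; lra.
Qed.

(** The kernel has an upper bound [k] that does not depend on [eps], and its mean
    is nonnegative; so the mean of its absolute value is at most [2 k]. *)
Lemma energy_diag_bound u eps r B : Cmod u = 1 -> 0 < eps <= 1 -> 0 < r < 1 ->
  (forall t, Cmod (G (polar r t)) <= B) ->
  - (2 * PI * (2 * PI) * (2 * ln (4 * B ^ 2 + 1))) <= energy u eps r r.
Proof.
  intros Hu He Hr HB. set (k := ln (4 * B ^ 2 + 1)).
  assert (k0 : 0 <= k).
  { unfold k. rewrite <- ln_1. assert (P := pow2_ge_0 B).
    destruct (Req_dec (4 * B ^ 2 + 1) 1) as [->|]; [lra|]. left; apply ln_increasing; lra. }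
  assert (KC : continuous_2 (log_kernel eps r r)) by (apply continuous_2_log_kernel; lra).
  assert (up : forall x y, log_kernel eps r r x y <= k).
  { intros x y. unfold log_kernel, k.
    assert (T := Cmod_triangle (G (polar r x)) (- G (polar r y))). rewrite Cmod_opp in T.
    assert (H1 := HB x). assert (H2 := HB y).
    change (G (polar r x) + - G (polar r y))%C with (G (polar r x) - G (polar r y))%C in T.
    assert (M := Cmod_ge_0 (G (polar r x) - G (polar r y))).
    assert (S1 : Cmod (G (polar r x) - G (polar r y)) ^ 2 <= (2 * B) ^ 2) by (apply pow_incr; lra).
    assert (S2 : eps ^ 2 <= 1 ^ 2) by (apply pow_incr; lra).
    assert (S3 : 0 < eps ^ 2) by (apply pow_lt; lra).
    assert (S4 := pow2_ge_0 (Cmod (G (polar r x) - G (polar r y)))).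
    apply ln_le; lra. }
  assert (L : 0 <= torus_integral (log_kernel eps r r)).
  { assert (T := two_PI_pos). unfold torus_integral.
    replace 0 with (RInt (fun _ : R => 0) 0 (2 * PI)) at 1 by (rewrite RInt_const_R; ring_R).
    apply RInt_le; [lra | apply ex_RInt_const | now apply ex_RInt_inner|].
    intros x _. now apply log_kernel_mean_nonneg. }
  apply Rle_trans with (torus_integral (fun x y => log_kernel eps r r x y - 2 * k)).
  - rewrite torus_integral_minus, torus_integral_const; [lra | exact KC | apply continuous_2_const].
  - apply torus_integral_le.
    + apply continuous_2_minus; [exact KC | apply continuous_2_const].
    + apply continuous_2_energy; lra.
    + intros x y. assert (W1 := wave_bound u x Hu). assert (W2 := wave_bound u y Hu).
      assert (W : Rabs (wave u x * wave u y) <= 1).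
      { rewrite Rabs_mult. assert (P1 := Rabs_pos (wave u x)). assert (P2 := Rabs_pos (wave u y)). nra. }
      apply Rabs_le_between in W. specialize (up x y).
      set (W' := wave u x * wave u y) in *. set (l := log_kernel eps r r x y) in *.
      destruct (Rle_dec 0 l); nra.
Qed.

(** Charges of density [wave u] are placed on the images of [M + 1] circles
    with radii between [r0] and 1. If the conclusion fails, each of the
    [M (M + 1)] pairs of distinct circles has energy bounded below by a
    positive constant, while the self-energies are bounded below; for large [M] this
    contradicts [log_energy_nonpos]. *)
Lemma coefficient_half_plane (u : C) : Cmod u = 1 ->
  -1 <= Re (b * (Cconj u * Cconj u)).
Proof.
  intros Hu. set (beta := Re (b * (Cconj u * Cconj u))).
  apply Rnot_lt_le; intros Hb.
  (* [r0] is chosen such that [r0^2 beta < -1], the midpoint of [t] and 1 being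
     larger than [sqrt t] *)
  set (t := / - beta).
  assert (Ht : 0 < t < 1).
  { unfold t; split; [apply Rinv_0_lt_compat; lra|].
    rewrite <- Rinv_1. apply Rinv_lt_contravar; lra. }
  assert (tb : t * beta = -1) by (unfold t; field; lra).
  set (r0 := (1 + t) / 2). set (r1 := (1 + r0) / 2).
  assert (Hr0 : 0 < r0 < 1) by (unfold r0; lra).
  assert (Hr1 : r0 < r1 < 1) by (unfold r1; lra).
  assert (r0t : t < r0 ^ 2).
  { assert (0 < (1 - t) ^ 2) by (apply pow_lt; lra). unfold r0. nra. }
  assert (r0b : r0 ^ 2 * beta < -1) by nra.
  set (kap := PI ^ 2 * (- 1 - r0 ^ 2 * beta)).
  assert (Hkap : 0 < kap).
  { apply Rmult_lt_0_compat; [apply pow_lt, PI_RGT_0 | lra]. }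
  set (rho := fun i : nat => r0 + (r1 - r0) * (1 - / INR (S i))).
  assert (invS : forall i, 0 < / INR (S i) <= 1).
  { intros i. assert (P : 1 <= INR (S i)) by (rewrite S_INR; assert (H := pos_INR i); lra).
    split; [apply Rinv_0_lt_compat; lra|]. rewrite <- Rinv_1. apply Rinv_le_contravar; lra. }
  assert (Hrho : forall i, r0 <= rho i < r1).
  { intros i. unfold rho. specialize (invS i). nra. }
  assert (rho_incr : forall i j, (i < j)%nat -> rho i < rho j).
  { intros i j Hij. unfold rho. apply Rplus_lt_compat_l, Rmult_lt_compat_l; [lra|].
    assert (/ INR (S j) < / INR (S i)); [|lra].
    apply Rinv_lt_contravar; [|apply lt_INR; lia].
    apply Rmult_lt_0_compat; apply lt_0_INR; lia. }
  assert (far : forall r s, r0 <= r -> r < s -> s < 1 -> 2 * kap <= energy u 0 s r).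
  { intros r s Hr Hrs Hs. rewrite (energy_0) by (trivial; lra). fold beta. unfold kap.
    assert (D : r / s <= 1).
    { apply Rmult_le_reg_r with s; [lra|]. unfold Rdiv; rewrite Rmult_assoc, Rinv_l; lra. }
    assert (E : r * s * beta <= r0 ^ 2 * beta).
    { assert (r0 ^ 2 <= r * s) by (simpl; rewrite Rmult_1_r; apply Rmult_le_compat; lra). nra. }
    assert (P : 0 < PI ^ 2) by apply pow_lt, PI_RGT_0.
    nra. }
  destruct (bounded_on_disc q r1) as [B0 HB0]; [intros z Hz; apply q_cont; lra|].
  set (B := / r0 + B0).
  assert (HB : forall i x, Cmod (with_pole (polar (rho i) x)) <= B).
  { intros i x. specialize (Hrho i). unfold with_pole.
    eapply Rle_trans; [apply Cmod_triangle|]. apply Rplus_le_compat.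
    - rewrite Cmod_inv, Cmod_polar by (lra || (apply polar_neq_0; lra)).
      apply Rinv_le_contravar; lra.
    - apply HB0. rewrite Cmod_polar; lra. }
  set (c := 2 * PI * (2 * PI) * (2 * ln (4 * B ^ 2 + 1))).
  destruct (INR_unbounded (c / kap)) as [M HM].
  assert (HM' : c < INR M * kap).
  { apply (Rmult_lt_compat_r kap) in HM; [|assumption].
    unfold Rdiv in HM; rewrite Rmult_assoc, Rinv_l in HM; lra. }
  assert (off : forall i j, i <> j -> exists d, 0 < d /\
            forall e, 0 < e < d -> kap <= energy u e (rho i) (rho j)).
  { assert (ord : forall i j, (i < j)%nat -> exists d, 0 < d /\
            forall e, 0 < e < d -> kap <= energy u e (rho j) (rho i)).
    { intros i j Hij. assert (Hi := Hrho i). assert (Hj := Hrho j). assert (L := rho_incr i j Hij).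
      assert (F := far (rho i) (rho j) ltac:(lra) L ltac:(lra)).
      destruct (energy_continuous_0 u (rho j) (rho i) ltac:(lra) ltac:(lra) ltac:(lra)
                  (fun v => kap <= v)) as [d Hd].
      { exists (mkposreal _ Hkap); intros v Hv.
        change (Rabs (v - energy u 0 (rho j) (rho i)) < kap) in Hv.
        apply Rabs_lt_between in Hv; lra. }
      exists d; split; [apply cond_pos|]. intros e He. apply Hd.
      change (Rabs (e - 0) < d). rewrite Rminus_0_r, Rabs_pos_eq; lra. }
    intros i j N. destruct (Nat.lt_total i j) as [L|[L|L]]; [|contradiction|now apply ord].
    destruct (ord i j L) as [d [Hd K]]. exists d; split; [assumption|]. intros e He.
    assert (Hi := Hrho i). assert (Hj := Hrho j).
    rewrite energy_sym by (trivial; lra). now apply K. }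
  destruct (eventually_forall_le (fun i e => forall j, (j <= M)%nat -> j <> i ->
              kap <= energy u e (rho i) (rho j)) M) as [d [Hd K]].
  { intros i.
    destruct (eventually_forall_le (fun j e => j <> i -> kap <= energy u e (rho i) (rho j)) M)
      as [d [Hd K]].
    - intros j. destruct (Nat.eq_dec j i) as [E|E].
      + exists 1; split; [lra | tauto].
      + destruct (off i j) as [d [Hd K]]; [congruence|]. exists d; split; auto.
    - exists d; split; [assumption|]. intros e He j Hj. now apply K. }
  set (eps := Rmin (d / 2) 1).
  assert (He : 0 < eps) by (apply Rmin_glb_lt; lra).
  assert (He1 : eps <= d / 2) by apply Rmin_l. assert (He2 : eps <= 1) by apply Rmin_r.
  assert (up := log_energy_nonpos M (fun i x => with_pole (polar (rho i) x)) (wave u) B eps).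
  assert (K2 : forall i j, continuous_2 (fun x y => wave u x * wave u y * log_kernel eps (rho i) (rho j) x y)).
  { intros i j. assert (Hi := Hrho i). assert (Hj := Hrho j).
    apply continuous_2_energy; trivial; lra. }
  assert (split := torus_integral_sum2 M
    (fun i j x y => wave u x * wave u y * log_kernel eps (rho i) (rho j) x y) K2).
  change (fun i j => torus_integral _) with (fun i j => energy u eps (rho i) (rho j)) in split.
  enough (INR (S M) * (INR M * kap - c) <= sum2 M (fun i j => energy u eps (rho i) (rho j))).
  { assert (0 < INR (S M) * (INR M * kap - c)).
    { apply Rmult_lt_0_compat; [apply lt_0_INR; lia | lra]. }
    enough (sum2 M (fun i j => energy u eps (rho i) (rho j)) <= 0) by lra.
    rewrite <- split. apply up; trivial.
    - intros i x. assert (Hi := Hrho i).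
      apply (continuous_G_polar (fun _ => rho i) (fun x => x));
        [apply continuous_const | apply continuous_id | lra].
    - apply continuous_wave.
    - intros x; now apply wave_bound.
    - apply RInt_wave. }
  apply sum_n_ge_const. intros i Hi. apply (sum_n_ge_exception _ _ _ _ i Hi).
  - intros j Hj N. apply K; trivial. lra.
  - assert (Hr := Hrho i). unfold c.
    apply energy_diag_bound; trivial; try lra; try (intros; apply HB).
Qed.

(** Choose [u] such that [b (Cconj u)^2] is the negative number [- |b|]. *)
Lemma coefficient_bound : Cmod b <= 1.
Proof.
  destruct (classic (b = RtoC 0)) as [->|Nb]; [rewrite Cmod_0; lra|].
  assert (Mb : 0 < Cmod b) by (now apply Cmod_gt_0).
  assert (Nm : RtoC (Cmod b) <> RtoC 0) by (intros E; apply RtoC_inj in E; lra).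
  destruct (Csqrt_exists (- Cconj b / RtoC (Cmod b))) as [v Hv].
  assert (Hm : Cmod v * Cmod v = 1).
  { rewrite <- Cmod_mult, Hv, Cmod_div, Cmod_opp, Cmod_conj, Cmod_R, Rabs_pos_eq by (trivial; lra).
    field; lra. }
  assert (Hm1 : Cmod v = 1) by (assert (P := Cmod_ge_0 v); nra).
  assert (H := coefficient_half_plane (Cconj v)).
  rewrite Cmod_conj, Cconj_conj, Hv in H. specialize (H Hm1).
  replace (b * (- Cconj b / RtoC (Cmod b)))%C with (RtoC (- Cmod b)) in H.
  - simpl in H. lra.
  - transitivity (- (b * Cconj b) / RtoC (Cmod b))%C; [|field; assumption].
    rewrite <- Cmod2_conj. rewrite RtoC_opp. simpl pow. rewrite Rmult_1_r, RtoC_mult. field. assumption.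
Qed.

End Energy.

(** * Taylor coefficients of a concave function *)

Lemma is_pseries_C_partial (a : nat -> C) (z w : C) :
  is_pseries (K := C_AbsRing) (V := C_NormedModule) a z w ->
  forall e, 0 < e -> exists N, forall n, (N <= n)%nat ->
    Cmod (sum_n (G := C_AbelianMonoid) (fun k => z ^ k * a k)%C n - w) < e.
Proof.
  intros H e He.
  destruct (H (fun v => Cmod (v - w) < e)) as [N HN].
  { apply locally_Cmod. exists e; split; [assumption | tauto]. }
  exists N; intros n Hn. exact (HN n Hn).
Qed.

Definition cubic (a : nat -> C) (z : C) : C :=
  (a 0%nat + a 1%nat * z + a 2%nat * z ^ 2 + a 3%nat * z ^ 3)%C.

(** Convergence at [z0] bounds the coefficients by those of a geometric
    series. *)
Lemma pseries_cubic_remainder (a : nat -> C) (z0 w0 : C) : z0 <> RtoC 0 ->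
  is_pseries (K := C_AbsRing) (V := C_NormedModule) a z0 w0 ->
  exists K, 0 <= K /\ forall z w, Cmod z <= Cmod z0 / 2 ->
    is_pseries (K := C_AbsRing) (V := C_NormedModule) a z w ->
    Cmod (w - cubic a z) <= K * Cmod z ^ 4.
Proof.
  intros Hz0 Hw0. assert (R0 : 0 < Cmod z0) by (now apply Cmod_gt_0).
  set (term := fun (z : C) (k : nat) => (z ^ k * a k)%C).
  set (S := fun (z : C) => sum_n (G := C_AbelianMonoid) (term z)).
  assert (SS : forall z n, S z (Datatypes.S n) = (S z n + term z (Datatypes.S n))%C)
    by (intros; apply (sum_Sn (G := C_AbelianMonoid))).
  assert (bounded : exists B, 0 <= B /\ forall n, Cmod (a n) * Cmod z0 ^ n <= B).
  { destruct (is_pseries_C_partial a z0 w0 Hw0 1 Rlt_0_1) as [N HN].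
    assert (fin : forall m, exists B, 0 <= B /\ forall n, (n <= m)%nat -> Cmod (a n) * Cmod z0 ^ n <= B).
    { induction m.
      - exists (Cmod (a 0%nat) * Cmod z0 ^ 0); split.
        + apply Rmult_le_pos; [apply Cmod_ge_0 | apply pow_le; lra].
        + intros n Hn; replace n with 0%nat by lia; lra.
      - destruct IHm as [B [HB K]].
        exists (Rmax B (Cmod (a (Datatypes.S m)) * Cmod z0 ^ Datatypes.S m)); split.
        + eapply Rle_trans; [exact HB | apply Rmax_l].
        + intros n Hn. destruct (Nat.eq_dec n (Datatypes.S m)) as [->|E]; [apply Rmax_r|].
          eapply Rle_trans; [apply K; lia | apply Rmax_l]. }
    destruct (fin (Datatypes.S N)) as [B [HB K]].
    exists (Rmax B 2); split; [eapply Rle_trans; [exact HB | apply Rmax_l]|].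
    intros n. destruct (Nat.le_gt_cases n (Datatypes.S N)) as [Hn|Hn].
    - eapply Rle_trans; [now apply K | apply Rmax_l].
    - eapply Rle_trans; [|apply Rmax_r]. destruct n as [|n]; [lia|].
      assert (A1 := HN n ltac:(lia)). assert (A2 := HN (Datatypes.S n) ltac:(lia)).
      fold (term z0) in A1, A2. fold (S z0) in A1, A2. rewrite SS in A2.
      rewrite <- Cmod_pow, Rmult_comm, <- Cmod_mult. fold (term z0 (Datatypes.S n)).
      assert (T := Cmod_triangle (S z0 n + term z0 (Datatypes.S n) - w0) (- (S z0 n - w0))).
      rewrite Cmod_opp in T.
      replace (S z0 n + term z0 (Datatypes.S n) - w0 + - (S z0 n - w0))%C
        with (term z0 (Datatypes.S n)) in T by ring. lra. }
  destruct bounded as [B [HB K]].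
  exists (2 * B / Cmod z0 ^ 4). split.
  { apply Rmult_le_pos; [lra | left; apply Rinv_0_lt_compat, pow_lt, R0]. }
  intros z w Hz Hw. set (t := Cmod z / Cmod z0).
  assert (Mz := Cmod_ge_0 z).
  assert (Ht0 : 0 <= t) by (apply Rmult_le_pos; [assumption | left; now apply Rinv_0_lt_compat]).
  assert (Ht : t <= / 2).
  { unfold t. apply Rmult_le_reg_r with (Cmod z0); [assumption|].
    unfold Rdiv; rewrite Rmult_assoc, Rinv_l by lra. lra. }
  assert (Hterm : forall n, Cmod (term z n) <= B * t ^ n).
  { intros n. unfold term. rewrite Cmod_mult, Cmod_pow.
    replace (Cmod z ^ n * Cmod (a n)) with ((Cmod (a n) * Cmod z0 ^ n) * t ^ n).
    - apply Rmult_le_compat_r; [now apply pow_le | apply K].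
    - unfold t, Rdiv. rewrite Rpow_mult_distr, pow_inv. field. apply pow_nonzero; lra. }
  assert (S3 : S z 3%nat = cubic a z).
  { rewrite !SS. unfold S. rewrite sum_O. unfold term, cubic. simpl. ring. }
  assert (tail : forall n, Cmod (S z (4 + n)%nat - cubic a z) <= B * t ^ 4 * (2 - (/ 2) ^ n)).
  { induction n.
    - change (S z (4 + 0)%nat) with (S z 4%nat). rewrite SS, S3.
      replace (cubic a z + term z 4%nat - cubic a z)%C with (term z 4%nat) by ring.
      eapply Rle_trans; [apply Hterm|]. simpl; lra.
    - change (4 + Datatypes.S n)%nat with (Datatypes.S (4 + n)). rewrite SS.
      replace (S z (4 + n)%nat + term z (Datatypes.S (4 + n)) - cubic a z)%C
        with ((S z (4 + n)%nat - cubic a z) + term z (Datatypes.S (4 + n)))%C by ring.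
      eapply Rle_trans; [apply Cmod_triangle|].
      assert (A := Hterm (Datatypes.S (4 + n))).
      replace (B * t ^ Datatypes.S (4 + n)) with (B * t ^ 4 * t ^ Datatypes.S n) in A
        by (change (Datatypes.S (4 + n)) with (4 + Datatypes.S n)%nat; rewrite pow_add; ring).
      assert (P : t ^ Datatypes.S n <= (/ 2) ^ Datatypes.S n) by (apply pow_incr; lra).
      assert (Q : 0 <= B * t ^ 4) by (apply Rmult_le_pos; [assumption | now apply pow_le]).
      replace (2 - (/ 2) ^ Datatypes.S n) with ((2 - (/ 2) ^ n) + (/ 2) ^ Datatypes.S n) by (simpl; field).
      nra. }
  replace (2 * B / Cmod z0 ^ 4 * Cmod z ^ 4) with (2 * (B * t ^ 4))
    by (unfold t; field; lra).
  apply le_epsilon; intros e He.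
  destruct (is_pseries_C_partial a z w Hw e He) as [N HN].
  specialize (HN (4 + N)%nat ltac:(lia)). fold (term z) in HN. fold (S z) in HN.
  specialize (tail N).
  assert (T := Cmod_triangle (S z (4 + N)%nat - cubic a z) (- (S z (4 + N)%nat - w))).
  rewrite Cmod_opp in T.
  replace (S z (4 + N)%nat - cubic a z + - (S z (4 + N)%nat - w))%C with (w - cubic a z)%C in T by ring.
  assert (Q : 0 <= B * t ^ 4) by (apply Rmult_le_pos; [assumption | now apply pow_le]).
  assert (0 < (/ 2) ^ N) by (apply pow_lt; lra). nra.
Qed.

Section ConcaveFunction.
Variables (p : R) (f : C -> sphere) (a : nat -> C).
Hypothesis hp : 0 < p < 1.
Hypothesis Hf : concave_normalized p f.
Hypothesis Ha : expansion p f a.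

Lemma pole_unique z : Cmod z < 1 -> f z = None -> z = RtoC p.
Proof.
  intros Hz E. apply (concave_univalent _ _ Hf); trivial.
  - unfold unit_disc. rewrite Cmod_R, Rabs_pos_eq; lra.
  - rewrite E. symmetry. apply (concave_pole _ _ Hf).
Qed.

Lemma differentiable_off_pole z : Cmod z < 1 -> z <> RtoC p ->
  locally z (finite_differentiable f).
Proof.
  intros Hz N. destruct (concave_meromorphic _ _ Hf z Hz) as [H|H]; [exact H|].
  exfalso. apply N, pole_unique; [assumption | apply H].
Qed.

(** The value 0 at the pole makes [1 / f] continuous there. *)
Definition reciprocal (z : C) : C :=
  match f z with Some w => (/ w)%C | None => RtoC 0 end.

Lemma finite_part_neq_0 z w : Cmod z < 1 -> z <> RtoC 0 -> f z = Some w -> w <> RtoC 0.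
Proof.
  intros Hz N E ->. apply N. apply (concave_univalent _ _ Hf); trivial.
  - unfold unit_disc. rewrite Cmod_0; lra.
  - rewrite E. symmetry. apply (concave_zero _ _ Hf).
Qed.

Lemma ex_derive_reciprocal z : Cmod z < 1 -> z <> RtoC 0 -> z <> RtoC p -> ex_derive reciprocal z.
Proof.
  intros Hz N0 Np. assert (L := differentiable_off_pole z Hz Np).
  destruct (locally_singleton _ _ L) as [Fz Dz].
  apply (ex_derive_CC_ext_loc (fun w => / finite_part f w)%C).
  - revert L. apply filter_imp. intros w [Fw _]. unfold reciprocal, finite_part.
    destruct (f w); [reflexivity | contradiction].
  - apply ex_derive_Cinv; [exact Dz|].
    unfold finite_part. destruct (f z) as [w|] eqn:E; [|contradiction].
    now apply (finite_part_neq_0 z).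
Qed.

Lemma continuous_reciprocal_pole : continuous reciprocal (RtoC p).
Proof.
  destruct (concave_pole _ _ Hf) as [E [_ L]].
  apply continuous_CC_iff; intros e He.
  assert (K := L (fun x => / e < x) (ex_intro _ (/ e) (fun x Hx => Hx))).
  unfold filtermap, locally', within in K.
  apply locally_Cmod in K as [d [Hd K]].
  exists d; split; [assumption|]. intros w Hw.
  assert (Rp : reciprocal (RtoC p) = RtoC 0) by (unfold reciprocal; now rewrite E).
  rewrite Rp. replace (reciprocal w - 0)%C with (reciprocal w) by ring.
  destruct (classic (w = RtoC p)) as [->|N]; [rewrite Rp, Cmod_0; assumption|].
  specialize (K w Hw N). unfold reciprocal. unfold finite_part in K.
  assert (I : 0 < / e) by (now apply Rinv_0_lt_compat).
  destruct (f w) as [v|]; [|rewrite Cmod_0; assumption].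
  assert (V : 0 < Cmod v) by lra.
  rewrite Cmod_inv by (now apply Cmod_gt_0).
  rewrite <- (Rinv_inv e). apply Rinv_lt_contravar; [now apply Rmult_lt_0_compat | exact K].
Qed.

Lemma finite_part_expansion : exists d K, 0 < d <= 1 /\ 0 <= K /\
  forall z, Cmod z <= d -> f z <> None /\ Cmod (finite_part f z - cubic a z) <= K * Cmod z ^ 4.
Proof.
  assert (M : Cmod (RtoC (p / 2)) = p / 2) by (rewrite Cmod_R, Rabs_pos_eq; lra).
  destruct (Ha (RtoC (p / 2))) as [w0 [_ Hw0]]; [lra|].
  destruct (pseries_cubic_remainder a (RtoC (p / 2)) w0) as [K [HK H]]; trivial.
  { apply Cmod_gt_0; lra. }
  exists (p / 4), K. split; [lra|]; split; [assumption|]. intros z Hz.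
  destruct (Ha z) as [w [E Hw]]; [lra|].
  unfold finite_part. rewrite E. split; [discriminate|]. apply H; [lra | exact Hw].
Qed.

Lemma coefficient_0 : a 0%nat = RtoC 0.
Proof.
  destruct finite_part_expansion as (d & K & Hd & _ & H).
  specialize (H (RtoC 0)). rewrite Cmod_0 in H. destruct (H ltac:(lra)) as [_ H'].
  clear H; rename H' into H.
  assert (E : (finite_part f 0 - cubic a 0)%C = (- a 0%nat)%C).
  { unfold finite_part. rewrite (concave_zero _ _ Hf). unfold cubic. simpl. ring. }
  rewrite E, Cmod_opp in H. apply Cmod_eq_0. apply Rle_antisym; [|apply Cmod_ge_0].
  simpl in H. lra.
Qed.

Lemma coefficient_1 : a 1%nat = RtoC 1.
Proof.
  destruct finite_part_expansion as (d & K & Hd & HK & H).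
  rewrite <- (is_C_derive_unique _ _ _ (concave_derive _ _ Hf)). symmetry.
  apply is_C_derive_unique, is_derive_CC_iff. intros e He.
  set (m := Cmod (a 2%nat) + Cmod (a 3%nat) + K).
  assert (A2 := Cmod_ge_0 (a 2%nat)). assert (A3 := Cmod_ge_0 (a 3%nat)).
  exists (Rmin d (e / (1 + m))); split.
  { apply Rmin_glb_lt; [lra | apply Rdiv_lt_0_compat; unfold m; lra]. }
  intros z Hz. replace (z - 0)%C with z in * by ring.
  assert (Z1 : Cmod z < d) by (eapply Rlt_le_trans; [exact Hz | apply Rmin_l]).
  assert (Z2 : Cmod z < e / (1 + m)) by (eapply Rlt_le_trans; [exact Hz | apply Rmin_r]).
  apply (Rmult_lt_compat_r (1 + m)) in Z2; [|unfold m; lra].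
  unfold Rdiv in Z2; rewrite Rmult_assoc, Rinv_l in Z2 by (unfold m; lra).
  destruct (H z ltac:(lra)) as [_ H']; clear H; rename H' into H.
  assert (F0 : finite_part f 0 = RtoC 0) by (unfold finite_part; now rewrite (concave_zero _ _ Hf)).
  rewrite F0.
  replace (finite_part f z - 0 - z * a 1%nat)%C
    with ((finite_part f z - cubic a z) + (a 2%nat * (z * z) + a 3%nat * (z * z * z)))%C.
  2: { unfold cubic. rewrite coefficient_0. simpl. ring. }
  eapply Rle_trans; [apply Cmod_triangle|].
  eapply Rle_trans; [apply Rplus_le_compat_l, Cmod_triangle|].
  rewrite !Cmod_mult. assert (Mz := Cmod_ge_0 z). set (t := Cmod z) in *.
  assert (T1 : t ^ 4 <= t * t).
  { replace (t ^ 4) with (t * t * (t * t)) by ring. assert (0 <= t * t <= 1) by nra. nra. }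
  assert (T2 : t * t * t <= t * t) by nra.
  assert (U1 : K * t ^ 4 <= K * (t * t)) by (apply Rmult_le_compat_l; lra).
  assert (U2 : Cmod (a 3%nat) * (t * t * t) <= Cmod (a 3%nat) * (t * t)) by (apply Rmult_le_compat_l; lra).
  assert (U3 : m * t * t <= e * t) by nra. unfold m in U3. lra.
Qed.

(** The value at 0 is the limit, as [1 / f = 1 / z - a_2 + O(z)]. *)
Definition regular_part (z : C) : C :=
  if excluded_middle_informative (z = RtoC 0) then (- a 2%nat)%C else (reciprocal z - / z)%C.

Lemma regular_part_0 : regular_part (RtoC 0) = (- a 2%nat)%C.
Proof. unfold regular_part. destruct excluded_middle_informative; [reflexivity | contradiction]. Qed.

Lemma regular_part_E z : z <> RtoC 0 -> regular_part z = (reciprocal z - / z)%C.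
Proof. intros N. unfold regular_part. destruct excluded_middle_informative; [contradiction | reflexivity]. Qed.

Lemma regular_part_loc z : z <> RtoC 0 ->
  locally z (fun w => (reciprocal w - / w)%C = regular_part w).
Proof.
  intros N. apply locally_Cmod. exists (Cmod z); split; [now apply Cmod_gt_0|].
  intros w Hw. symmetry; apply regular_part_E. intros ->.
  replace (0 - z)%C with (- z)%C in Hw by ring. rewrite Cmod_opp in Hw; lra.
Qed.

(** With [f z = z s] and [s = 1 + a_2 z + a_3 z^2 + r z^3], the quotient
    [(1 - s) / (z s)] differs from [- a_2 + (a_2^2 - a_3) z] by [z^2 / s] times
    a bounded quantity. *)
Lemma is_derive_regular_part_0 :
  is_derive regular_part (RtoC 0) (a 2%nat * a 2%nat - a 3%nat)%C.
Proof.
  destruct finite_part_expansion as (d & K & Hd & HK & H).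
  set (a2 := a 2%nat) in *. set (a3 := a 3%nat) in *. set (b := (a2 * a2 - a3)%C).
  assert (A2 := Cmod_ge_0 a2). assert (A3 := Cmod_ge_0 a3). assert (Ab := Cmod_ge_0 b).
  set (k := K + Cmod (a2 * a3 - b * a2) + (Cmod a2 * K + Cmod b * Cmod a3) + Cmod b * K).
  assert (k0 : 0 <= k).
  { assert (X := Cmod_ge_0 (a2 * a3 - b * a2)). unfold k.
    assert (0 <= Cmod a2 * K) by (now apply Rmult_le_pos).
    assert (0 <= Cmod b * Cmod a3) by (now apply Rmult_le_pos).
    assert (0 <= Cmod b * K) by (now apply Rmult_le_pos). lra. }
  set (l := Cmod a2 + Cmod a3 + K).
  assert (l0 : 0 <= l) by (unfold l; lra).
  apply is_derive_CC_iff; intros eps Heps.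
  set (d' := Rmin d (Rmin (/ (2 * (1 + l))) (eps / (2 * (1 + k))))).
  exists d'; split.
  { repeat apply Rmin_glb_lt; [lra | apply Rinv_0_lt_compat; lra | apply Rdiv_lt_0_compat; lra]. }
  intros z Hz. replace (z - 0)%C with z in * by ring.
  destruct (excluded_middle_informative (z = RtoC 0)) as [->|Nz].
  { rewrite Cmult_0_l. replace (regular_part 0 - regular_part 0 - 0)%C with (RtoC 0) by ring.
    rewrite Cmod_0. lra. }
  assert (Z1 : Cmod z < d) by (eapply Rlt_le_trans; [exact Hz | apply Rmin_l]).
  assert (Z23 : Cmod z < Rmin (/ (2 * (1 + l))) (eps / (2 * (1 + k))))
    by (eapply Rlt_le_trans; [exact Hz | apply Rmin_r]).
  assert (Z2 : Cmod z < / (2 * (1 + l))) by (eapply Rlt_le_trans; [exact Z23 | apply Rmin_l]).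
  assert (Z3 : Cmod z < eps / (2 * (1 + k))) by (eapply Rlt_le_trans; [exact Z23 | apply Rmin_r]).
  assert (Z2' : Cmod z * (1 + l) < / 2).
  { apply (Rmult_lt_compat_r (1 + l)) in Z2; [|lra].
    replace (/ (2 * (1 + l)) * (1 + l)) with (/ 2) in Z2 by (field; lra). exact Z2. }
  assert (Z3' : 2 * (Cmod z * (1 + k)) < eps).
  { apply (Rmult_lt_compat_r (2 * (1 + k))) in Z3; [|lra].
    replace (eps / (2 * (1 + k)) * (2 * (1 + k))) with eps in Z3 by (field; lra). lra. }
  assert (M : 0 < Cmod z) by (now apply Cmod_gt_0).
  destruct (H z ltac:(lra)) as [Fz H']; clear H; rename H' into H.
  unfold finite_part in H. destruct (f z) as [w|] eqn:Ew; [clear Fz | contradiction].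
  set (r := ((w - cubic a z) / (z * z * z * z))%C).
  assert (Hr : Cmod r <= K).
  { unfold r. rewrite Cmod_div, !Cmod_mult by (repeat apply Cmult_neq_0; assumption).
    apply Rmult_le_reg_r with (Cmod z ^ 4); [now apply pow_lt|].
    replace (Cmod (w - cubic a z) / (Cmod z * Cmod z * Cmod z * Cmod z) * Cmod z ^ 4)
      with (Cmod (w - cubic a z)) by (field; lra). exact H. }
  set (s := (1 + z * (a2 + a3 * z + r * (z * z)))%C).
  assert (Es : w = (z * s)%C).
  { unfold s, r, cubic. fold a2 a3. rewrite coefficient_0, coefficient_1. simpl. field. exact Nz. }
  assert (Hs : Cmod (s - 1) <= / 2).
  { replace (s - 1)%C with (z * (a2 + a3 * z + r * (z * z)))%C by (unfold s; ring).
    rewrite Cmod_mult. apply Rle_trans with (Cmod z * (1 + l)); [|lra].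
    apply Rmult_le_compat_l; [lra|].
    eapply Rle_trans; [apply Cmod_triangle|].
    eapply Rle_trans; [apply Rplus_le_compat_r, Cmod_triangle|].
    rewrite !Cmod_mult. assert (Mr := Cmod_ge_0 r). unfold l.
    assert (Cmod a3 * Cmod z <= Cmod a3 * 1) by (apply Rmult_le_compat_l; lra).
    assert (Cmod z * Cmod z <= 1) by nra.
    assert (Cmod r * (Cmod z * Cmod z) <= K * 1) by (apply Rmult_le_compat; nra). lra. }
  assert (Ms : / 2 <= Cmod s).
  { assert (T := Cmod_triangle s (- (s - 1))). rewrite Cmod_opp in T.
    replace (s + - (s - 1))%C with (RtoC 1) in T by ring. rewrite Cmod_1 in T. lra. }
  assert (Ns : s <> RtoC 0) by (apply Cmod_gt_0; lra).
  set (N := (- r + (a2 * a3 - b * a2) + z * (a2 * r - b * a3) + - (z * z * (b * r)))%C).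
  replace (regular_part z - regular_part 0 - z * b)%C with (z * (z * (N / s)))%C.
  2: { rewrite regular_part_0, regular_part_E by assumption.
       unfold reciprocal. rewrite Ew, Es. fold a2.
       assert (Nu : (s - 1)%C = (z * (a2 + a3 * z + r * (z * z)))%C) by (unfold s; ring).
       transitivity ((- ((s - 1) / z) + (a2 - z * b) * s) / s)%C; [|field; now split].
       rewrite Nu. unfold N, b, s. field. split; [exact Nz | exact Ns]. }
  rewrite !Cmod_mult, Cmod_div by assumption.
  rewrite (Rmult_comm eps). apply Rmult_le_compat_l; [lra|].
  assert (HN : Cmod N <= k).
  { unfold N. assert (Mr := Cmod_ge_0 r).
    eapply Rle_trans; [apply Cmod_triangle|].
    eapply Rle_trans; [apply Rplus_le_compat_r, Cmod_triangle|].
    eapply Rle_trans; [apply Rplus_le_compat_r, Rplus_le_compat_r, Cmod_triangle|].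
    rewrite !Cmod_opp, (Cmod_mult z), !Cmod_mult.
    assert (T := Cmod_triangle (a2 * r) (- (b * a3))). rewrite Cmod_opp, !Cmod_mult in T.
    assert (U1 : Cmod a2 * Cmod r <= Cmod a2 * K) by (apply Rmult_le_compat_l; lra).
    assert (U2 : Cmod b * Cmod r <= Cmod b * K) by (apply Rmult_le_compat_l; lra).
    assert (T' : Cmod z * Cmod (a2 * r - b * a3) <= 1 * (Cmod a2 * K + Cmod b * Cmod a3)).
    { apply Rmult_le_compat; try apply Cmod_ge_0; [lra|]. unfold Cminus. lra. }
    assert (U3 : Cmod z * Cmod z <= 1) by nra.
    assert (U4 : Cmod z * Cmod z * (Cmod b * Cmod r) <= 1 * (Cmod b * K)).
    { apply Rmult_le_compat; try nra. }
    unfold k. lra. }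
  assert (Is : / Cmod s <= 2).
  { rewrite <- (Rinv_inv 2). apply Rinv_le_contravar; lra. }
  assert (Is0 : 0 < / Cmod s) by (apply Rinv_0_lt_compat; lra).
  assert (MN := Cmod_ge_0 N).
  assert (Q : Cmod N / Cmod s <= k * 2) by (unfold Rdiv; apply Rmult_le_compat; lra).
  apply Rle_trans with (Cmod z * (k * 2)); [apply Rmult_le_compat_l; lra | nra].
Qed.

Lemma continuous_regular_part z : Cmod z < 1 -> continuous regular_part z.
Proof.
  intros Hz. destruct (excluded_middle_informative (z = RtoC 0)) as [->|N].
  - apply ex_derive_CC_continuous. eexists; apply is_derive_regular_part_0.
  - apply (continuous_ext_loc _ (fun w : C => reciprocal w - / w)%C); [now apply regular_part_loc|].
    apply continuous_Cminus.
    + destruct (excluded_middle_informative (z = RtoC p)) as [->|Np].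
      * apply continuous_reciprocal_pole.
      * now apply ex_derive_CC_continuous, ex_derive_reciprocal.
    + apply continuous_Cinv; [apply continuous_id | assumption].
Qed.

Lemma ex_derive_regular_part z : Cmod z < 1 -> off_slit z -> ex_derive regular_part z.
Proof.
  intros Hz Sz.
  assert (N0 : z <> RtoC 0) by (intros ->; destruct Sz as [S|S]; simpl in S; lra).
  assert (Np : z <> RtoC p) by (intros ->; destruct Sz as [S|S]; simpl in S; lra).
  apply (ex_derive_CC_ext_loc (fun w => reciprocal w - / w)%C); [now apply regular_part_loc|].
  apply ex_derive_Cminus; [now apply ex_derive_reciprocal|].
  apply ex_derive_Cinv; [apply ex_derive_Cid | assumption].
Qed.

Lemma reciprocal_inj z w : 0 < Cmod z < Cmod w -> Cmod w < 1 ->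
  with_pole regular_part z <> with_pole regular_part w.
Proof.
  intros Hz Hw.
  assert (Nz : z <> RtoC 0) by (apply Cmod_gt_0; lra).
  assert (Nw : w <> RtoC 0) by (apply Cmod_gt_0; lra).
  assert (E : forall x : C, x <> RtoC 0 -> with_pole regular_part x = reciprocal x).
  { intros x Nx. unfold with_pole. rewrite regular_part_E by assumption. ring. }
  rewrite !E by assumption. intros K.
  enough (z = w) by (subst; lra).
  apply (concave_univalent _ _ Hf); unfold unit_disc; try lra.
  unfold reciprocal in K.
  assert (Iz := finite_part_neq_0 z). assert (Iw := finite_part_neq_0 w).
  destruct (f z) as [v|], (f w) as [v'|]; trivial.
  - assert (Nv : v <> RtoC 0) by (apply Iz; trivial; lra).
    assert (Nv' : v' <> RtoC 0) by (apply Iw; trivial; lra).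
    f_equal. transitivity (v * v' * / v')%C; [field; assumption|].
    rewrite <- K. field. assumption.
  - exfalso. apply C1_nz. rewrite <- (Cinv_r v), K; [ring|]. apply Iz; trivial; lra.
  - exfalso. apply C1_nz. rewrite <- (Cinv_r v'), <- K; [ring|]. apply Iw; trivial; lra.
Qed.

Lemma fekete_szego_bound : Cmod (a 3%nat - a 2%nat * a 2%nat)%C <= 1.
Proof.
  rewrite <- Cmod_opp.
  replace (- (a 3%nat - a 2%nat * a 2%nat))%C with (a 2%nat * a 2%nat - a 3%nat)%C by ring.
  apply (coefficient_bound regular_part).
  - exact continuous_regular_part.
  - exact ex_derive_regular_part.
  - exact is_derive_regular_part_0.
  - exact reciprocal_inj.
Qed.

End ConcaveFunction.

(** * An extremal function *)

Lemma Some_inj {A : Type} (x y : A) : Some x = Some y -> x = y.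
Proof. congruence. Qed.

Lemma Cpow_tendsto_0 (x : C) : Cmod x < 1 ->
  forall e, 0 < e -> exists N, forall n, (N <= n)%nat -> Cmod (x ^ n)%C < e.
Proof.
  intros Hx e He. destruct (pow_lt_1_zero (Cmod x)) with (y := e) as [N HN]; trivial.
  { rewrite Rabs_pos_eq; [assumption | apply Cmod_ge_0]. }
  exists N; intros n Hn. specialize (HN n Hn). rewrite Cmod_pow.
  rewrite Rabs_pos_eq in HN; [assumption | apply pow_le, Cmod_ge_0].
Qed.

Lemma is_series_geom_C (x : C) : Cmod x < 1 ->
  is_series (K := C_AbsRing) (V := C_NormedModule) (fun k => (x ^ k)%C) (/ (1 - x))%C.
Proof.
  intros Hx.
  assert (N : (1 - x)%C <> RtoC 0).
  { intros E. assert (x = RtoC 1).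
    { transitivity (1 - (1 - x))%C; [ring | rewrite E; ring]. }
    subst. rewrite Cmod_1 in Hx; lra. }
  assert (M : 0 < Cmod (1 - x)) by (now apply Cmod_gt_0).
  assert (part : forall n, sum_n (G := C_AbelianMonoid) (fun k => (x ^ k)%C) n = ((1 - x ^ S n) / (1 - x))%C).
  { induction n.
    - rewrite sum_O. simpl. field. exact N.
    - rewrite sum_Sn, IHn. change plus with Cplus. simpl. field. exact N. }
  intros Q HQ. apply locally_Cmod in HQ as [e [He HQ]].
  destruct (Cpow_tendsto_0 x Hx (e * Cmod (1 - x))) as [n0 Hn0].
  { now apply Rmult_lt_0_compat. }
  exists n0; intros n Hn. apply HQ.
  assert (E : (sum_n (G := C_AbelianMonoid) (fun k => (x ^ k)%C) n - / (1 - x))%C = (- x ^ S n / (1 - x))%C).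
  { rewrite part. field. exact N. }
  change (Cmod (sum_n (G := C_AbelianMonoid) (fun k => (x ^ k)%C) n - / (1 - x)) < e).
  rewrite E, Cmod_div, Cmod_opp by assumption.
  apply Rmult_lt_reg_r with (Cmod (1 - x)); [assumption|].
  unfold Rdiv; rewrite Rmult_assoc, Rinv_l, Rmult_1_r by lra. apply Hn0; lia.
Qed.

Section Extremal.
Variable p : R.
Hypothesis hp : 0 < p < 1.

Definition extremal_denominator (z : C) : C := ((1 - z / RtoC p) * (1 - RtoC p * z))%C.

(** [1 / f = z + 1 / z - (p + 1 / p)], so [f] maps the disc onto the complement
    of a segment. *)
Definition extremal (z : C) : sphere :=
  if excluded_middle_informative (z = RtoC p) then None
  else Some (z / extremal_denominator z)%C.

Notation den := extremal_denominator.
Notation P := (p + / p).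

Lemma RtoC_p_neq_0 : RtoC p <> RtoC 0.
Proof. intros E; apply RtoC_inj in E; lra. Qed.

Lemma extremal_E z : z <> RtoC p -> extremal z = Some (z / den z)%C.
Proof. intros N. unfold extremal. destruct excluded_middle_informative; [contradiction | reflexivity]. Qed.

Lemma extremal_p : extremal (RtoC p) = None.
Proof. unfold extremal. destruct excluded_middle_informative; [reflexivity | contradiction]. Qed.

Lemma den_E z : den z = (1 - RtoC P * z + z * z)%C.
Proof.
  unfold extremal_denominator. rewrite RtoC_plus, RtoC_inv by lra. field. apply RtoC_p_neq_0.
Qed.

Lemma den_neq_0 z : Cmod z < 1 -> z <> RtoC p -> den z <> RtoC 0.
Proof.
  intros Hz N. apply Cmult_neq_0.
  - intros E. apply N. transitivity (RtoC p * (1 - (1 - z / RtoC p)))%C.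
    + field. apply RtoC_p_neq_0.
    + rewrite E. ring.
  - intros E. assert (K : Cmod (RtoC p * z) = 1).
    { replace (RtoC p * z)%C with (1 - (1 - RtoC p * z))%C by ring.
      rewrite E. replace (1 - 0)%C with (RtoC 1) by ring. apply Cmod_1. }
    rewrite Cmod_mult, Cmod_R, Rabs_pos_eq in K by lra.
    assert (M := Cmod_ge_0 z). nra.
Qed.

Lemma is_derive_den z : exists l, is_derive den z l.
Proof.
  eexists. apply is_derive_Cmult.
  - apply is_derive_Cplus; [apply is_derive_Cconst|]. apply is_derive_Copp.
    apply is_derive_Cmult; [apply is_derive_Cid | apply is_derive_Cconst].
  - apply is_derive_Cplus; [apply is_derive_Cconst|]. apply is_derive_Copp.
    apply is_derive_Cmult; [apply is_derive_Cconst | apply is_derive_Cid].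
Qed.

Lemma extremal_loc z : z <> RtoC p -> locally z (fun w : C => (w / den w)%C = finite_part extremal w).
Proof.
  intros N.
  assert (M : 0 < Cmod (z - RtoC p)).
  { apply Cmod_gt_0. intros E. apply N. transitivity (z - RtoC p + RtoC p)%C; [ring | rewrite E; ring]. }
  apply locally_Cmod. exists (Cmod (z - RtoC p)); split; [assumption|].
  intros w Hw. unfold finite_part. rewrite extremal_E; [reflexivity|]. intros ->.
  rewrite <- Cmod_opp in Hw. replace (- (RtoC p - z))%C with (z - RtoC p)%C in Hw by ring. lra.
Qed.

Lemma extremal_differentiable z : Cmod z < 1 -> z <> RtoC p -> finite_differentiable extremal z.
Proof.
  intros Hz N. split; [rewrite extremal_E by assumption; discriminate|].
  apply (ex_derive_CC_ext_loc (fun w => w / den w)%C); [now apply extremal_loc|].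
  apply ex_derive_Cmult; [apply ex_derive_Cid|].
  apply ex_derive_Cinv; [apply is_derive_den | now apply den_neq_0].
Qed.

Lemma extremal_pole : pole_at extremal (RtoC p).
Proof.
  split; [apply extremal_p|]. split.
  - apply locally_Cmod. exists (1 - p); split; [lra|]. intros w Hw N.
    apply extremal_differentiable; [|exact N].
    assert (T := Cmod_triangle (w - RtoC p) (RtoC p)).
    replace (w - RtoC p + RtoC p)%C with w in T by ring.
    rewrite Cmod_R, Rabs_pos_eq in T by lra. lra.
  - intros Q [M HM]. apply locally_Cmod.
    set (d := p ^ 2 / (4 * (1 + Rabs M))).
    assert (MM := Rabs_pos M). assert (p2 : 0 < p ^ 2) by (apply pow_lt; lra).
    assert (Hd : 0 < d) by (apply Rdiv_lt_0_compat; lra).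
    exists (Rmin d (Rmin (1 - p) (p / 2))); split; [repeat apply Rmin_glb_lt; lra|].
    intros w Hw N. apply HM.
    assert (W1 : Cmod (w - RtoC p) < d) by (eapply Rlt_le_trans; [exact Hw | apply Rmin_l]).
    assert (W23 : Cmod (w - RtoC p) < Rmin (1 - p) (p / 2))
      by (eapply Rlt_le_trans; [exact Hw | apply Rmin_r]).
    assert (W2 : Cmod (w - RtoC p) < 1 - p) by (eapply Rlt_le_trans; [exact W23 | apply Rmin_l]).
    assert (W3 : Cmod (w - RtoC p) < p / 2) by (eapply Rlt_le_trans; [exact W23 | apply Rmin_r]).
    assert (T := Cmod_triangle (w - RtoC p) (RtoC p)).
    replace (w - RtoC p + RtoC p)%C with w in T by ring.
    rewrite Cmod_R, Rabs_pos_eq in T by lra.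
    assert (T2 := Cmod_triangle w (- (w - RtoC p))). rewrite Cmod_opp in T2.
    replace (w + - (w - RtoC p))%C with (RtoC p) in T2 by ring.
    rewrite Cmod_R, Rabs_pos_eq in T2 by lra.
    assert (Dn : den w <> RtoC 0) by (apply den_neq_0; [lra | exact N]).
    assert (Dm : 0 < Cmod (den w)) by (now apply Cmod_gt_0).
    unfold finite_part. rewrite extremal_E by exact N. rewrite Cmod_div by assumption.
    assert (D : Cmod (den w) * p <= 2 * Cmod (w - RtoC p)).
    { replace (Cmod (den w) * p) with (Cmod (den w * RtoC p)).
      2: { rewrite Cmod_mult, Cmod_R, (Rabs_pos_eq p); lra. }
      replace (den w * RtoC p)%C with ((1 - RtoC p * w) * - (w - RtoC p))%C.
      2: { unfold extremal_denominator. field. apply RtoC_p_neq_0. }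
      rewrite Cmod_mult, Cmod_opp. apply Rmult_le_compat_r; [apply Cmod_ge_0|].
      assert (T3 := Cmod_triangle 1 (- (RtoC p * w))).
      rewrite Cmod_opp, Cmod_mult, Cmod_1, Cmod_R, Rabs_pos_eq in T3 by lra.
      assert (Mw := Cmod_ge_0 w). unfold Cminus. nra. }
    apply Rle_lt_trans with (Rabs M); [apply Rle_abs|].
    apply Rmult_lt_reg_r with (Cmod (den w)); [assumption|].
    unfold Rdiv; rewrite Rmult_assoc, Rinv_l, Rmult_1_r by lra.
    apply Rmult_lt_reg_r with p; [lra|].
    apply Rle_lt_trans with (Rabs M * (2 * Cmod (w - RtoC p))).
    { rewrite Rmult_assoc. apply Rmult_le_compat_l; lra. }
    apply (Rmult_lt_compat_r (4 * (1 + Rabs M))) in W1; [|lra].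
    unfold d in W1. replace (p ^ 2 / (4 * (1 + Rabs M)) * (4 * (1 + Rabs M))) with (p ^ 2) in W1 by (field; lra).
    assert (V := Cmod_ge_0 (w - RtoC p)). nra.
Qed.

Lemma extremal_injective : injective_on unit_disc extremal.
Proof.
  intros z w Hz Hw E. unfold unit_disc in *.
  destruct (excluded_middle_informative (z = RtoC p)) as [->|Nz];
    destruct (excluded_middle_informative (w = RtoC p)) as [->|Nw]; trivial.
  - rewrite extremal_p, extremal_E in E by assumption; discriminate.
  - rewrite extremal_p, extremal_E in E by assumption; discriminate.
  - rewrite !extremal_E in E by assumption. apply Some_inj in E.
    assert (Dz := den_neq_0 z Hz Nz). assert (Dw := den_neq_0 w Hw Nw).
    assert (K : (z * den w - w * den z)%C = RtoC 0).
    { transitivity ((z / den z - w / den w) * den z * den w)%C; [field; now split|].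
      rewrite E. ring. }
    rewrite !den_E in K.
    replace (z * (1 - RtoC P * w + w * w) - w * (1 - RtoC P * z + z * z))%C
      with ((z - w) * (1 - z * w))%C in K by ring.
    destruct (classic ((z - w)%C = RtoC 0)) as [Q|Q].
    + transitivity (z - w + w)%C; [ring | rewrite Q; ring].
    + exfalso. assert (Q' : (1 - z * w)%C = RtoC 0).
      { apply NNPP; intros N. exact (Cmult_neq_0 _ _ Q N K). }
      assert (M : Cmod (z * w) = 1).
      { replace (z * w)%C with (1 - (1 - z * w))%C by ring. rewrite Q'.
        replace (1 - 0)%C with (RtoC 1) by ring. apply Cmod_1. }
      rewrite Cmod_mult in M. assert (A := Cmod_ge_0 z). assert (B := Cmod_ge_0 w). nra.
Qed.

Lemma sum_inv_gt_2 : 2 < P.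
Proof.
  apply Rmult_lt_reg_r with p; [lra|]. replace ((p + / p) * p) with (p * p + 1) by (field; lra). nra.
Qed.

(** [z + 1 / z] takes on the unit circle, and nowhere inside, the real values
    between -2 and 2. *)
Lemma extremal_omitted_iff (w : C) :
  omitted_set unit_disc extremal w <->
  exists x : R, w = RtoC x /\ / (2 - P) <= x <= / (- 2 - P).
Proof.
  assert (HP := sum_inv_gt_2). split.
  - intros Om.
    assert (Nw : w <> RtoC 0).
    { intros ->. apply Om. exists (RtoC 0). split; [unfold unit_disc; rewrite Cmod_0; lra|].
      rewrite extremal_E by (intros E; apply RtoC_inj in E; lra). f_equal. unfold Cdiv; ring. }
    set (T := (/ w + RtoC P)%C).
    assert (root : forall z z' : C, (z + z')%C = T -> (z * z')%C = RtoC 1 -> 1 <= Cmod z).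
    { intros z z' Sz Pz. apply Rnot_lt_le; intros Hz. apply Om. exists z. split; [exact Hz|].
      assert (Nz : z <> RtoC 0) by (intros ->; apply C1_nz; rewrite <- Pz; ring).
      assert (Dz : (den z * w)%C = z).
      { rewrite den_E, <- Pz.
        replace (z * z' - RtoC P * z + z * z)%C with (z * (z + z') - RtoC P * z)%C by ring.
        rewrite Sz. unfold T. field. exact Nw. }
      assert (Np : z <> RtoC p).
      { intros ->. apply RtoC_p_neq_0. rewrite <- Dz. unfold extremal_denominator.
        field. apply RtoC_p_neq_0. }
      rewrite extremal_E by assumption. f_equal.
      assert (D0 := den_neq_0 z Hz Np).
      rewrite <- Dz at 1. field. exact D0. }
    destruct (Csqrt_exists (T * T - 4)) as [s Hs].
    set (z1 := ((T + s) / 2)%C). set (z2 := ((T - s) / 2)%C).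
    assert (Two : RtoC 2 <> RtoC 0) by (intros E; apply RtoC_inj in E; lra).
    assert (Sm : (z1 + z2)%C = T) by (unfold z1, z2; field; exact Two).
    assert (Pr : (z1 * z2)%C = RtoC 1).
    { transitivity ((T * T - s * s) / 4)%C.
      - unfold z1, z2. field.
      - rewrite Hs. field. }
    assert (R1 := root z1 z2 Sm Pr).
    assert (R2 : 1 <= Cmod z2) by (apply (root z2 z1); [rewrite <- Sm | rewrite <- Pr]; ring).
    assert (M : Cmod z1 * Cmod z2 = 1) by (rewrite <- Cmod_mult, Pr; apply Cmod_1).
    assert (M1 : Cmod z1 = 1) by nra.
    assert (Cj : (z1 * Cconj z1)%C = RtoC 1) by (rewrite <- Cmod2_conj, M1; f_equal; ring).
    assert (Z2 : z2 = Cconj z1).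
    { transitivity ((z1 * Cconj z1) * z2)%C; [rewrite Cj; ring|].
      transitivity ((z1 * z2) * Cconj z1)%C; [ring | rewrite Pr; ring]. }
    set (t := 2 * Re z1).
    assert (Tt : T = RtoC t).
    { rewrite <- Sm, Z2. unfold t. apply injective_projections; simpl; unfold Re; ring. }
    assert (Ht : -2 <= t <= 2).
    { assert (A := re_le_Cmod z1). rewrite M1 in A. apply Rabs_le_between in A. unfold t; lra. }
    assert (Iw : (/ w)%C = RtoC (t - P)).
    { rewrite RtoC_minus, <- Tt. unfold T. ring. }
    exists (/ (t - P)). split.
    + rewrite RtoC_inv by lra. rewrite <- Iw. field. exact Nw.
    + assert (K : forall x y, x <= y -> y < 0 -> / y <= / x).
      { intros x y Hxy Hy. rewrite <- (Ropp_involutive x), <- (Ropp_involutive y), !(Rinv_opp (- _)).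
        apply Ropp_le_contravar, Rinv_le_contravar; lra. }
      split; apply K; lra.
  - intros [x [-> Hx]] [z [Hz E]].
    unfold unit_disc in Hz.
    assert (x0 : x < 0).
    { apply Rle_lt_trans with (/ (- 2 - P)); [lra|]. apply Rinv_lt_0_compat; lra. }
    assert (Np : z <> RtoC p) by (intros ->; rewrite extremal_p in E; discriminate).
    rewrite extremal_E in E by assumption. apply Some_inj in E.
    assert (D0 := den_neq_0 z Hz Np).
    set (t := / x + P).
    assert (Ix : x * / x = 1) by (apply Rinv_r; lra).
    assert (I0 : / x < 0) by (now apply Rinv_lt_0_compat).
    assert (Ht : -2 <= t <= 2).
    { assert (J1 : / (2 - P) * (2 - P) = 1) by (apply Rinv_l; lra).
      assert (J2 : / (- 2 - P) * (- 2 - P) = 1) by (apply Rinv_l; lra).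
      unfold t; split; nra. }
    assert (Q : (z * z - RtoC t * z + 1)%C = RtoC 0).
    { assert (zE : z = (RtoC x * den z)%C) by (rewrite <- E; field; exact D0).
      assert (Nx : RtoC x <> RtoC 0) by (intros K; apply RtoC_inj in K; lra).
      transitivity (den z - z / RtoC x)%C.
      - rewrite den_E. unfold t. rewrite RtoC_plus, RtoC_inv by lra. field. exact Nx.
      - rewrite zE at 2. field. exact Nx. }
    destruct z as [u v].
    assert (Q1 : u * u - v * v - t * u + 1 = 0).
    { apply (f_equal fst) in Q. simpl in Q. lra. }
    assert (Q2 : v * (2 * u - t) = 0).
    { apply (f_equal snd) in Q. simpl in Q. lra. }
    assert (Nm : u * u + v * v < 1).
    { assert (A := Cmod2_alt (u, v)). simpl in A. assert (B := Cmod_ge_0 (u, v)). nra. }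
    apply Rmult_integral in Q2 as [V|V].
    + subst v. assert (-1 < u < 1) by (split; nra).
      destruct (Rle_dec 0 u).
      * assert (t * u <= 2 * u) by nra. assert (0 < (1 - u) ^ 2) by (apply pow_lt; lra). nra.
      * assert (t * u <= - 2 * u) by nra. assert (0 < (1 + u) ^ 2) by (apply pow_lt; lra). nra.
    + replace t with (2 * u) in Q1 by lra. nra.
Qed.

Lemma extremal_concave : concave_normalized p extremal.
Proof.
  split.
  - intros z Hz. destruct (excluded_middle_informative (z = RtoC p)) as [->|N].
    + right; apply extremal_pole.
    + left. unfold unit_disc in Hz.
      assert (M : 0 < Cmod (z - RtoC p)).
      { apply Cmod_gt_0. intros E. apply N. transitivity (z - RtoC p + RtoC p)%C; [ring | rewrite E; ring]. }
      apply locally_Cmod. exists (Rmin (Cmod (z - RtoC p)) (1 - Cmod z)); split; [apply Rmin_glb_lt; lra|].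
      intros w Hw.
      assert (W1 : Cmod (w - z) < Cmod (z - RtoC p)) by (eapply Rlt_le_trans; [exact Hw | apply Rmin_l]).
      assert (W2 : Cmod (w - z) < 1 - Cmod z) by (eapply Rlt_le_trans; [exact Hw | apply Rmin_r]).
      apply extremal_differentiable.
      * assert (T := Cmod_triangle (w - z) z). replace (w - z + z)%C with w in T by ring. lra.
      * intros ->. rewrite <- Cmod_opp in W1.
        replace (- (RtoC p - z))%C with (z - RtoC p)%C in W1 by ring. lra.
  - exact extremal_injective.
  - intros u v t Hu Hv Ht.
    apply extremal_omitted_iff in Hu as [x [-> Hx]].
    apply extremal_omitted_iff in Hv as [y [-> Hy]].
    apply extremal_omitted_iff. exists (t * x + (1 - t) * y). split.
    + rewrite RtoC_plus, !RtoC_mult. reflexivity.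
    + nra.
  - rewrite extremal_E by (intros E; apply RtoC_inj in E; lra). f_equal. unfold Cdiv; ring.
  - assert (N : RtoC 0 <> RtoC p) by (intros E; apply RtoC_inj in E; lra).
    apply (is_derive_CC_ext_loc (fun w => w / den w)%C); [now apply extremal_loc|].
    destruct (is_derive_den (RtoC 0)) as [l Hl].
    assert (D1 : den (RtoC 0) = RtoC 1).
    { unfold extremal_denominator. field. apply RtoC_p_neq_0. }
    eapply is_derive_CC_eq.
    + apply is_derive_Cmult; [apply is_derive_Cid|].
      apply (is_derive_CC_comp (fun w => / w)%C den); [|exact Hl].
      apply is_derive_Cinv_id. rewrite D1. apply C1_nz.
    + change (RtoC 1 * / den (RtoC 0) + RtoC 0 * (l * - / (den (RtoC 0) * den (RtoC 0))) = RtoC 1)%C.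
      rewrite D1. field.
  - exact extremal_pole.
Qed.

Definition extremal_coefficient (n : nat) : C := RtoC ((/ p ^ n - p ^ n) / (/ p - p)).

Lemma inv_minus_pos : 0 < / p - p.
Proof.
  apply Rmult_lt_reg_r with p; [lra|]. replace ((/ p - p) * p) with (1 - p * p) by (field; lra). nra.
Qed.

(** Partial fractions: [f] is a multiple of the difference of two geometric
    series. *)
Lemma extremal_expansion : expansion p extremal extremal_coefficient.
Proof.
  intros z Hz. assert (K := inv_minus_pos).
  assert (N : z <> RtoC p).
  { intros ->. rewrite Cmod_R, Rabs_pos_eq in Hz; lra. }
  assert (D0 : den z <> RtoC 0) by (apply den_neq_0; trivial; lra).
  exists (z / den z)%C. split; [now apply extremal_E|].
  assert (g1 : Cmod (RtoC (/ p) * z) < 1).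
  { rewrite Cmod_mult, Cmod_R, Rabs_pos_eq by (left; apply Rinv_0_lt_compat; lra).
    apply Rmult_lt_reg_l with p; [lra|]. rewrite <- Rmult_assoc, Rinv_r by lra. lra. }
  assert (g2 : Cmod (RtoC p * z) < 1).
  { rewrite Cmod_mult, Cmod_R, Rabs_pos_eq by lra. assert (M := Cmod_ge_0 z). nra. }
  assert (S := is_series_scal (K := C_AbsRing) (V := C_NormedModule) (RtoC (/ (/ p - p))) _ _
     (is_series_minus (K := C_AbsRing) (V := C_NormedModule) _ _ _ _
        (is_series_geom_C _ g1) (is_series_geom_C _ g2))).
  unfold is_pseries.
  assert (Nk : RtoC (/ p - p) <> RtoC 0) by (intros E; apply RtoC_inj in E; lra).
  replace (z / den z)%C with
    (scal (K := C_Ring) (V := C_ModuleSpace) (RtoC (/ (/ p - p)))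
      (minus (G := C_AbelianGroup) (/ (1 - RtoC (/ p) * z))%C (/ (1 - RtoC p * z))%C)).
  - eapply is_series_ext; [|exact S]. intros n.
    change (RtoC (/ (/ p - p)) * ((RtoC (/ p) * z) ^ n - (RtoC p * z) ^ n) =
            z ^ n * RtoC ((/ p ^ n - p ^ n) / (/ p - p)))%C.
    rewrite !Cpow_mult_l, <- !RtoC_pow, pow_inv.
    unfold Rdiv. rewrite RtoC_mult, RtoC_minus. ring.
  - change (RtoC (/ (/ p - p)) * (/ (1 - RtoC (/ p) * z) - / (1 - RtoC p * z)) = z / den z)%C.
    unfold extremal_denominator in *.
    rewrite RtoC_inv by lra. rewrite RtoC_minus in *. rewrite RtoC_inv in * by lra.
    assert (P0 := RtoC_p_neq_0).
    assert (N1 : (1 - z / RtoC p)%C <> RtoC 0) by (intros E; apply D0; rewrite E; ring).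
    assert (N2 : (1 - RtoC p * z)%C <> RtoC 0) by (intros E; apply D0; rewrite E; ring).
    assert (N1' : (RtoC p - z)%C <> RtoC 0).
    { intros E; apply N1. transitivity ((RtoC p - z) / RtoC p)%C; [field; exact P0 | rewrite E].
      unfold Cdiv; ring. }
    assert (N3 : (1 - RtoC p * RtoC p)%C <> RtoC 0).
    { intros E. apply Nk. transitivity ((1 - RtoC p * RtoC p) / RtoC p)%C; [field; exact P0 | rewrite E].
      unfold Cdiv; ring. }
    field. repeat split; assumption.
Qed.

Lemma extremal_coefficients :
  (extremal_coefficient 3 - extremal_coefficient 2 * extremal_coefficient 2)%C = RtoC (-1).
Proof.
  assert (K := inv_minus_pos). unfold extremal_coefficient.
  rewrite <- RtoC_mult, <- RtoC_minus. f_equal.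
  assert (1 - p * p <> 0) by nra. simpl. field. split; [|lra]. nra.
Qed.

End Extremal.

Theorem corollary4 (p : R) (hp : 0 < p < 1) :
  (forall (f : C -> sphere) (a : nat -> C),
      concave_normalized p f -> expansion p f a ->
      Cmod (a 3%nat - a 2%nat * a 2%nat)%C <= 1) /\
  (exists (f : C -> sphere) (a : nat -> C),
      concave_normalized p f /\ expansion p f a /\
      Cmod (a 3%nat - a 2%nat * a 2%nat)%C = 1).
Proof.
  split.
  - intros f a Hf Ha. exact (fekete_szego_bound p f a hp Hf Ha).
  - exists (extremal p), (extremal_coefficient p). split; [now apply extremal_concave|].
    split; [now apply extremal_expansion|].
    rewrite extremal_coefficients by assumption. rewrite Cmod_R. apply Rabs_m1.
Qed.
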